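(* Let $a \in \mathbb{R}$ and let $\mathcal{S}_a$ denote the structure $(\mathbb{R},<,+,\mathbb{Z},\lambda_a)$, where $\lambda_a:\mathbb{R}\to\mathbb{R}$ is the function $x \mapsto ax$ and $\mathbb{Z}$ is a unary predicate for the set of integers. Then the first order theory of $\mathcal{S}_a$ is decidable if and only if $a$ is quadratic.
   Context: A real number $a$ is called quadratic if it is a solution of a quadratic equation with rational coefficients (in particular, every rational number is quadratic). *)

(* Defs.v *)
From HB Require Import structures.
From mathcomp Require Import all_boot all_order all_algebra.
From mathcomp Require Import reals.

Set Implicit Arguments.
Unset Strict Implicit.
Unset Printing Implicit Defensive.

Import Order.TTheory GRing.Theory Num.Theory.

(* The language has the symbols <, +, a unary predicate for the integers and a
   unary function symbol [Lam], interpreted in [S_ a] as multiplication by [a]. *)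
Inductive term : Type :=
| Var of nat
| Add of term & term
| Lam of term.

(* The remaining connectives and the universal quantifier are the usual
   classical abbreviations.  Variables are named: [FEx x p] binds [Var x]. *)
Inductive formula : Type :=
| FEq of term & term
| FLt of term & term
| FInt of term
| FNot of formula
| FAnd of formula & formula
| FEx of nat & formula.

Fixpoint term_vars (t : term) : seq nat :=
  match t with
  | Var x => [:: x]
  | Add t1 t2 => term_vars t1 ++ term_vars t2
  | Lam t1 => term_vars t1
  end.

Fixpoint free_vars (p : formula) : seq nat :=
  match p with
  | FEq t1 t2 | FLt t1 t2 => term_vars t1 ++ term_vars t2
  | FInt t => term_vars t
  | FNot q => free_vars q
  | FAnd q r => free_vars q ++ free_vars r
  | FEx x q => [seq y <- free_vars q | y != x]
  end.

Definition sentence (p : formula) : Prop := free_vars p = [::].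

Record structure : Type := Structure {
  carrier : Type;
  lt_interp : carrier -> carrier -> Prop;
  add_interp : carrier -> carrier -> carrier;
  int_interp : carrier -> Prop;
  lam_interp : carrier -> carrier
}.

Fixpoint eval (M : structure) (e : nat -> carrier M) (t : term) : carrier M :=
  match t with
  | Var x => e x
  | Add t1 t2 => add_interp (eval e t1) (eval e t2)
  | Lam t1 => lam_interp (eval e t1)
  end.

Definition update (T : Type) (e : nat -> T) (x : nat) (c : T) : nat -> T :=
  fun y => if y == x then c else e y.

Fixpoint sat (M : structure) (e : nat -> carrier M) (p : formula) : Prop :=
  match p with
  | FEq t1 t2 => eval e t1 = eval e t2
  | FLt t1 t2 => lt_interp (eval e t1) (eval e t2)
  | FInt t => int_interp (eval e t)
  | FNot q => ~ sat e q
  | FAnd q r => sat e q /\ sat e r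
  | FEx x q => exists c : carrier M, sat (update e x c) q
  end.

Definition theory (M : structure) (p : formula) : Prop :=
  sentence p /\ forall e : nat -> carrier M, sat e p.

(* The total recursive functions: the least class containing the zero,
   successor and projection functions and closed under composition, primitive
   recursion and minimization of regular functions. *)
Inductive recursive : forall n : nat, (n.-tuple nat -> nat) -> Prop :=
| rec_zero n : @recursive n (fun _ => 0)
| rec_succ : @recursive 1 (fun v => (thead v).+1)
| rec_proj n (i : 'I_n) : @recursive n (fun v => tnth v i)
| rec_comp m n (g : m.-tuple nat -> nat) (h : 'I_m -> n.-tuple nat -> nat) :
    recursive g -> (forall i, recursive (h i)) ->
    @recursive n (fun v => g [tuple h i v | i < m])
| rec_prim n (g : n.-tuple nat -> nat) (h : n.+2.-tuple nat -> nat)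
    (f : n.+1.-tuple nat -> nat) :
    recursive g -> recursive h ->
    (forall v : n.-tuple nat, f [tuple of 0 :: v] = g v) ->
    (forall y (v : n.-tuple nat),
       f [tuple of y.+1 :: v] = h [tuple of y :: f [tuple of y :: v] :: v]) ->
    recursive f
| rec_min n (g : n.+1.-tuple nat -> nat) (f : n.-tuple nat -> nat) :
    recursive g ->
    (forall v : n.-tuple nat, g [tuple of f v :: v] = 0) ->
    (forall (v : n.-tuple nat) y, y < f v -> g [tuple of y :: v] <> 0) ->
    recursive f.

Definition recursive_set (A : nat -> Prop) : Prop :=
  exists f : 1.-tuple nat -> nat,
    [/\ recursive f,
        forall n, A n -> f [tuple n] = 1
      & forall n, ~ A n -> f [tuple n] = 0].

(* Goedel numbers; [CodeSeq.code [:: n1; ...; nk]] is the (primitive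
   recursive) bijective code 2 ^ n1 * (2 * (2 ^ n2 * (...)) + 1) of finite
   sequences of natural numbers. *)
Fixpoint term_code (t : term) : nat :=
  match t with
  | Var x => CodeSeq.code [:: 0; x]
  | Add t1 t2 => CodeSeq.code [:: 1; term_code t1; term_code t2]
  | Lam t1 => CodeSeq.code [:: 2; term_code t1]
  end.

Fixpoint formula_code (p : formula) : nat :=
  match p with
  | FEq t1 t2 => CodeSeq.code [:: 0; term_code t1; term_code t2]
  | FLt t1 t2 => CodeSeq.code [:: 1; term_code t1; term_code t2]
  | FInt t => CodeSeq.code [:: 2; term_code t]
  | FNot q => CodeSeq.code [:: 3; formula_code q]
  | FAnd q r => CodeSeq.code [:: 4; formula_code q; formula_code r]
  | FEx x q => CodeSeq.code [:: 5; x; formula_code q]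
  end.

Lemma term_code_inj : injective term_code.
Proof.
elim=> [x|t1 IH1 t2 IH2|t IH] [y|u1 u2|u] /(can_inj CodeSeq.codeK) //.
- by case=> ->.
- by case=> /IH1 -> /IH2 ->.
- by case=> /IH ->.
Qed.

Lemma formula_code_inj : injective formula_code.
Proof.
elim=> [t1 t2|t1 t2|t|q IHq|q IHq r IHr|x q IHq]
  [u1 u2|u1 u2|u|q'|q' r'|y q'] /(can_inj CodeSeq.codeK) //.
- by case=> /term_code_inj -> /term_code_inj ->.
- by case=> /term_code_inj -> /term_code_inj ->.
- by case=> /term_code_inj ->.
- by case=> /IHq ->.
- by case=> /IHq -> /IHr ->.
- by case=> -> /IHq ->.
Qed.

Definition decidable_theory (T : formula -> Prop) : Prop :=
  recursive_set (fun n => exists2 p, T p & formula_code p = n).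

Local Open Scope ring_scope.

Definition S_ (R : realType) (a : R) : structure :=
  @Structure R (fun x y => x < y) (fun x y => x + y)
    (fun x => x \is a Num.int) (fun x => a * x).

Definition quadratic (R : realType) (a : R) : Prop :=
  exists u v w : rat,
    u != 0 /\ ratr u * a ^+ 2 + ratr v * a + ratr w = 0.

(* Main.v *)
(* If [a] is quadratic, then it lies in Q(b) for some [b > 1] whose conjugate is
   [1 / b], that is [b ^ 2 = t * b - 1] with an integer [t]. Reals are represented by streams of pairs
   of base-[b] digits, one digit of the integral part and one of the fractional
   part. A linear relation with coefficients in [Z[b]] then only needs finitely
   many carries, an integer is a number whose two halves mirror each other, and
   the order is read off the signs of the digits. So the atomic formulas are
   recognized by finite semigroups in the sense of Buechi; complement, conjunction
   and projection (power semigroup, Ramsey's theorem) are computable on them.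

   If [a] is not quadratic, then [1, a, a ^ 2] are linearly independent over Q, and
   by Kronecker's theorem the points [(n * a, n * a ^ 2)] are dense modulo 1. A real
   [d] selects the indices [j] for which [j * a] is very close to [d] modulo 1, and
   the chain of selected indices can be built so that the values [j * a ^ 2] modulo 1
   approximate any finite sequence of multiples of [a]. Hence every finite relation
   on the naturals is coded by four reals, so that every recursive function is
   definable in [S_ a], and a diagonal sentence refutes any decision procedure. *)

Require Import Defs.
From mathcomp Require Import all_boot all_order all_algebra.
From mathcomp Require Import boolp classical_sets reals.
From mathcomp Require Import zify ring lra.

Set Implicit Arguments.
Unset Strict Implicit.
Unset Printing Implicit Defensive.
Import Order.TTheory GRing.Theory Num.Theory.

(** * Recursive functions of an environment *)

(** A carry is an element [p + q * b] of [Z[b]]; to leave finitely many, both of its real embeddings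
    must be bounded. This is why [b] is a unit with conjugate [1 / b]: where the carry recurrence
    expands under one embedding it contracts under the other. For irrational [a] the unit comes from
    Pell's equation; for rational [a] any such unit does. Digits are signed and redundant, so that a
    linear relation can be formed digit by digit and only null expansions need to be recognized.
    Recognizers are natural numbers, because the procedure that combines them has to be recursive in
    the literal sense.

    In the other direction the difficulty is that one real [d] must select indices of every size,
    with a tolerance that is definable from the index alone. The tolerance is built from two
    quantities: the least distance to the integers of the first [j] multiples of [a], and the time
    after which the multiples of [(a, a ^ 2)] come close to every point of the torus. A larger index
    gets a much smaller tolerance, which keeps the unselected indices out. Coding finite relations
    is then needed for primitive recursion only, where the relation is the table of values. *)

Definition scons (T : Type) (x : T) (e : nat -> T) (n : nat) : T :=
  if n is m.+1 then e m else x.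

(** Functions of an infinite environment, of which finitely many entries matter: closure properties
    can be stated for expressions in [e], without bookkeeping of arities. *)
Definition Rec (F : (nat -> nat) -> nat) : Prop :=
  exists n (g : n.-tuple nat -> nat),
    recursive g /\ forall e, F e = g [tuple e (val i) | i < n].

Lemma Rec_ext F G : (forall e, F e = G e) -> Rec F -> Rec G.
Proof. by move=> FG [n [g [rg Fg]]]; exists n, g; split=> // e; rewrite -FG. Qed.

Lemma Rec_widen n (g : n.-tuple nat -> nat) N : n <= N -> recursive g ->
  exists2 h : N.-tuple nat -> nat, recursive h &
    forall e : nat -> nat, h [tuple e (val i) | i < N] = g [tuple e (val i) | i < n].
Proof.
move=> le_nN rg.
exists (fun v => g [tuple tnth v (widen_ord le_nN i) | i < n]).
  by apply: (rec_comp (h := fun i v => tnth v (widen_ord le_nN i))) => // i; apply: rec_proj.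
by move=> e; congr g; apply: eq_from_tnth => i; rewrite !tnth_mktuple.
Qed.

Lemma Rec_var i : Rec (fun e => e i).
Proof.
exists i.+1, (fun v => tnth v (@Ordinal i.+1 i (ltnSn i))); split; first exact: rec_proj.
by move=> e; rewrite tnth_mktuple.
Qed.

(** [G] reads finitely many entries, so the arities of the relevant [A i] have a common bound
    [N]. *)
Lemma Rec_subst (G : (nat -> nat) -> nat) (A : nat -> (nat -> nat) -> nat) :
  Rec G -> (forall i, Rec (A i)) -> Rec (fun e => G (fun i => A i e)).
Proof.
move=> [n [g [rg Gg]]] rA.
have /boolp.choice [k rA1] : forall i, exists n (g : n.-tuple nat -> nat),
    recursive g /\ forall e, A i e = g [tuple e (val i) | i < n] by move=> i; exact: rA.
pose N := \max_(i < n) k i.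
have /boolp.choice [h hP] : forall i : 'I_n, exists h : N.-tuple nat -> nat,
    recursive h /\ forall e, A (val i) e = h [tuple e (val i) | i < N].
  move=> i; have [g' [rg' Ag']] := rA1 (val i).
  have [h rh hh] := Rec_widen (leq_bigmax i : k i <= N) rg'.
  by exists h; split=> // e; rewrite hh.
exists N, (fun v => g [tuple h i v | i < n]); split.
  by apply: rec_comp => // i; case: (hP i).
move=> e; rewrite Gg; congr g; apply: eq_from_tnth => i; rewrite !tnth_mktuple.
by case: (hP i).
Qed.

Lemma Rec_succ A : Rec A -> Rec (fun e => (A e).+1).
Proof.
move=> rA; apply: (@Rec_subst (fun e => (e 0).+1) (fun=> A)) => //.
by exists 1, (fun v => (thead v).+1); split=> [|e]; [exact: rec_succ | rewrite /thead tnth_mktuple].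
Qed.

Lemma Rec_const c : Rec (fun=> c).
Proof.
elim: c => [|c IH]; last exact: Rec_succ.
by exists 0, (fun=> 0); split=> //; exact: rec_zero.
Qed.

Lemma tuple_scons (T : Type) n x (e : nat -> T) :
  [tuple scons x e (val i) | i < n.+1] = [tuple of x :: [tuple e (val i) | i < n]].
Proof.
apply: eq_from_tnth => i; rewrite tnth_mktuple (tnth_nth x).
case: i => [[|i] /= lti] //.
by rewrite (nth_map (Ordinal (lti : i < n))) ?size_enum_ord // nth_enum_ord.
Qed.

Definition shift (e : nat -> nat) i := e i.+1.

Lemma tuple_env n (v : n.-tuple nat) : [tuple nth 0 v (val i) | i < n] = v.
Proof. by apply: eq_from_tnth => i; rewrite tnth_mktuple (tnth_nth 0). Qed.

Lemma Rec_prim B S N : Rec B -> Rec (fun e => S (e 0) (e 1) (shift (shift e))) -> Rec N ->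
  Rec (fun e => nat_rec (fun=> nat) (B e) (fun k r => S k r e) (N e)).
Proof.
move=> [n1 [g1 [rg1 B1]]] [n2 [g2 [rg2 S2]]] rN.
(* The number of iterations is first made the variable 0; [N] is substituted for it afterwards. *)
pose F e := nat_rec (fun=> nat) (B (shift e)) (fun k r => S k r (shift e)) (e 0).
suff rF : Rec F.
  apply: (@Rec_ext (fun e => F (fun i => scons (N e) e i))) => //.
  apply: (@Rec_subst F (fun i e => scons (N e) e i)) => // -[|i] //=; exact: Rec_var.
pose n := maxn n1 n2.
have [b rb bE] := Rec_widen (leq_maxl n1 n2) rg1.
have [h rh hE] := Rec_widen (leq_trans (leq_maxr n1 n2) (leqW (leqnSn _)) : n2 <= n.+2) rg2.
exists n.+1, (fun v => F (nth 0 v)); split; last first.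
  move=> e; have E : forall e, F e = nat_rec (fun=> nat) (b [tuple shift e (val i) | i < n])
      (fun k r => h [tuple of k :: [tuple of r :: [tuple shift e (val i) | i < n]]]) (e 0).
    move=> e'; rewrite /F; elim: (e' 0) => [|k IH] /=; first by rewrite B1 bE.
    rewrite IH; set r := nat_rec _ _ _ _.
    by rewrite (S2 (scons k (scons r (shift e')))) -hE !tuple_scons.
  rewrite !E; rewrite (_ : [tuple shift (nth 0 _) (val i) | i < n] = [tuple shift e (val i) | i < n]).
    by congr (nat_rec _ _ _ _); rewrite (nth_map ord0) ?size_enum_ord //= nth_enum_ord.
  apply: eq_from_tnth => i; rewrite !tnth_mktuple /shift.
  by rewrite (nth_map ord0) ?size_enum_ord //= ?nth_enum_ord ?ltnS.
apply: (@rec_prim _ b h) => // [v|y v].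
  rewrite /F /= B1 -bE; congr b.
  by rewrite -[RHS]tuple_env; apply: eq_from_tnth => i; rewrite !tnth_mktuple.
rewrite /F /=; set r := nat_rec _ _ _ _.
have := S2 (scons y (scons r (nth 0 v))); rewrite -hE !tuple_scons tuple_env /= => <-.
by congr (S _ _ _); apply: funext.
Qed.

Lemma Rec_min P F : Rec (fun e => (P (e 0) (shift e) : bool)) ->
  (forall e, P (F e) e) -> (forall e y, y < F e -> ~~ P y e) -> Rec F.
Proof.
move=> [n [g [rg Pg]]] F1 F2.
have [g' rg' g'E] := Rec_widen (leqnSn n) rg.
have PE y e : (P y e : nat) = g' [tuple of y :: [tuple e (val i) | i < n]].
  by rewrite -tuple_scons g'E -Pg; congr (nat_of_bool (P _ _)); apply: funext.
have PE' y (v : n.-tuple nat) : g' [tuple of y :: v] = P y (nth 0 v) :> nat.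
  by rewrite PE tuple_env.
have rF : recursive (fun v : n.-tuple nat => F (nth 0 v)).
  apply: (@rec_min _ (fun v => (g' v == 0) : nat)).
  (* [rec_min] looks for a zero, whereas [P] has the value 1 where it holds; [d] is the exchange of
     zero and nonzero. *)
  - pose d v := nat_rec (fun=> nat) 1 (fun _ _ => 0) v.
    have [m [s [rs sE]]] : Rec (fun e => d (e 0)).
      by apply: Rec_prim; [exact: Rec_const | exact: Rec_const | exact: Rec_var].
    have [s' rs' s'E] := Rec_widen (leq_maxl m 1) rs.
    suff -> : (fun v => nat_of_bool (g' v == 0)) =
              (fun v => s' [tuple g' v | i < maxn m 1]).
      by apply: (rec_comp (h := fun _ => g')).
    by apply: funext => v; rewrite (s'E (fun=> g' v)) -(sE (fun=> g' v)); case: (g' v).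
  - by move=> v; rewrite (PE' (F (nth 0 v)) v) F1.
  - by move=> v y /F2; rewrite (PE' y v); case: (P y (nth 0 v)).
(* [F e] is the least witness of [P], and [P] reads only the first entries of [e]; hence so does
   [F]. *)
have FE e : F e = F (nth 0 [tuple e (val i) | i < n]).
  set e' := nth 0 _.
  have PP y : P y e = P y e'.
    by have := PE y e; rewrite PE' -/e'; case: (P y e); case: (P y e').
  by case: (ltngtP (F e) (F e')) => // /F2; [rewrite -PP | rewrite PP]; rewrite F1.
by exists n, (fun v => F (nth 0 v)).
Qed.

Lemma Rec_comp1 (f : nat -> nat) A :
  Rec (fun e => f (e 0)) -> Rec A -> Rec (fun e => f (A e)).
Proof. by move=> rf rA; apply: (@Rec_subst (fun e => f (e 0)) (fun=> A)). Qed.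

Lemma Rec_comp2 (f : nat -> nat -> nat) A B :
  Rec (fun e => f (e 0) (e 1)) -> Rec A -> Rec B -> Rec (fun e => f (A e) (B e)).
Proof.
move=> rf rA rB.
by apply: (@Rec_subst (fun e => f (e 0) (e 1)) (fun i => if i is 0 then A else B)) => // -[].
Qed.

Lemma Rec_comp3 (f : nat -> nat -> nat -> nat) A B C :
  Rec (fun e => f (e 0) (e 1) (e 2)) -> Rec A -> Rec B -> Rec C ->
  Rec (fun e => f (A e) (B e) (C e)).
Proof.
move=> rf rA rB rC.
by apply: (@Rec_subst (fun e => f (e 0) (e 1) (e 2))
  (fun i => if i is i.+1 then if i is 0 then B else C else A)) => // -[|[]].
Qed.

Lemma Rec_comp4 (f : nat -> nat -> nat -> nat -> nat) A B C D :
  Rec (fun e => f (e 0) (e 1) (e 2) (e 3)) -> Rec A -> Rec B -> Rec C -> Rec D ->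
  Rec (fun e => f (A e) (B e) (C e) (D e)).
Proof.
move=> rf rA rB rC rD.
by apply: (@Rec_subst (fun e => f (e 0) (e 1) (e 2) (e 3))
  (fun i => match i with 0 => A | 1 => B | 2 => C | _ => D end)) => // -[|[|[]]].
Qed.

Lemma Rec_add A B : Rec A -> Rec B -> Rec (fun e => A e + B e).
Proof.
apply: Rec_comp2; apply: (@Rec_ext (fun e => nat_rec (fun=> nat) (e 1) (fun _ r => r.+1) (e 0))).
  by move=> e; elim: (e 0) => //= n ->; rewrite addSn.
by apply: Rec_prim; [| apply: Rec_succ |]; apply: Rec_var.
Qed.

Lemma Rec_mul A B : Rec A -> Rec B -> Rec (fun e => A e * B e).
Proof.
apply: Rec_comp2; apply: (@Rec_ext (fun e => nat_rec (fun=> nat) 0 (fun _ r => e 1 + r) (e 0))).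
  by move=> e; elim: (e 0) => //= n ->; rewrite mulSn.
by apply: Rec_prim; [exact: Rec_const | apply: Rec_add |]; apply: Rec_var.
Qed.

Lemma Rec_exp A B : Rec A -> Rec B -> Rec (fun e => A e ^ B e).
Proof.
apply: Rec_comp2; apply: (@Rec_ext (fun e => nat_rec (fun=> nat) 1 (fun _ r => e 0 * r) (e 1))).
  by move=> e; elim: (e 1) => //= n ->; rewrite expnS.
by apply: Rec_prim; [exact: Rec_const | apply: Rec_mul |]; apply: Rec_var.
Qed.

Lemma Rec_pred A : Rec A -> Rec (fun e => (A e).-1).
Proof.
apply: Rec_comp1; apply: (@Rec_ext (fun e => nat_rec (fun=> nat) 0 (fun k _ => k) (e 0))).
  by move=> e; case: (e 0).
by apply: Rec_prim; [exact: Rec_const | |]; apply: Rec_var.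
Qed.

Lemma Rec_sub A B : Rec A -> Rec B -> Rec (fun e => A e - B e).
Proof.
apply: Rec_comp2; apply: (@Rec_ext (fun e => nat_rec (fun=> nat) (e 0) (fun _ r => r.-1) (e 1))).
  by move=> e; elim: (e 1) => [|n IH] /=; rewrite ?subn0 // IH subnS.
by apply: Rec_prim; [| apply: Rec_pred |]; apply: Rec_var.
Qed.

Lemma Rec_negb (P : (nat -> nat) -> bool) : Rec P -> Rec (fun e => ~~ P e).
Proof.
move=> rP; apply: (@Rec_ext (fun e => 1 - P e)); first by move=> e; case: (P e).
by apply: Rec_sub => //; apply: Rec_const.
Qed.

Lemma Rec_andb (P Q : (nat -> nat) -> bool) : Rec P -> Rec Q -> Rec (fun e => P e && Q e).
Proof.
move=> rP rQ; apply: (@Rec_ext (fun e => P e * Q e)); last exact: Rec_mul.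
by move=> e; rewrite mulnb.
Qed.

Lemma Rec_orb (P Q : (nat -> nat) -> bool) : Rec P -> Rec Q -> Rec (fun e => P e || Q e).
Proof.
move=> rP rQ; apply: (@Rec_ext (fun e => ~~ (~~ P e && ~~ Q e))).
  by move=> e; rewrite negb_and !negbK.
by apply: Rec_negb; apply: Rec_andb; apply: Rec_negb.
Qed.

Lemma Rec_leq A B : Rec A -> Rec B -> Rec (fun e => A e <= B e).
Proof.
move=> rA rB; apply: (@Rec_ext (fun e => 1 - (A e - B e))).
  by move=> e; rewrite /leq; case: (A e - B e).
by apply: Rec_sub; [exact: Rec_const | exact: Rec_sub].
Qed.

Lemma Rec_ltn A B : Rec A -> Rec B -> Rec (fun e => A e < B e).
Proof. by move=> rA rB; apply: Rec_leq => //; apply: Rec_succ. Qed.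

Lemma Rec_eqn A B : Rec A -> Rec B -> Rec (fun e => A e == B e).
Proof.
move=> rA rB; apply: (@Rec_ext (fun e => (A e <= B e) && (B e <= A e))).
  by move=> e; rewrite eqn_leq.
by apply: Rec_andb; apply: Rec_leq.
Qed.

Lemma Rec_if (P : (nat -> nat) -> bool) A B :
  Rec P -> Rec A -> Rec B -> Rec (fun e => if P e then A e else B e).
Proof.
move=> rP rA rB; apply: (@Rec_ext (fun e => P e * A e + ~~ P e * B e)).
  by move=> e; case: (P e); rewrite ?mul0n ?mul1n ?addn0.
by apply: Rec_add; apply: Rec_mul => //; apply: Rec_negb.
Qed.

Lemma Rec_ifb (P Q S : (nat -> nat) -> bool) :
  Rec P -> Rec Q -> Rec S -> Rec (fun e => if P e then Q e else S e : bool).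
Proof.
move=> rP rQ rS; apply: (@Rec_ext (fun e => if P e then Q e : nat else S e)).
  by move=> e; case: (P e).
exact: Rec_if.
Qed.

Lemma Rec_sum F N : Rec (fun e => F (e 0) (shift e)) -> Rec N ->
  Rec (fun e => \sum_(i < N e) F i e).
Proof.
move=> rF rN.
apply: (@Rec_ext (fun e => nat_rec (fun=> nat) 0 (fun i r => r + F i e) (N e))).
  by move=> e; elim: (N e) => [|n IH] /=; rewrite ?big_ord0 // big_ord_recr IH.
apply: Rec_prim => //; first exact: Rec_const.
apply: Rec_add; first exact: Rec_var.
apply: (@Rec_subst (fun e => F (e 0) (shift e))
          (fun i e => if i is i.+1 then e i.+2 else e 0)) => // -[|i] /=; exact: Rec_var.
Qed.

Lemma Rec_has (P : nat -> (nat -> nat) -> bool) N :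
  Rec (fun e => P (e 0) (shift e)) -> Rec N ->
  Rec (fun e => has (fun i => P i e) (iota 0 (N e))).
Proof.
move=> rP rN; apply: (@Rec_ext (fun e => 0 < \sum_(i < N e) P i e)).
  move=> e; rewrite lt0n sum_nat_eq0 negb_forall; congr nat_of_bool.
  apply/existsP/hasP => [[i Pi]|[i]].
    by exists (val i); [rewrite mem_iota /= | move: Pi; case: (P _ _)].
  by rewrite mem_iota => /= ltiN Pi; exists (Ordinal ltiN); rewrite /= Pi.
by apply: Rec_ltn; [exact: Rec_const | exact: (@Rec_sum (fun i e => P i e))].
Qed.

Lemma Rec_all (P : nat -> (nat -> nat) -> bool) N :
  Rec (fun e => P (e 0) (shift e)) -> Rec N ->
  Rec (fun e => all (fun i => P i e) (iota 0 (N e))).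
Proof.
move=> rP rN; apply: (@Rec_ext (fun e => ~~ has (fun i => ~~ P i e) (iota 0 (N e)))).
  by move=> e; rewrite -all_predC; congr nat_of_bool; apply: eq_all => i /=; rewrite negbK.
by apply: Rec_negb; apply: Rec_has => //; apply: Rec_negb.
Qed.

Lemma Rec_divn A B : Rec A -> Rec B -> Rec (fun e => A e %/ B e).
Proof.
apply: Rec_comp2.
(* The first disjunct makes the search total and gives quotient 0 for divisor 0. *)
apply: (@Rec_min (fun q e => (e 1 == 0) || (e 0 < q.+1 * e 1))).
- by apply: Rec_orb; [apply: Rec_eqn | apply: Rec_ltn]; try apply: Rec_mul;
    try apply: Rec_succ; try exact: Rec_var; exact: Rec_const.
- by move=> e; case: posnP => //= B0; exact: ltn_ceil.
- move=> e y; case: posnP => [->|B0] //=; rewrite -leqNgt leq_divRL //.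
Qed.

Lemma Rec_modn A B : Rec A -> Rec B -> Rec (fun e => A e %% B e).
Proof.
move=> rA rB; apply: (@Rec_ext (fun e => A e - A e %/ B e * B e)).
  by move=> e; rewrite {1}(divn_eq (A e) (B e)) addKn.
by apply: Rec_sub => //; apply: Rec_mul => //; apply: Rec_divn.
Qed.

(** * Pairing, tables and course-of-values recursion *)

(** The operation that [CodeSeq.code] iterates: a nonempty sequence is coded by [pr] of its head and
    the code of its tail, the empty one by 0. *)
Definition pr a b := 2 ^ a * b.*2.+1.
Definition hd n := logn 2 n.
Definition tl n := (n %/ 2 ^ hd n)./2.

Lemma hd_pr a b : hd (pr a b) = a.
Proof.
rewrite /hd /pr lognM ?expn_gt0 // pfactorK // lognE /= dvdn2 /= odd_double /=.
by rewrite addn0.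
Qed.

Lemma tl_pr a b : tl (pr a b) = b.
Proof. by rewrite /tl hd_pr /pr mulKn ?expn_gt0 //= uphalf_double. Qed.

Lemma pr_gt0 a b : 0 < pr a b.
Proof. by rewrite muln_gt0 expn_gt0. Qed.

Lemma pr_ltl a b : a < pr a b.
Proof. by rewrite (leq_trans (ltn_expl a (isT : 1 < 2))) // leq_pmulr. Qed.

Lemma pr_ltr a b : b < pr a b.
Proof.
by apply: leq_trans (leq_pmull _ (expn_gt0 2 a)); rewrite ltnS -addnn leq_addr.
Qed.

Lemma pr_hd_tl n : 0 < n -> pr (hd n) (tl n) = n.
Proof.
move=> n0; rewrite /pr /tl /hd.
have [m om E] := pfactor_coprime (isT : prime 2) n0.
have -> : n %/ 2 ^ logn 2 n = m by rewrite {1}E mulnK ?expn_gt0.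
rewrite [RHS]E mulnC; congr (_ * _).
by rewrite -[RHS]odd_double_half -coprime2n om.
Qed.

Lemma Rec_pr A B : Rec A -> Rec B -> Rec (fun e => pr (A e) (B e)).
Proof.
move=> rA rB; apply: (@Rec_ext (fun e => 2 ^ A e * (2 * B e).+1)).
  by move=> e; rewrite mul2n.
apply: Rec_mul; first by apply: Rec_exp => //; apply: Rec_const.
by apply: Rec_succ; apply: Rec_mul => //; apply: Rec_const.
Qed.

Lemma Rec_hd A : Rec A -> Rec (fun e => hd (A e)).
Proof.
apply: Rec_comp1.
apply: (@Rec_min (fun a e => (e 0 == 0) || ~~ (e 0 %% 2 ^ a.+1 == 0))).
- apply: Rec_orb; [apply: Rec_eqn | apply: Rec_negb; apply: Rec_eqn];
    try apply: Rec_modn; try apply: Rec_exp; try apply: Rec_succ;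
    try exact: Rec_var; exact: Rec_const.
- move=> e; case: posnP => //= e0; rewrite -/(dvdn _ _) /hd.
  by rewrite pfactor_dvdn // ltnn.
- move=> e y; rewrite /hd; case: posnP => [->|e0] //= lty.
  by rewrite negbK -/(dvdn _ _) pfactor_dvdn.
Qed.

Lemma Rec_tl A : Rec A -> Rec (fun e => tl (A e)).
Proof.
move=> rA; apply: (@Rec_ext (fun e => A e %/ 2 ^ hd (A e) %/ 2)).
  by move=> e; rewrite /tl divn2.
by do ?apply: Rec_divn => //; try apply: Rec_exp; try apply: Rec_hd => //; apply: Rec_const.
Qed.

Ltac rec_step := cbv beta;
  lazymatch goal with
  | |- Rec (fun e => e _) => exact: Rec_var
  | |- Rec (fun _ => ?c) => exact: Rec_const
  | |- Rec (fun e => shift _ _) => cbv beta delta [shift]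
  | |- Rec (fun e => if _ then _ else _) => apply: Rec_if
  | |- Rec (fun e => nat_of_bool (if _ then _ else _)) => apply: Rec_ifb
  | |- Rec (fun e => nat_of_bool (_ && _)) => apply: Rec_andb
  | |- Rec (fun e => nat_of_bool (_ || _)) => apply: Rec_orb
  | |- Rec (fun e => nat_of_bool (~~ _)) => apply: Rec_negb
  | |- Rec (fun e => nat_of_bool (_ == _)) => apply: Rec_eqn
  | |- Rec (fun e => nat_of_bool (_ < _)) => apply: Rec_ltn
  | |- Rec (fun e => nat_of_bool (_ <= _)) => apply: Rec_leq
  | |- Rec (fun e => nat_of_bool (has _ (iota 0 _))) => apply: Rec_has
  | |- Rec (fun e => nat_of_bool (all _ (iota 0 _))) => apply: Rec_all
  | |- Rec (fun e => pr _ _) => apply: Rec_pr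
  | |- Rec (fun e => hd _) => apply: Rec_hd
  | |- Rec (fun e => tl _) => apply: Rec_tl
  | |- Rec (fun e => _ + _) => apply: Rec_add
  | |- Rec (fun e => _ * _) => apply: Rec_mul
  | |- Rec (fun e => _ - _) => apply: Rec_sub
  | |- Rec (fun e => _ ^ _) => apply: Rec_exp
  | |- Rec (fun e => _ %/ _) => apply: Rec_divn
  | |- Rec (fun e => _ %% _) => apply: Rec_modn
  | |- Rec (fun e => _.+1) => apply: Rec_succ
  | |- _ => assumption
  end.
Ltac rec_solve := repeat rec_step.

(** The last entry is outermost, so that a table is extended by one [pr]; entry [i] then lies behind
    [n - i.+1] tails. *)
Definition tab n (f : nat -> nat) := nat_rec (fun=> nat) 0 (fun k r => pr (f k) r) n.
Definition get n t i := hd (nat_rec (fun=> nat) t (fun _ r => tl r) (n - i.+1)).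

Lemma get_tab n f i : i < n -> get n (tab n f) i = f i.
Proof.
rewrite /get; elim: n i => // n IH i; rewrite ltnS leq_eqVlt subSS => /orP[/eqP->|lti].
  by rewrite subnn /= hd_pr.
rewrite -IH //; congr hd.
have -> : n - i = (n - i.+1).+1 by rewrite subnSK.
elim: (n - i.+1) => [|k IHk] /=; first by rewrite tl_pr.
by rewrite -IHk.
Qed.

Lemma Rec_tab F N : Rec (fun e => F (e 0) (shift e)) -> Rec N ->
  Rec (fun e => tab (N e) (fun i => F i e)).
Proof.
move=> rF rN; apply: Rec_prim => //; first exact: Rec_const.
apply: Rec_pr; last exact: Rec_var.
apply: (@Rec_subst (fun e => F (e 0) (shift e))
          (fun i e => if i is i.+1 then e i.+2 else e 0)) => // -[|i] /=; exact: Rec_var.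
Qed.

Lemma Rec_get A B C : Rec A -> Rec B -> Rec C -> Rec (fun e => get (A e) (B e) (C e)).
Proof.
move=> rA rB rC; apply: Rec_hd; apply: Rec_prim => //; first by rec_solve.
by rec_solve.
Qed.

Definition arg1 n := hd (tl n).
Definition arg2 n := hd (tl (tl n)).

(** Course-of-values recursion: the table of all earlier values is carried along, and [G] receives
    those at [arg1 n] and [arg2 n], the only places where the code of a term or formula has
    immediate subcodes. *)
Definition hist (G : nat -> nat -> nat -> nat) n :=
  nat_rec (fun=> nat) 0
    (fun k r => pr (G k (get k r (arg1 k)) (get k r (arg2 k))) r) n.
Definition tfold G n := hd (hist G n.+1).

Lemma histS G n : hist G n.+1 =
  pr (G n (get n (hist G n) (arg1 n)) (get n (hist G n) (arg2 n))) (hist G n).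
Proof. by []. Qed.

Lemma hist_tab G n : hist G n = tab n (tfold G).
Proof.
elim: n => // n IH.
transitivity (pr (tfold G n) (hist G n)); first by rewrite /tfold histS hd_pr.
by rewrite IH.
Qed.

Lemma tl_lt n : 0 < n -> tl n < n.
Proof. by move=> n0; have := pr_ltr (hd n) (tl n); rewrite pr_hd_tl. Qed.

Lemma hd_lt n : 0 < n -> hd n < n.
Proof. by move=> n0; have := pr_ltl (hd n) (tl n); rewrite pr_hd_tl. Qed.

Lemma hd_le n : hd n <= n.
Proof. by case: n => [|n] //; rewrite ltnW // hd_lt. Qed.

Lemma tl_le n : tl n <= n.
Proof. by case: n => [|n] //; rewrite ltnW // tl_lt. Qed.

Lemma arg1_lt n : 0 < n -> arg1 n < n.
Proof. by move=> n0; apply: leq_ltn_trans (hd_le _) (tl_lt n0). Qed.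

Lemma arg2_lt n : 0 < n -> arg2 n < n.
Proof. by move=> n0; apply: leq_ltn_trans (hd_le _) (leq_ltn_trans (tl_le _) (tl_lt n0)). Qed.

Lemma tfoldE G n : 0 < n -> tfold G n = G n (tfold G (arg1 n)) (tfold G (arg2 n)).
Proof.
move=> n0; rewrite {1}/tfold histS hd_pr hist_tab !get_tab //.
  exact: arg2_lt.
exact: arg1_lt.
Qed.

Lemma Rec_tfold G N :
  Rec (fun e => G (e 0) (e 1) (e 2) (shift (shift (shift e)))) -> Rec N ->
  Rec (fun e => tfold (fun n x y => G n x y e) (N e)).
Proof.
move=> rG rN; apply: Rec_hd; rewrite /hist; apply: Rec_prim; last exact: Rec_succ.
  exact: Rec_const.
apply: Rec_pr; last exact: Rec_var.
apply: (@Rec_subst (fun e => G (e 0) (e 1) (e 2) (shift (shift (shift e))))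
  (fun i e => match i with 0 => e 0 | 1 => get (e 0) (e 1) (arg1 (e 0))
                         | 2 => get (e 0) (e 1) (arg2 (e 0)) | i.+3 => e i.+2 end)) => //.
move=> [|[|[|i]]] /=; try exact: Rec_var.
  by apply: Rec_get; rewrite /arg1; rec_solve.
by apply: Rec_get; rewrite /arg2; rec_solve.
Qed.

(** * Recognizers of infinite words *)

Lemma infinite_pigeonhole (P : nat -> Prop) (f : nat -> nat) B :
  (forall N, exists2 j, N < j & P j) -> (forall j, f j < B) ->
  exists v, forall N, exists2 j, N < j & P j /\ f j = v.
Proof.
move=> infP fB; apply: contrapT => none.
have /boolp.choice [N NP] : forall v, exists N, forall j, N < j -> P j -> f j <> v.
  move=> v; apply: contrapT => nN; apply: none; exists v => N.
  apply: contrapT => nj; apply: nN; exists N => j ltj Pj fj; apply: nj; by exists j.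
have [j ltj Pj] := infP (\max_(v < B) N v).
apply: (NP (f j) j) => //; apply: leq_ltn_trans ltj.
by apply: (leq_bigmax_cond (F := fun v : 'I_B => N v) (Ordinal (fB j))).
Qed.

(** For additive colourings Ramsey's theorem has a direct proof: call [i] and [j] merged at [n] if
    they have the same colour towards [n]. By additivity they stay merged, and there are at most [B]
    pairwise unmerged positions, since such positions have distinct colours towards any common later
    one. *)
Lemma additive_ramsey (c f : nat -> nat -> nat) B :
  (forall i j, i < j -> c i j < B) ->
  (forall i j k, i < j -> j < k -> c i k = f (c i j) (c j k)) ->
  exists m e, [/\ forall i, m i < m i.+1, 0 < m 0
    & forall i j, i < j -> c (m i) (m j) = e].
Proof.
move=> cB cA.
pose merge i j n := [/\ i < n, j < n & c i n = c j n].
have mergeS i j n n' : merge i j n -> n <= n' -> merge i j n'.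
  move=> [ltin ltjn E]; rewrite leq_eqVlt => /orP[/eqP<-//|ltn].
  split; [exact: ltn_trans ltn | exact: ltn_trans ltn |].
  by rewrite (cA _ n) // (cA j n) // E.
have [i0 i0P] : exists i0, forall N, exists2 j, N < j & exists n, merge i0 j n.
  apply: contrapT => none.
  have /boolp.choice [N NP] : forall i, exists N, forall j n, N < j -> ~ merge i j n.
    move=> i; apply: contrapT => nN; apply: none; exists i => N.
    apply: contrapT => nj; apply: nN; exists N => j n ltj mij.
    by apply: nj; exists j => //; exists n.
  have [s [us ss nm]] : exists s : seq nat, [/\ uniq s, size s = B.+1 &
      forall i j n, i \in s -> j \in s -> merge i j n -> i = j].
    elim: B.+1 => [|b [s [us ss nm]]]; first by exists [::].
    pose x := (\sum_(i <- s) (i + N i)).+1.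
    have ltx i : i \in s -> i < x /\ N i < x.
      move=> si; rewrite /x (big_rem i) //=; split; lia.
    exists (x :: s); split => /=; last 2 first.
    - by rewrite ss.
    - move=> i j n; rewrite !inE => /orP[/eqP->|si] /orP[/eqP->|sj] //.
      + by move=> [? ? E]; case: (NP j x n) => //; have [] := ltx _ sj.
      + by move=> mij; case: (NP i x n) => //; have [] := ltx _ si.
      + exact: nm.
    rewrite us andbT; apply/negP => /ltx []; rewrite ltnn //.
  pose n := (\max_(i <- s) i).+1.
  have ltn i : i \in s -> i < n by move=> si; rewrite ltnS; apply: (leq_bigmax_seq (F := id)).
  have u : uniq [seq c i n | i <- s].
    rewrite map_inj_in_uniq // => i j si sj E; apply: (nm i j n) => //.
    by split=> //; exact: ltn.
  have sub : {subset [seq c i n | i <- s] <= iota 0 B}.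
    by move=> v /mapP[i si ->]; rewrite mem_iota /= cB // ltn.
  by have := uniq_leq_size u sub; rewrite size_map size_iota ss ltnn.
(* Colours are bounded only for increasing pairs; the maximum with [i0.+1] keeps the pigeonhole
   argument within them. *)
have [e eP] : exists e, forall N, exists2 j, N < j &
    (i0 < j /\ exists n, merge i0 j n) /\ c i0 (maxn j i0.+1) = e.
  apply: (@infinite_pigeonhole _ _ B) => [N|j].
    have [j ltj mj] := i0P (maxn N i0).
    by exists j; [exact: leq_ltn_trans (leq_maxl _ _) ltj
                 | split=> //; exact: leq_ltn_trans (leq_maxr _ _) ltj].
  by apply: cB; rewrite leq_maxr.
pose Y j := [/\ i0 < j, exists n, merge i0 j n & c i0 j = e].
have {}eP N : exists2 j, N < j & Y j.
  have [j ltj [[lti mj] E]] := eP N; exists j => //; split=> //.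
  by rewrite (maxn_idPl lti) in E.
(* [g n] lies beyond the point where [n] has merged with [i0]. From there on [n] has the colours of
   [i0], which are [e] towards every member of [Y]. *)
have /boolp.choice [g gP] : forall n, exists j, Y n ->
    [/\ n < j, Y j & forall j', j <= j' -> c n j' = c i0 j'].
  move=> n; case: (pselect (Y n)) => [Yn|]; last by exists 0.
  case: (Yn) => _ [q mq] _; have [j ltj Yj] := eP (maxn n q).
  exists j => _; split=> // [|j' lej]; first exact: leq_ltn_trans (leq_maxl _ _) ltj.
  have /mergeS : merge i0 n q := mq.
  by case/(_ j') => //; apply: leq_trans (ltnW (leq_ltn_trans (leq_maxr n q) ltj)) lej.
have [y0 y00 Yy0] := eP 0.
pose m i := iter i g y0.
have mY i : Y (m i) by elim: i => //= i IH; case: (gP _ IH).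
have mS i : m i < m i.+1 by case: (gP _ (mY i)).
exists m, e; split=> // i j ltij.
have mle : m i.+1 <= m j.
  elim: j ltij => // j IH; rewrite ltnS leq_eqVlt => /orP[/eqP->//|/IH le1].
  exact: leq_trans le1 (ltnW (mS j)).
by case: (gP _ (mY i)) => _ _ ->//; case: (mY j).
Qed.

(* A recognizer [R] codes a finite semigroup on [0 .. bnd R - 1] with product
   [mul_], a map [lt_] from letters to it, and a set [acc_] of pairs. By Ramsey's
   theorem every infinite word is cut into one factor of type [s] and infinitely
   many factors of type [e] ([fact]); it is accepted when [acc_ R s e]. *)
Definition bnd R := hd R.
Definition lt_ Lb R l := get Lb (hd (tl R)) l.
Definition mul_ R a b := get (bnd R * bnd R) (hd (tl (tl R))) (a * bnd R + b).
Definition acc_ R a b := get (bnd R * bnd R) (tl (tl (tl R))) (a * bnd R + b) == 1.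
Definition mk Lb n f g (h : nat -> nat -> bool) :=
  pr n (pr (tab Lb f) (pr (tab (n * n) (fun i => g (i %/ n) (i %% n)))
                          (tab (n * n) (fun i => h (i %/ n) (i %% n))))).

Lemma bnd_mk Lb n f g h : bnd (mk Lb n f g h) = n.
Proof. exact: hd_pr. Qed.

Lemma lt_mk Lb n f g h l : l < Lb -> lt_ Lb (mk Lb n f g h) l = f l.
Proof. by move=> ltl; rewrite /lt_ tl_pr hd_pr get_tab. Qed.

Lemma idx_lt n a b : a < n -> b < n -> a * n + b < n * n.
Proof. nia. Qed.

Lemma idx_div n a b : b < n -> (a * n + b) %/ n = a.
Proof. by move=> ltb; rewrite divnMDl ?divn_small ?addn0 //; case: n ltb. Qed.

Lemma idx_mod n a b : b < n -> (a * n + b) %% n = b.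
Proof. by move=> ltb; rewrite modnMDl modn_small. Qed.

Lemma mul_mk Lb n f g h a b : a < n -> b < n -> mul_ (mk Lb n f g h) a b = g a b.
Proof.
move=> lta ltb; rewrite /mul_ bnd_mk !tl_pr hd_pr get_tab ?idx_lt //.
by rewrite idx_div // idx_mod.
Qed.

Lemma acc_mk Lb n f g h a b : a < n -> b < n -> acc_ (mk Lb n f g h) a b = h a b.
Proof.
move=> lta ltb; rewrite /acc_ bnd_mk !tl_pr get_tab ?idx_lt //.
by rewrite idx_div // idx_mod // eqb1.
Qed.

(** The semigroup has no unit, so factors are nonempty: [tyn] takes [n.+1] letters from position [i]
    on, and [ty] below the letters at positions [i] to [j - 1]. *)
Fixpoint tyn Lb R (w : nat -> nat) i n :=
  if n is n'.+1 then mul_ R (tyn Lb R w i n') (lt_ Lb R (w (i + n))) else lt_ Lb R (w i).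
Definition ty Lb R w i j := tyn Lb R w i (j - i.+1).

Lemma ty1 Lb R w i : ty Lb R w i i.+1 = lt_ Lb R (w i).
Proof. by rewrite /ty subnn. Qed.

Lemma tyS Lb R w i j : i < j -> ty Lb R w i j.+1 = mul_ R (ty Lb R w i j) (lt_ Lb R (w j)).
Proof. by move=> ltij; rewrite /ty subSn //= -subSn // subSS subnKC // ltnW. Qed.

Lemma ty_ext Lb R w w' i j : i < j -> (forall n, i <= n < j -> w n = w' n) ->
  ty Lb R w i j = ty Lb R w' i j.
Proof.
elim: j => // j IH; rewrite ltnS leq_eqVlt => /orP[/eqP->|ltij] E.
  by rewrite !ty1 E // leqnn ltnSn.
rewrite !tyS // IH // => [|n /andP[n1 n2]]; first by rewrite E // ltnSn ltnW.
by rewrite E // n1 ltnW.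
Qed.

Definition wf Lb R := [/\ forall l, l < Lb -> lt_ Lb R l < bnd R,
  forall a b, a < bnd R -> b < bnd R -> mul_ R a b < bnd R &
  forall a b c, a < bnd R -> b < bnd R -> c < bnd R ->
    mul_ R a (mul_ R b c) = mul_ R (mul_ R a b) c].

Definition word Lb (w : nat -> nat) := forall i, w i < Lb.

Lemma ty_lt Lb R w i j : wf Lb R -> word Lb w -> i < j -> ty Lb R w i j < bnd R.
Proof.
move=> [W1 W2 _] Ww; elim: j => // j IH; rewrite ltnS leq_eqVlt => /orP[/eqP->|ltij].
  by rewrite ty1 W1.
by rewrite tyS // W2 ?IH // W1.
Qed.

Lemma ty_cat Lb R w i j k : wf Lb R -> word Lb w -> i < j -> j < k ->
  ty Lb R w i k = mul_ R (ty Lb R w i j) (ty Lb R w j k).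
Proof.
move=> WR Ww ltij; elim: k => // k IH; rewrite ltnS leq_eqVlt => /orP[/eqP<-|ltjk].
  by rewrite tyS // ty1.
rewrite tyS ?(ltn_trans ltij) // IH // [in RHS]tyS //.
by case: WR (WR) => W1 _ W WR; rewrite W ?ty_lt // W1.
Qed.

(** The type is [e] between any two cut points, not only between neighbours; this makes [e]
    idempotent. *)
Definition fact Lb R w k s e := [/\ forall i, k i < k i.+1, 0 < k 0,
  ty Lb R w 0 (k 0) = s & forall i j, i < j -> ty Lb R w (k i) (k j) = e].

(** All factorizations of a word must give the same answer. Complementation then only negates
    [acc_]. *)
Definition recognizes Lb R (L : (nat -> nat) -> Prop) :=
  wf Lb R /\ forall w k s e, word Lb w -> fact Lb R w k s e -> (L w <-> acc_ R s e).

Lemma homo_lt (k : nat -> nat) : (forall i, k i < k i.+1) -> {homo k : i j / i < j}.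
Proof. by move=> kS; apply: homo_ltn => // y x z; exact: ltn_trans. Qed.

Lemma fact_exists Lb R w : wf Lb R -> word Lb w -> exists k s e, fact Lb R w k s e.
Proof.
move=> WR Ww.
have [m [e [mS m0 me]]] := @additive_ramsey (ty Lb R w) (mul_ R) (bnd R)
  (fun i j => ty_lt WR Ww) (fun i j k => ty_cat WR Ww).
by exists m, (ty Lb R w 0 (m 0)), e.
Qed.

Lemma fact_lt Lb R w k s e : wf Lb R -> word Lb w -> fact Lb R w k s e ->
  s < bnd R /\ e < bnd R.
Proof.
move=> WR Ww [kS k0 <- /(_ 0 1 isT) <-]; split; apply: ty_lt => //.
Qed.

Lemma recognizes_ext Lb R L L' : (forall w, word Lb w -> (L w <-> L' w)) -> recognizes Lb R L -> recognizes Lb R L'.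
Proof. by move=> LL [W H]; split=> // w k s e Ww F; rewrite -LL //; apply: H F. Qed.

Definition notR Lb R :=
  mk Lb (bnd R) (lt_ Lb R) (mul_ R) (fun a b => ~~ acc_ R a b).

Lemma recognizes_not Lb R L : recognizes Lb R L -> recognizes Lb (notR Lb R) (fun w => ~ L w).
Proof.
move=> [WR H]; have [W1 W2 W3] := WR.
have tyE w i j : word Lb w -> i < j -> ty Lb (notR Lb R) w i j = ty Lb R w i j.
  move=> Ww; elim: j => // j IH; rewrite ltnS leq_eqVlt => /orP[/eqP->|ltij].
    by rewrite !ty1 lt_mk.
  by rewrite !tyS // IH // lt_mk // mul_mk ?ty_lt // W1.
split.
  split=> [l ltl|a b|a b c]; rewrite ?bnd_mk ?lt_mk //; first exact: W1.
    by move=> ? ?; rewrite mul_mk // W2.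
  by move=> ? ? ?; rewrite !mul_mk ?W2 ?W3.
move=> w k s e Ww [kS k0 ks ke].
have F : fact Lb R w k s e.
  split=> // [|i j ltij]; first by rewrite -tyE.
  by rewrite -tyE ?ke //; apply: homo_lt.
have [lts lte] := fact_lt WR Ww F.
by rewrite acc_mk // (H _ _ _ _ Ww F); split; move/negP.
Qed.

Definition andR Lb R1 R2 := let n := bnd R2 in
  mk Lb (bnd R1 * n) (fun l => lt_ Lb R1 l * n + lt_ Lb R2 l)
  (fun a b => mul_ R1 (a %/ n) (b %/ n) * n + mul_ R2 (a %% n) (b %% n))
  (fun a b => acc_ R1 (a %/ n) (b %/ n) && acc_ R2 (a %% n) (b %% n)).

Lemma recognizes_and Lb R1 R2 L1 L2 : recognizes Lb R1 L1 -> recognizes Lb R2 L2 ->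
  recognizes Lb (andR Lb R1 R2) (fun w => L1 w /\ L2 w).
Proof.
move=> [WR H] [WR' H']; have [W1 W2 W3] := WR; have [W1' W2' W3'] := WR'.
set R := andR Lb R1 R2; set n := bnd R2.
have ltM a b : a < bnd R1 -> b < n -> a * n + b < bnd R1 * n by nia.
have ltD a : a < bnd R1 * n -> a %/ n < bnd R1 /\ a %% n < n.
  have [->|n0] := posnP n; first by rewrite muln0.
  by rewrite ltn_divLR // ltn_mod.
have ltR l : l < Lb -> lt_ Lb R l = lt_ Lb R1 l * n + lt_ Lb R2 l by move=> ?; rewrite lt_mk.
have mulR a b : a < bnd R1 * n -> b < bnd R1 * n ->
    mul_ R a b = mul_ R1 (a %/ n) (b %/ n) * n + mul_ R2 (a %% n) (b %% n).
  by move=> ? ?; rewrite mul_mk.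
have tyE w i j : word Lb w -> i < j -> ty Lb R w i j = ty Lb R1 w i j * n + ty Lb R2 w i j.
  move=> Ww; elim: j => // j IH; rewrite ltnS leq_eqVlt => /orP[/eqP->|ltij].
    by rewrite !ty1 ltR.
  rewrite !tyS // IH // ltR // mulR ?ltM ?ty_lt ?W1 ?W1' //.
  by rewrite !idx_div ?idx_mod ?ty_lt ?W1 ?W1'.
split.
  split=> [l ltl|a b|a b c]; rewrite ?bnd_mk -/n.
  - by rewrite ltR // ltM ?W1 ?W1'.
  - by move=> lta ltb; have [? ?] := ltD _ lta; have [? ?] := ltD _ ltb;
      rewrite mulR // ltM ?W2 ?W2'.
  - move=> lta ltb ltc; have [? ?] := ltD _ lta; have [? ?] := ltD _ ltb.
    have [? ?] := ltD _ ltc.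
    rewrite (mulR a b) // (mulR b c) // !mulR ?ltM ?W2 ?W2' //.
    by rewrite !idx_div ?idx_mod ?W2 ?W2' // W3 ?W3'.
move=> w k s e Ww [kS k0 ks ke].
have F1 : fact Lb R1 w k (s %/ n) (e %/ n).
  split=> // [|i j ltij]; first by rewrite -ks tyE // idx_div // ty_lt.
  have := homo_lt kS ltij => ltk.
  by rewrite -(ke i j) // tyE // idx_div // ty_lt.
have F2 : fact Lb R2 w k (s %% n) (e %% n).
  split=> // [|i j ltij]; first by rewrite -ks tyE // idx_mod // ty_lt.
  have := homo_lt kS ltij => ltk.
  by rewrite -(ke i j) // tyE // idx_mod // ty_lt.
have lts : s < bnd R1 * n by rewrite -ks tyE // ltM // ty_lt.
have lte : e < bnd R1 * n by rewrite -(ke 0 1) // tyE // ltM // ty_lt.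
rewrite acc_mk // (H _ _ _ _ Ww F1) (H' _ _ _ _ Ww F2).
by split=> [[-> ->]|/andP[]].
Qed.

Definition renR Lb Lb' f R := mk Lb (bnd R) (fun l => lt_ Lb' R (f l)) (mul_ R) (acc_ R).

Lemma recognizes_ren Lb Lb' f R L : (forall l, l < Lb -> f l < Lb') -> recognizes Lb' R L ->
  recognizes Lb (renR Lb Lb' f R) (fun w => L (fun i => f (w i))).
Proof.
move=> fL [WR H]; have [W1 W2 W3] := WR.
have tyE w i j : word Lb w -> i < j ->
    ty Lb (renR Lb Lb' f R) w i j = ty Lb' R (fun i => f (w i)) i j.
  move=> Ww; have Wf : word Lb' (fun i => f (w i)) by move=> q; exact: fL.
  elim: j => // j IH; rewrite ltnS leq_eqVlt => /orP[/eqP->|ltij].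
    by rewrite !ty1 lt_mk.
  by rewrite !tyS // IH // lt_mk // mul_mk ?ty_lt // W1 // fL.
split.
  split=> [l ltl|a b|a b c]; rewrite ?bnd_mk ?lt_mk //; first exact/W1/fL.
    by move=> ? ?; rewrite mul_mk // W2.
  by move=> ? ? ?; rewrite !mul_mk ?W2 ?W3.
move=> w k s e Ww [kS k0 ks ke].
have Wf : word Lb' (fun i => f (w i)) by move=> q; exact: fL.
have F : fact Lb' R (fun i => f (w i)) k s e.
  split=> // [|i j ltij]; first by rewrite -tyE.
  by rewrite -tyE ?ke //; apply: homo_lt.
have [lts lte] := fact_lt WR Wf F.
by rewrite acc_mk // (H _ _ _ _ Wf F).
Qed.

(** * Bit masks, digits and projection *)

Definition bmask n (P : nat -> bool) := \sum_(z < n) P z * 2 ^ z.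
Definition bit A a := A %/ 2 ^ a %% 2 == 1.

Lemma bmask_lt n P : bmask n P < 2 ^ n.
Proof.
rewrite /bmask; elim: n => [|n IH]; first by rewrite big_ord0.
by rewrite big_ord_recr /= expnS mul2n -addnn -addSn leq_add // -[leqRHS]mul1n leq_mul // leq_b1.
Qed.

Lemma bit_bmask n P a : a < n -> bit (bmask n P) a = P a.
Proof.
rewrite /bmask; elim: n => // n IH; rewrite ltnS leq_eqVlt big_ord_recr /= => /orP[/eqP->|lta].
  rewrite /bit addnC divnMDl ?expn_gt0 // divn_small ?addn0; last exact: bmask_lt.
  by case: (P n).
have E2 : 2 ^ n = 2 ^ (n - a.+1) * 2 * 2 ^ a by rewrite -mulnA -expnS -expnD subnK.
rewrite -IH // /bit E2 !mulnA addnC divnMDl ?expn_gt0 //.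
by rewrite modnMDl.
Qed.

Definition dig D x l := l %/ D ^ x %% D.
Definition upd D x l d := l - dig D x l * D ^ x + d * D ^ x.

Lemma dig_lt D x l : 0 < D -> dig D x l < D.
Proof. exact: ltn_pmod. Qed.

Lemma split_dig D x l : 0 < D -> l = l %/ D ^ x.+1 * D ^ x.+1 + dig D x l * D ^ x + l %% D ^ x.
Proof.
move=> D0; rewrite {1}(divn_eq l (D ^ x)); congr (_ + _).
rewrite {1}(divn_eq (l %/ D ^ x) D) -divnMA -expnSr mulnDl; congr (_ + _).
by rewrite -mulnA -expnS.
Qed.

Lemma updE D x l d : 0 < D ->
  upd D x l d = l %/ D ^ x.+1 * D ^ x.+1 + d * D ^ x + l %% D ^ x.
Proof.
move=> D0; have := split_dig x l D0; rewrite /upd.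
move: (_ * _) (_ * _) (_ * _) (l %% _) => p q r t; lia.
Qed.

Lemma dig_cons D x a d r : 0 < D -> d < D -> r < D ^ x -> forall y,
  dig D y (a * D ^ x.+1 + d * D ^ x + r) =
  if y < x then dig D y r else if y == x then d else dig D (y - x.+1) a.
Proof.
move=> D0 ltd ltr y.
have D0x z : 0 < D ^ z by rewrite expn_gt0 D0.
case: ltngtP => [ltyx|ltxy|->].
- set q := D ^ (x - y.+1).
  have E : D ^ x = q * D * D ^ y by rewrite -mulnA -expnS -expnD subnK.
  rewrite /dig expnS E (_ : a * _ + _ + r = (a * D * q + d * q) * D * D ^ y + r).
    by rewrite divnMDl // modnMDl.
  by rewrite !mulnDl !mulnA.
- rewrite /dig -[in D ^ y](subnKC ltxy) expnD divnMA.
  rewrite -addnA divnMDl // (divn_small (m := _ + r)) ?addn0 //.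
  by rewrite expnS; move: (D ^ x) ltr => p; nia.
- rewrite /dig expnS mulnA -mulnDl divnMDl // (divn_small ltr) addn0.
  by rewrite modnMDl modn_small.
Qed.

Lemma dig_upd D x l d y : 0 < D -> d < D ->
  dig D y (upd D x l d) = if y == x then d else dig D y l.
Proof.
move=> D0 ltd; rewrite updE // dig_cons ?ltn_pmod ?expn_gt0 ?D0 //.
rewrite [in RHS](split_dig x l D0) dig_cons ?dig_lt ?ltn_pmod ?expn_gt0 ?D0 //.
by case: ltngtP.
Qed.

Lemma upd_lt D N x l d : 0 < D -> x < N -> l < D ^ N -> d < D -> upd D x l d < D ^ N.
Proof.
move=> D0 ltx ltl ltd; rewrite updE //.
have D0x z : 0 < D ^ z by rewrite expn_gt0 D0.
have lt1 : l %/ D ^ x.+1 < D ^ (N - x.+1).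
  by rewrite ltn_divLR // -expnD subnK.
have lt2 : l %% D ^ x < D ^ x by rewrite ltn_mod.
rewrite -[N in ltnRHS](subnK ltx) expnD; move: (l %/ _) lt1 => s lt1; rewrite expnS.
move: (D ^ x) (D ^ (N - x.+1)) (l %% _) lt1 lt2 => p q r lt1 lt2.
have le1 : s.+1 * (D * p) <= q * (D * p) by rewrite leq_mul.
have le2 : d.+1 * p <= D * p by rewrite leq_mul.
move: le1 le2; rewrite !mulSn; move: (D * p) => v. lia.
Qed.

(* Power semigroup, a set of types being coded by its bit mask: a word is
   accepted when its track [x] can be rewritten so that the result is accepted. *)
Definition exR Lb D x R := let n := bnd R in
  mk Lb (2 ^ n)
  (fun l => bmask n (fun z => has (fun d => lt_ Lb R (upd D x l d) == z) (iota 0 D)))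
  (fun A B => bmask n (fun z => has (fun a => has (fun b =>
     [&& bit A a, bit B b & mul_ R a b == z]) (iota 0 n)) (iota 0 n)))
  (fun U E => has (fun u => has (fun v => has (fun e =>
     [&& bit U u, bit E v, bit E e, mul_ R e e == e & acc_ R (mul_ R u v) e])
       (iota 0 n)) (iota 0 n)) (iota 0 n)).

Lemma has_iotaP n (P : nat -> bool) : reflect (exists2 i, i < n & P i) (has P (iota 0 n)).
Proof.
apply: (iffP hasP) => -[i]; first by rewrite mem_iota => /= lti Pi; exists i.
by move=> lti Pi; exists i; rewrite ?mem_iota.
Qed.

(** Tracks chosen separately on the blocks of a factorization are assembled into one; block 0 ends
    at [k 0]. *)
Lemma glue (k : nat -> nat) (Y : nat -> nat -> nat) D :
  (forall i, k i < k i.+1) -> (forall i n, Y i n < D) ->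
  exists y, [/\ forall n, y n < D, forall n, n < k 0 -> y n = Y 0 n
    & forall i n, k i <= n < k i.+1 -> y n = Y i.+1 n].
Proof.
move=> kS YD.
have ex n : exists i, n < k i.
  by exists n.+1; elim: n.+1 => // i IH; apply: leq_ltn_trans IH (kS i).
exists (fun n => Y (ex_minn (ex n)) n); split=> // [n ltn|i n /andP[le1 lt2]].
  by case: ex_minnP => -[//|i] _ /(_ _ ltn).
case: ex_minnP => j ltj /(_ _ lt2) lej; congr Y; apply/eqP; rewrite eqn_leq lej ltnNge.
apply/negP => le2; have : k j <= k i.
  by move: le2; rewrite leq_eqVlt => /orP[/eqP->//|/(homo_lt kS)/ltnW].
by move=> /(leq_trans ltj); rewrite ltnNge le1.
Qed.

(** The type of a factor in the power semigroup is the set of types of its rewritings ([bty]), so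
    types can be realized block by block. Conversely, a rewriting of the whole word has to be made
    uniform by Ramsey's theorem. *)
Lemma recognizes_ex D N x R L : 0 < D -> x < N -> recognizes (D ^ N) R L ->
  recognizes (D ^ N) (exR (D ^ N) D x R)
    (fun w => exists2 y : nat -> nat, (forall i, y i < D) &
                L (fun i => upd D x (w i) (y i))).
Proof.
move=> D0 ltx [WR H]; have [W1 W2 W3] := WR.
set Lb := D ^ N in WR W1 W2 W3 H *; set R' := exR Lb D x R; set n := bnd R in W1 W2 W3 *.
pose up (w y : nat -> nat) i := upd D x (w i) (y i).
have wup w y : word Lb w -> (forall i, y i < D) -> word Lb (up w y).
  by move=> Ww yD i; exact: upd_lt.
have ltR l : l < Lb -> lt_ Lb R' l = bmask n (fun z =>
    has (fun d => lt_ Lb R (upd D x l d) == z) (iota 0 D)) by move=> ?; rewrite lt_mk.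
have mulR a b : a < 2 ^ n -> b < 2 ^ n -> mul_ R' a b = bmask n (fun z =>
    has (fun u => has (fun v => [&& bit a u, bit b v & mul_ R u v == z])
      (iota 0 n)) (iota 0 n)) by move=> ? ?; rewrite mul_mk.
have bitM a b z : a < 2 ^ n -> b < 2 ^ n -> z < n -> reflect
    (exists u v, [/\ u < n, v < n, bit a u, bit b v & mul_ R u v = z]) (bit (mul_ R' a b) z).
  move=> lta ltb ltz; rewrite mulR // bit_bmask //; apply: (iffP (has_iotaP _ _)).
    by move=> [u ltu /has_iotaP[v ltv /and3P[? ? /eqP ?]]]; exists u, v.
  move=> [u [v [ltu ltv bu bv E]]]; exists u => //; apply/has_iotaP; exists v => //.
  by rewrite bu bv E eqxx.
have WR' : wf Lb R'.
  split=> [l ltl|a b|a b c]; rewrite ?bnd_mk.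
  - by rewrite ltR // bmask_lt.
  - by move=> ? ?; rewrite mulR // bmask_lt.
  move=> lta ltb ltc.
  have ltab : mul_ R' a b < 2 ^ n by rewrite mulR ?bmask_lt.
  have ltbc : mul_ R' b c < 2 ^ n by rewrite mulR ?bmask_lt.
  rewrite mulR // [RHS]mulR //; apply: eq_bigr => z _; congr (nat_of_bool _ * _).
  apply/has_iotaP/has_iotaP => -[u ltu /has_iotaP[v ltv /and3P[]]].
  + move=> bu /bitM-/(_ ltb ltc ltv)[v1 [v2 [ltv1 ltv2 b1 b2 <-]]] /eqP <-.
    exists (mul_ R u v1); first exact: W2.
    apply/has_iotaP; exists v2 => //; rewrite b2 W3 // eqxx andbT andbT.
    by apply/bitM; rewrite ?W2 //; exists u, v1.
  + move=> /bitM-/(_ lta ltb ltu)[u1 [u2 [ltu1 ltu2 b1 b2 <-]]] bv /eqP <-.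
    exists u1 => //; apply/has_iotaP; exists (mul_ R u2 v); first exact: W2.
    rewrite b1 W3 // eqxx andbT /=.
    by apply/bitM; rewrite ?W2 //; exists u2, v.
have bty w i j z : word Lb w -> i < j -> z < n -> reflect
    (exists2 y, (forall q, y q < D) & ty Lb R (up w y) i j = z) (bit (ty Lb R' w i j) z).
  move=> Ww; elim: j z => // j IH z; rewrite ltnS; case: (ltngtP i j) => [ltij|//|->] _ ltz; last first.
    rewrite ty1 ltR // bit_bmask //; apply: (iffP (has_iotaP _ _)) => [[d ltd /eqP E]|[y yD]].
      by exists (fun=> d) => //; rewrite ty1.
    by rewrite ty1 => E; exists (y j) => //; rewrite -E.
  have ltT : ty Lb R' w i j < 2 ^ n by have := ty_lt WR' Ww ltij; rewrite bnd_mk.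
  have ltl : lt_ Lb R' (w j) < 2 ^ n by rewrite ltR // bmask_lt.
  rewrite tyS //; apply: (iffP (bitM _ _ _ ltT ltl ltz)).
    move=> [u [v [ltu ltv /(IH _ ltij ltu)[y yD Ey]]]].
    rewrite ltR // bit_bmask // => /has_iotaP[d ltd /eqP Ed] Eu.
    exists (fun q => if q == j then d else y q) => [q|]; first by case: ifP.
    rewrite tyS // {2}/up eqxx Ed -Eu -Ey; congr mul_.
    by apply: ty_ext => // q /andP[_ ltq]; rewrite /up ltn_eqF.
  move=> [y yD E]; have Wy := wup _ _ Ww yD.
  exists (ty Lb R (up w y) i j), (lt_ Lb R (up w y j)); split.
  - exact: ty_lt.
  - exact: W1.
  - by apply/IH => //; [exact: ty_lt | exists y].
  - rewrite ltR // bit_bmask; last exact: W1.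
    by apply/has_iotaP; exists (y j).
  - by rewrite -E tyS.
split=> // w k s e Ww F.
have [lts lte] := fact_lt WR' Ww F.
rewrite bnd_mk -/n in lts lte.
have [kS k0 ks ke] := F; have kH := homo_lt kS.
rewrite /R' /exR acc_mk // -/n; split.
- move=> [y yD Ly]; have Wy := wup _ _ Ww yD.
  (* The cut points [k] suit the original word; the types of the rewritten word between them may
     vary. A second use of Ramsey's theorem thins them out. *)
  have [m [e' [mS m0 me]]] := @additive_ramsey
    (fun i j => ty Lb R (up w y) (k i) (k j)) (mul_ R) n
    (fun i j ltij => ty_lt WR Wy (kH _ _ ltij))
    (fun i j l ltij ltjl => ty_cat WR Wy (kH _ _ ltij) (kH _ _ ltjl)).
  have mH := homo_lt mS.
  set u := ty Lb R (up w y) 0 (k 0).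
  set v := ty Lb R (up w y) (k 0) (k (m 0)).
  have k0m : k 0 < k (m 0) by exact: kH.
  have ltu : u < n by exact: ty_lt.
  have ltv : v < n by exact: ty_lt.
  have lte' : e' < n by rewrite -(me 0 1) //; apply: ty_lt => //; apply: kH; exact: mH.
  have F' : fact Lb R (up w y) (k \o m) (mul_ R u v) e'.
    split=> [i|||i j ltij] /=; first exact/kH/mS.
    - exact: ltn_trans k0 k0m.
    - by rewrite -ty_cat.
    - exact: me.
  have accE := H _ _ _ _ Wy F'.
  apply/has_iotaP; exists u => //; apply/has_iotaP; exists v => //.
  apply/has_iotaP; exists e' => //.
  apply/and5P; split.
  + by rewrite -ks; apply/bty => //; exists y.
  + by rewrite -(ke 0 (m 0)) //; apply/bty => //; exists y.
  + rewrite -(ke (m 0) (m 1)) ?mH //; apply/bty => //; first exact/kH/mH.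
    by exists y => //; exact: me.
  + apply/eqP; rewrite -{3}(me 0 2) // -{1}(me 0 1) // -(me 1 2) //.
    by rewrite -ty_cat //; apply: kH; exact: mH.
  + exact/accE.
- move=> /has_iotaP[u ltu /has_iotaP[v ltv /has_iotaP[e' lte' /and5P[bu bv be /eqP ee accu]]]].
  have /bty-/(_ Ww k0 ltu)[y0 y0D E0] : bit (ty Lb R' w 0 (k 0)) u by rewrite ks.
  have /bty-/(_ Ww (kS _) ltv)[y1 y1D E1] : bit (ty Lb R' w (k 0) (k 1)) v by rewrite ke.
  have /boolp.choice [Y YP] : forall i, exists y, (forall q, y q < D) /\
      ty Lb R (up w y) (k i) (k i.+1) = e'.
    move=> i; have /bty-/(_ Ww (kS _) lte')[y yD Ey] : bit (ty Lb R' w (k i) (k i.+1)) e'.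
      by rewrite ke.
    by exists y.
  (* The first block realizes [u], the second [v] and all others [e']. The new factorization
     therefore starts its cut points at [k 1], with initial type [u v]. *)
  have [y [yD yk0 yk]] := @glue k (fun i => match i with 0 => y0 | 1 => y1 | i.+2 => Y i.+1 end)
    D kS (fun i n => match i with 0 => y0D n | 1 => y1D n | i.+2 => (YP i.+1).1 n end).
  have Wy := wup _ _ Ww yD.
  exists y => //; apply/(H _ (fun i => k i.+1) (mul_ R u v) e') => //.
  split=> [i|||i j]; first exact: kS.
  + exact: ltn_trans k0 (kS 0).
  + rewrite (ty_cat (j := k 0)) // -E0 -E1; congr mul_; apply: ty_ext => // q.
      by move=> /andP[_ ltq]; rewrite yk0.
    by move=> ltq; rewrite (yk 0).
  have eE i0 : ty Lb R (up w y) (k i0.+1) (k i0.+2) = e'.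
    rewrite -(YP i0.+1).2; apply: ty_ext => // q ltq.
    by rewrite /up (yk _ _ ltq).
  elim: j => // j IH; rewrite ltnS leq_eqVlt => /orP[/eqP->|ltij]; first exact: eE.
  by rewrite (ty_cat (j := k j.+1)) // ?IH ?eE //; apply: kH.
Qed.

(* A factor is summarised by its first and last letters and by whether all its
   letters lie in [E]; the value [2 * Lb ^ 2] means that [S] fails somewhere inside. *)
Definition locR Lb (I E : pred nat) (S : rel nat) :=
  let n := (Lb * Lb).*2 in let ok a := a < n in
  let fst a := a %/ 2 %/ Lb in let lst a := a %/ 2 %% Lb in let allE a := a %% 2 == 1 in
  mk Lb n.+1 (fun l => (l * Lb + l) * 2 + E l)
  (fun a b => if [&& ok a, ok b & S (lst a) (fst b)]
              then (fst a * Lb + lst b) * 2 + (allE a && allE b) else n)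
  (fun a b => [&& ok a, ok b, I (fst a), S (lst a) (fst b) & allE b]).

(** The only languages recognized from scratch: a condition on the first letter, a transition
    between neighbours and a condition at almost all positions. They express initial carries, the
    passing on of carries and finite support. *)
Lemma recognizes_loc Lb (I E : pred nat) (S : rel nat) :
  exists R, recognizes Lb R (fun w => [/\ I (w 0), forall i, S (w i) (w i.+1)
    & exists n, forall i, n <= i -> E (w i)]).
Proof.
exists (locR Lb I E S); set R := locR _ _ _ _; set n := (Lb * Lb).*2.
pose ok a := a < n; pose fst a := a %/ 2 %/ Lb; pose lst a := a %/ 2 %% Lb.
pose allE a := a %% 2 == 1; pose enc f l b := (f * Lb + l) * 2 + nat_of_bool b.
have encP f l b : f < Lb -> l < Lb ->
    [/\ ok (enc f l b), fst (enc f l b) = f, lst (enc f l b) = l & allE (enc f l b) = b].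
  move=> ltf ltl; rewrite /ok /fst /lst /allE /enc.
  have E2 : ((f * Lb + l) * 2 + b) %/ 2 = f * Lb + l.
    by rewrite divnMDl // divn_small ?addn0 //; case: b.
  rewrite !E2 idx_div // idx_mod // modnMDl.
  split=> //; last by case: (b).
  by rewrite /n -muln2; have := leq_b1 b; have := idx_lt ltf ltl; lia.
have encK a : ok a -> exists f l b, [/\ f < Lb, l < Lb & a = enc f l b].
  rewrite /ok /n => lta; have L0 : 0 < Lb by case: (posnP Lb) lta => [->|].
  exists (fst a), (lst a), (allE a); split.
  - by rewrite /fst ltn_divLR // ltn_divLR // muln2.
  - by rewrite /lst ltn_mod.
  - rewrite /enc -divn_eq {1}(divn_eq a 2); congr (_ + _).
    by rewrite /allE; have := ltn_pmod a (isT : 0 < 2); case: (a %% 2) => [|[]].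
have ltE l : l < Lb -> lt_ Lb R l = enc l l (E l) by move=> ?; rewrite lt_mk.
have mulE f l b f' l' b' : f < Lb -> l < Lb -> f' < Lb -> l' < Lb ->
    mul_ R (enc f l b) (enc f' l' b') = if S l f' then enc f l' (b && b') else n.
  move=> ltf ltl ltf' ltl'; have [o1 f1 l1 b1] := encP f l b ltf ltl.
  have [o2 f2 l2 b2] := encP f' l' b' ltf' ltl'.
  rewrite mul_mk ?(leqW o1) ?(leqW o2) // -/n -/(ok _) -/(ok _) -/(fst _) -/(fst _).
  by rewrite -/(lst _) -/(lst _) -/(allE _) -/(allE _) o1 o2 f1 f2 l1 l2 b1 b2.
have okn : ok n = false by rewrite /ok ltnn.
have mulnl a : a < n.+1 -> mul_ R n a = n.
  by move=> lta; rewrite mul_mk // -/n -/(ok n) okn.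
have mulnr a : a < n.+1 -> mul_ R a n = n.
  by move=> lta; rewrite mul_mk // -/n -/(ok n) okn andbF.
have cases a : a < n.+1 -> a = n \/ exists f l b, [/\ f < Lb, l < Lb & a = enc f l b].
  by rewrite ltnS leq_eqVlt => /orP[/eqP->|/encK]; [left | right].
have encn f l b : f < Lb -> l < Lb -> enc f l b < n.+1.
  by move=> ltf ltl; have [o _ _ _] := encP f l b ltf ltl; exact: leqW.
have WR : wf Lb R.
  split=> [l ltl|a b|a b c]; rewrite ?bnd_mk -/n.
  - by rewrite ltE // encn.
  - move=> /cases[->|[f [l [b1 [ltf ltl ->]]]]] => [ltb|]; first by rewrite mulnl.
    move=> /cases[->|[f' [l' [b2 [ltf' ltl' ->]]]]]; first by rewrite mulnr ?encn.
    by rewrite mulE //; case: ifP; rewrite ?encn.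
  - have nn : n < n.+1 by [].
    have m2 f l b1 f' l' b2 : f < Lb -> l < Lb -> f' < Lb -> l' < Lb ->
        mul_ R (enc f l b1) (enc f' l' b2) < n.+1.
      by move=> *; rewrite mulE //; case: ifP; rewrite ?encn.
    move=> /cases[->|[f [l [b1 [ltf ltl ->]]]]]; last first.
      move=> /cases[->|[f' [l' [b2 [ltf' ltl' ->]]]]]; last first.
        move=> /cases[->|[f'' [l'' [b3 [ltf'' ltl'' ->]]]]]; last first.
          rewrite !mulE //; case S1: (S l f'); case S2: (S l' f'');
            rewrite ?mulE ?S1 ?S2 ?mulnl ?mulnr ?encn ?andbA //.
        by rewrite !mulnr ?m2 ?encn.
      by move=> ltc; rewrite mulnr ?encn // !mulnl // mulnr ?encn.
    move=> /cases[->|[f' [l' [b2 [ltf' ltl' ->]]]]] /cases[->|[f'' [l'' [b3 [ltf'' ltl'' ->]]]]];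
      by rewrite ?mulnl ?mulnr ?m2 ?encn // mulnl ?encn // m2.
split=> // w k s e Ww F; have [kS k0 ks ke] := F; have kH := homo_lt kS.
have [lts lte] := fact_lt WR Ww F; rewrite bnd_mk -/n in lts lte.
have tyE i j : i < j -> ty Lb R w i j =
    if [forall q : 'I_j, (i <= q) && (q.+1 < j) ==> S (w q) (w q.+1)]
    then enc (w i) (w j.-1) [forall q : 'I_j, (i <= q) ==> E (w q)] else n.
  elim: j => // j IH; rewrite ltnS leq_eqVlt => /orP[/eqP->|ltij].
    rewrite ty1 ltE //=; case: ifP => [_|/forallP[]].
      congr enc; apply/idP/forallP => [Ej q|/(_ ord_max)]; last by rewrite leqnn.
      by apply/implyP => leq; have -> : nat_of_ord q = j by have := ltn_ord q; lia.
    by move=> q; apply/implyP => /andP[]; lia.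
  rewrite tyS // IH // ltE //.
  have -> : [forall q : 'I_j.+1, (i <= q) && (q.+1 < j.+1) ==> S (w q) (w q.+1)] =
     [forall q : 'I_j, (i <= q) && (q.+1 < j) ==> S (w q) (w q.+1)] && S (w j.-1) (w j).
    apply/forallP/andP => [H|[/forallP H Sj] q].
      split; last first.
        have lt1 : j.-1 < j.+1 by lia.
        have := H (Ordinal lt1); rewrite /= prednK ?(leq_ltn_trans _ ltij) // => /implyP; apply.
        by rewrite ltnSn andbT; lia.
      apply/forallP => q; apply/implyP => /andP[h1 h2].
      by have /implyP := H (widen_ord (leqnSn j) q); apply; rewrite /= h1; lia.
    apply/implyP => /andP[h1 h2]; case: (ltngtP q.+1 j) => [h|h|E2].
    - by have := H (Ordinal (ltnW h)); rewrite /= h1 h.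
    - by lia.
    - move: (nat_of_ord q) E2 => q' E2; by rewrite -E2 in Sj *.
  have -> : [forall q : 'I_j.+1, (i <= q) ==> E (w q)] =
     [forall q : 'I_j, (i <= q) ==> E (w q)] && E (w j).
    apply/forallP/andP => [H|[/forallP H Ej] q].
      split; last by have := H ord_max; rewrite /= ltnW.
      by apply/forallP => q; have := H (widen_ord (leqnSn j) q).
    apply/implyP => h1; case: (ltngtP q j) => [h|h|-> //]; last by have := ltn_ord q; lia.
    by have := H (Ordinal h); rewrite /= h1.
  case: [forall _, _] => /=; first by rewrite mulE.
  by rewrite mulnl // encn.
rewrite acc_mk // -/n -/(ok _) -/(ok _) -/(fst _) -/(fst _) -/(lst _) -/(allE _).
split.
- move=> [I0 Sw [m Em]].
  have tyk i j : i < j -> ty Lb R w i j = enc (w i) (w j.-1) [forall q : 'I_j, (i <= q) ==> E (w q)].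
    by move=> ltij; rewrite tyE //; case: ifP => // /forallP[] q; rewrite Sw implybT.
  have km i : i <= k i by elim: i => // i IH; apply: leq_ltn_trans IH (kS i).
  rewrite -ks -{1 2}(ke 0 1) // -(ke m m.+1) // !tyk ?kH //.
  have [-> -> -> _] := encP (w 0) (w (k 0).-1) [forall q : 'I_(k 0), (0 <= q) ==> E (w q)] (Ww _) (Ww _).
  have [-> -> _ _] := encP (w (k 0)) (w (k 1).-1) [forall q : 'I_(k 1), (k 0 <= q) ==> E (w q)] (Ww _) (Ww _).
  have [_ _ _ ->] := encP (w (k m)) (w (k m.+1).-1) [forall q : 'I_(k m.+1), (k m <= q) ==> E (w q)] (Ww _) (Ww _).
  rewrite I0 /= -{2}(prednK k0) Sw /=.
  by apply/forallP => q; apply/implyP => h; apply: Em; apply: leq_trans (km m) h.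
- move=> /and5P[oks oke Is Sse Ee].
  have tys : ty Lb R w 0 (k 0) = s by [].
  have tyj j : 0 < k j /\ ty Lb R w 0 (k j.+1) <> n.
    split; first by case: j => // j; rewrite (ltn_trans k0) ?kH.
    rewrite (ty_cat (j := k 0)) ?kH // tys ke //.
    have [f [l [b [ltf ltl Es]]]] := encK _ oks.
    have [f' [l' [b' [ltf' ltl' E']]]] := encK _ oke.
    have [? fs ls bs] := encP f l b ltf ltl; have [? fs' ls' bs'] := encP f' l' b' ltf' ltl'.
    move: Sse; rewrite Es E' ls fs' mulE // => -> E2.
    by have := encn f l' (b && b') ltf ltl'; have [o _ _ _] := encP f l' (b && b') ltf ltl';
      move: o; rewrite E2 okn.
  have km i : i <= k i by elim: i => // i IH; apply: leq_ltn_trans IH (kS i).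
  split.
  + move: Is; rewrite -ks tyE //; case: ifP => [_|Hf].
      by have [_ -> _ _] := encP (w 0) (w (k 0).-1) [forall q : 'I_(k 0), (0 <= q) ==> E (w q)] (Ww _) (Ww _).
    by move: oks; rewrite -ks tyE // Hf okn.
  + move=> i; have [_] := tyj i.+1; rewrite tyE ?(ltn_trans k0) ?kH //.
    have lti : i.+1 < k i.+2 by exact: km.
    by case: ifP => // /forallP/(_ (Ordinal (ltnW lti))); rewrite /= lti.
  + exists (k 0) => i lei.
    have lti : i < k i.+1 by exact: km.
    have := Ee; rewrite -(ke 0 i.+1) // tyE ?kH //; case: ifP => [_|Hf _]; last first.
      by move: oke; rewrite -(ke 0 i.+1) // tyE ?kH // Hf okn.
    have [_ _ _ ->] := encP (w (k 0)) (w (k i.+1).-1) [forall q : 'I_(k i.+1), (k 0 <= q) ==> E (w q)] (Ww _) (Ww _).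
    by move/forallP => /(_ (Ordinal lti)); rewrite /= lei.
Qed.

(** Moves the tracks [i], [j], [k] to 0, 1, 2, so that one fixed recognizer of a ternary relation
    serves for any three tracks. *)
Definition ren3 D i j k l := dig D i l + dig D j l * D + dig D k l * D ^ 2.

Lemma dig_ren3 D i j k l : 0 < D ->
  [/\ dig D 0 (ren3 D i j k l) = dig D i l, dig D 1 (ren3 D i j k l) = dig D j l
    & dig D 2 (ren3 D i j k l) = dig D k l].
Proof.
move=> D0; rewrite /ren3.
move: (dig_lt i l D0) (dig_lt j l D0) (dig_lt k l D0).
move: (dig D i l) (dig D j l) (dig D k l) => a b c lta ltb ltc.
have E1 : a + b * D + c * D ^ 2 = (c * D + b) * D + a by lia.
have E2 : a + b * D + c * D ^ 2 = c * D ^ 2 + (b * D + a) by lia.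
split.
- by rewrite /dig E1 expn0 divn1 modnMDl modn_small.
- by rewrite /dig E1 expn1 divnMDl // divn_small // addn0 modnMDl modn_small.
- rewrite /dig E2 divnMDl ?expn_gt0 ?D0 // divn_small ?addn0 ?modn_small //.
  by rewrite expnS expn1; nia.
Qed.

Lemma ren3_lt D i j k l : 0 < D -> ren3 D i j k l < D ^ 3.
Proof.
move=> D0; rewrite /ren3; move: (dig_lt i l D0) (dig_lt j l D0) (dig_lt k l D0).
move: (dig D i l) (dig D j l) (dig D k l) => a b c lta ltb ltc.
have le1 : b.+1 * D <= D * D by rewrite leq_mul.
have le2 : c.+1 * (D * D) <= D * (D * D) by rewrite leq_mul.
move: le1 le2; rewrite !mulSn !expnS expn0 muln1; lia.
Qed.

(* A letter below [D ^ N] carries [N] tracks, its digits in base [D]. *)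
Definition tracks := nat -> nat -> nat.

Definition retrack (E : tracks) x y : tracks := fun z => if z == x then y else E z.

Lemma recognizes_retrack D N R (P : tracks -> Prop) x : 0 < D -> x < N ->
  recognizes (D ^ N) R (fun w => P (fun z i => dig D z (w i))) ->
  recognizes (D ^ N) (exR (D ^ N) D x R) (fun w =>
    exists2 y : nat -> nat, (forall i, y i < D) & P (retrack (fun z i => dig D z (w i)) x y)).
Proof.
move=> D0 ltx HR.
have upE w y : (forall i, y i < D) -> (fun z i => dig D z (upd D x (w i) (y i))) =
    retrack (fun z i => dig D z (w i)) x y.
  move=> yD; apply: funext => z; apply: funext => i.
  by rewrite dig_upd // /retrack; case: eqP.
by apply: recognizes_ext (recognizes_ex D0 ltx HR) => w _; split=> -[y yD Py]; exists y => //;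
  move: Py; rewrite upE.
Qed.

Lemma recognizes_ren3 D M N R (P : (nat -> nat) -> (nat -> nat) -> (nat -> nat) -> Prop) i j k :
  0 < D -> 3 <= M ->
  recognizes (D ^ M) R (fun w => P (fun n => dig D 0 (w n)) (fun n => dig D 1 (w n)) (fun n => dig D 2 (w n))) ->
  recognizes (D ^ N) (renR (D ^ N) (D ^ M) (ren3 D i j k) R)
    (fun w => P (fun n => dig D i (w n)) (fun n => dig D j (w n)) (fun n => dig D k (w n))).
Proof.
move=> D0 M3 HR.
have ltf l : l < D ^ N -> ren3 D i j k l < D ^ M.
  by move=> _; apply: leq_trans (ren3_lt _ _ _ _ D0) _; rewrite leq_pexp2l.
apply: recognizes_ext (recognizes_ren ltf HR) => w _.
have E3 n := dig_ren3 i j k (w n) D0.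
have -> : (fun n => dig D 0 (ren3 D i j k (w n))) = (fun n => dig D i (w n)).
  by apply: funext => n; have [] := E3 n.
have -> : (fun n => dig D 1 (ren3 D i j k (w n))) = (fun n => dig D j (w n)).
  by apply: funext => n; have [] := E3 n.
by have -> : (fun n => dig D 2 (ren3 D i j k (w n))) = (fun n => dig D k (w n));
  first by apply: funext => n; have [] := E3 n.
Qed.

(** * Closure properties of regular relations between tracks *)

Section Regular.
Variables (D N : nat).
Hypotheses (D0 : 0 < D) (N3 : 3 <= N).

(** Mere existence is enough here: the finitely many recognizers of the atomic relations enter the
    decision procedure as constants. *)
Definition regular (P : tracks -> Prop) :=
  exists R, recognizes (D ^ N) R (fun w => P (fun z i => dig D z (w i))).

Lemma regular_ext P Q : (forall E : tracks, (forall z i, E z i < D) -> (P E <-> Q E)) -> regular P -> regular Q.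
Proof. by move=> PQ [R HR]; exists R; apply: recognizes_ext HR => w _; apply: PQ => z i; exact: dig_lt. Qed.

Lemma regular_not P : regular P -> regular (fun E => ~ P E).
Proof. by move=> [R HR]; exists (notR (D ^ N) R); exact: recognizes_not. Qed.

Lemma regular_and P Q : regular P -> regular Q -> regular (fun E => P E /\ Q E).
Proof. by move=> [R HR] [R' HR']; exists (andR (D ^ N) R R'); exact: recognizes_and. Qed.

Lemma regular_or P Q : regular P -> regular Q -> regular (fun E => P E \/ Q E).
Proof.
move=> rP rQ; apply: (@regular_ext (fun E => ~ (~ P E /\ ~ Q E))).
  move=> E _; split=> [h|[p|q] []//].
  by case: (pselect (P E)) => [|nP]; [left | right; apply: contrapT => nQ; apply: h].
by apply: regular_not; apply: regular_and; apply: regular_not.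
Qed.

Lemma regular_ex P x : x < N -> regular P ->
  regular (fun E => exists2 y : nat -> nat, (forall i, y i < D) & P (retrack E x y)).
Proof. by move=> ltx [R HR]; exists (exR (D ^ N) D x R); exact: recognizes_retrack. Qed.

Lemma regular_ren3 (P : (nat -> nat) -> (nat -> nat) -> (nat -> nat) -> Prop) i j k :
  regular (fun E => P (E 0) (E 1) (E 2)) -> regular (fun E => P (E i) (E j) (E k)).
Proof. by move=> [R HR]; exists (renR (D ^ N) (D ^ N) (ren3 D i j k) R); exact: recognizes_ren3. Qed.

Lemma regular_loc (I F : pred (nat -> nat)) (S : rel (nat -> nat)) :
  regular (fun E => [/\ I (fun z => E z 0), forall i, S (fun z => E z i) (fun z => E z i.+1)
                 & exists n, forall i, n <= i -> F (fun z => E z i)]).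
Proof.
have [R HR] := recognizes_loc (D ^ N) (fun l => I (fun z => dig D z l)) (fun l => F (fun z => dig D z l))
  (fun l l' => S (fun z => dig D z l) (fun z => dig D z l')).
by exists R.
Qed.

End Regular.

(** * Codes of terms and formulas *)

Lemma Rec_arg1 A : Rec A -> Rec (fun e => arg1 (A e)).
Proof. by move=> rA; rewrite /arg1; rec_solve. Qed.

Lemma Rec_arg2 A : Rec A -> Rec (fun e => arg2 (A e)).
Proof. by move=> rA; rewrite /arg2; rec_solve. Qed.

Lemma Rec_bmask (P : nat -> (nat -> nat) -> bool) N :
  Rec (fun e => P (e 0) (shift e)) -> Rec N -> Rec (fun e => bmask (N e) (fun z => P z e)).
Proof.
move=> rP rN; apply: (@Rec_sum (fun z e => P z e * 2 ^ z)) => //; rec_solve.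
Qed.

Ltac rec_tac := repeat (cbv beta;
  lazymatch goal with
  | |- Rec (fun e => tab _ _) => apply: Rec_tab
  | |- Rec (fun e => get _ _ _) => apply: Rec_get
  | |- Rec (fun e => bmask _ _) => apply: Rec_bmask
  | |- Rec (fun e => arg1 _) => apply: Rec_arg1
  | |- Rec (fun e => arg2 _) => apply: Rec_arg2
  | |- _ => rec_step
  end).

Lemma Rec_notR Lb R : Rec Lb -> Rec R -> Rec (fun e => notR (Lb e) (R e)).
Proof.
apply: Rec_comp2; rewrite /notR /mk /lt_ /mul_ /acc_ /bnd; rec_tac.
Qed.

Lemma Rec_andR Lb R1 R2 : Rec Lb -> Rec R1 -> Rec R2 -> Rec (fun e => andR (Lb e) (R1 e) (R2 e)).
Proof. by apply: Rec_comp3; rewrite /andR /mk /lt_ /mul_ /acc_ /bnd; rec_tac. Qed.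

Lemma Rec_exR Lb D X R : Rec Lb -> Rec X -> Rec R -> Rec (fun e => exR (Lb e) D (X e) (R e)).
Proof.
by apply: (@Rec_comp3 (fun L X R => exR L D X R));
  rewrite /exR /mk /lt_ /mul_ /acc_ /bnd /bit /upd /dig; cbv zeta; rec_tac.
Qed.

Lemma Rec_renR Lb D i j k R0 : Rec Lb -> Rec i -> Rec j -> Rec k ->
  Rec (fun e => renR (Lb e) (D ^ 8) (ren3 D (i e) (j e) (k e)) R0).
Proof.
by apply: (@Rec_comp4 (fun L i j k => renR L (D ^ 8) (ren3 D i j k) R0));
  rewrite /renR /mk /lt_ /mul_ /acc_ /bnd /ren3 /dig; rec_tac.
Qed.

Definition is_term n := tfold (fun n a b => nat_of_bool (
  if hd n == 0 then n == pr 0 (pr (arg1 n) 0) else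
  if hd n == 1 then [&& n == pr 1 (pr (arg1 n) (pr (arg2 n) 0)), a == 1 & b == 1]
  else (n == pr 2 (pr (arg1 n) 0)) && (a == 1))) n.

Definition is_formula n := tfold (fun n a b => nat_of_bool (
  if hd n <= 1 then
    [&& n == pr (hd n) (pr (arg1 n) (pr (arg2 n) 0)), is_term (arg1 n) == 1 & is_term (arg2 n) == 1] else
  if hd n == 2 then (n == pr 2 (pr (arg1 n) 0)) && (is_term (arg1 n) == 1) else
  if hd n == 3 then (n == pr 3 (pr (arg1 n) 0)) && (a == 1) else
  if hd n == 4 then [&& n == pr 4 (pr (arg1 n) (pr (arg2 n) 0)), a == 1 & b == 1] else
  (n == pr 5 (pr (arg1 n) (pr (arg2 n) 0))) && (b == 1))) n.

Definition var_of x n := tfold (fun n a b => nat_of_bool (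
  if hd n == 0 then arg1 n == x else if hd n == 1 then (a == 1) || (b == 1) else a == 1)) n.

Definition free_in x n := tfold (fun n a b => nat_of_bool (
  if hd n <= 1 then (var_of x (arg1 n) == 1) || (var_of x (arg2 n) == 1) else
  if hd n == 2 then var_of x (arg1 n) == 1 else
  if hd n == 3 then a == 1 else
  if hd n == 4 then (a == 1) || (b == 1) else (arg1 n != x) && (b == 1))) n.

Lemma Rec_is_term A : Rec A -> Rec (fun e => is_term (A e)).
Proof. by apply: Rec_comp1; rewrite /is_term; apply: Rec_tfold; rec_tac. Qed.

Lemma Rec_is_formula A : Rec A -> Rec (fun e => is_formula (A e)).
Proof. by apply: Rec_comp1; rewrite /is_formula; apply: Rec_tfold; rec_tac; apply: Rec_is_term; rec_tac. Qed.

Lemma Rec_fvT X A : Rec X -> Rec A -> Rec (fun e => var_of (X e) (A e)).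
Proof. by apply: Rec_comp2; rewrite /var_of; apply: Rec_tfold; rec_tac. Qed.

Lemma Rec_fvF X A : Rec X -> Rec A -> Rec (fun e => free_in (X e) (A e)).
Proof. by apply: Rec_comp2; rewrite /free_in; apply: Rec_tfold; rec_tac; apply: Rec_fvT; rec_tac. Qed.

Lemma pr_code1 a x : CodeSeq.code [:: a; x] = pr a (pr x 0).
Proof. by rewrite /pr /= muln1. Qed.

Lemma pr_code2 a x y : CodeSeq.code [:: a; x; y] = pr a (pr x (pr y 0)).
Proof. by rewrite /pr /= muln1. Qed.

Lemma arg1_pr a x y : arg1 (pr a (pr x y)) = x.
Proof. by rewrite /arg1 tl_pr hd_pr. Qed.

Lemma arg2_pr a x y z : arg2 (pr a (pr x (pr y z))) = y.
Proof. by rewrite /arg2 !tl_pr hd_pr. Qed.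

Arguments pr : simpl never.
Arguments hd : simpl never.

Lemma is_termE n : 0 < n -> is_term n = (
  if hd n == 0 then n == pr 0 (pr (arg1 n) 0) else
  if hd n == 1 then [&& n == pr 1 (pr (arg1 n) (pr (arg2 n) 0)), is_term (arg1 n) == 1 & is_term (arg2 n) == 1]
  else (n == pr 2 (pr (arg1 n) 0)) && (is_term (arg1 n) == 1)).
Proof. exact: tfoldE. Qed.

Lemma is_formulaE n : 0 < n -> is_formula n = (
  if hd n <= 1 then
    [&& n == pr (hd n) (pr (arg1 n) (pr (arg2 n) 0)), is_term (arg1 n) == 1 & is_term (arg2 n) == 1] else
  if hd n == 2 then (n == pr 2 (pr (arg1 n) 0)) && (is_term (arg1 n) == 1) else
  if hd n == 3 then (n == pr 3 (pr (arg1 n) 0)) && (is_formula (arg1 n) == 1) else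
  if hd n == 4 then [&& n == pr 4 (pr (arg1 n) (pr (arg2 n) 0)), is_formula (arg1 n) == 1 & is_formula (arg2 n) == 1] else
  (n == pr 5 (pr (arg1 n) (pr (arg2 n) 0))) && (is_formula (arg2 n) == 1)).
Proof. exact: tfoldE. Qed.

Lemma var_ofE x n : 0 < n -> var_of x n = (
  if hd n == 0 then arg1 n == x else
  if hd n == 1 then (var_of x (arg1 n) == 1) || (var_of x (arg2 n) == 1) else var_of x (arg1 n) == 1).
Proof. exact: tfoldE. Qed.

Lemma free_inE x n : 0 < n -> free_in x n = (
  if hd n <= 1 then (var_of x (arg1 n) == 1) || (var_of x (arg2 n) == 1) else
  if hd n == 2 then var_of x (arg1 n) == 1 else
  if hd n == 3 then free_in x (arg1 n) == 1 else
  if hd n == 4 then (free_in x (arg1 n) == 1) || (free_in x (arg2 n) == 1) else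
  (arg1 n != x) && (free_in x (arg2 n) == 1)).
Proof. exact: tfoldE. Qed.

Definition argE := (hd_pr, arg1_pr, arg2_pr).

Lemma term_codeE :
  [/\ forall x, term_code (Var x) = pr 0 (pr x 0),
      forall t1 t2, term_code (Add t1 t2) = pr 1 (pr (term_code t1) (pr (term_code t2) 0))
    & forall t, term_code (Lam t) = pr 2 (pr (term_code t) 0)].
Proof. by split=> *; rewrite -?pr_code1 -?pr_code2. Qed.

Lemma formula_codeE :
  [/\ forall t1 t2, formula_code (FEq t1 t2) = pr 0 (pr (term_code t1) (pr (term_code t2) 0)),
      forall t1 t2, formula_code (FLt t1 t2) = pr 1 (pr (term_code t1) (pr (term_code t2) 0))
    & forall t, formula_code (FInt t) = pr 2 (pr (term_code t) 0)] /\
  [/\ forall q, formula_code (FNot q) = pr 3 (pr (formula_code q) 0),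
      forall q r, formula_code (FAnd q r) = pr 4 (pr (formula_code q) (pr (formula_code r) 0))
    & forall x q, formula_code (FEx x q) = pr 5 (pr x (pr (formula_code q) 0))].
Proof. by split; split=> *; rewrite -?pr_code1 -?pr_code2. Qed.

Lemma is_term_code t : is_term (term_code t) = 1.
Proof.
have [E1 E2 E3] := term_codeE.
elim: t => [x|t1 IH1 t2 IH2|t IH]; rewrite ?E1 ?E2 ?E3 is_termE ?pr_gt0 // !argE /= eqxx //.
- by rewrite IH1 IH2.
- by rewrite IH.
Qed.

Lemma is_term_inv n : is_term n = 1 -> exists t, term_code t = n.
Proof.
elim/ltn_ind: n => n IH; have [->|n0] := posnP n; first by [].
rewrite is_termE //; have l1 := arg1_lt n0; have l2 := arg2_lt n0.
case: eqP => _.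
  case: eqP => // E _; exists (Var (arg1 n)); by rewrite [RHS]E -pr_code1.
case: eqP => _.
  case: eqP => // E; case: eqP => // /(IH _ l1)[t1 E1]; case: eqP => // /(IH _ l2)[t2 E2] _.
  by exists (Add t1 t2); rewrite [RHS]E -E1 -E2 -pr_code2.
case: eqP => // E; case: eqP => // /(IH _ l1)[t1 E1] _.
by exists (Lam t1); rewrite [RHS]E -E1 -pr_code1.
Qed.

Lemma is_formula_code p : is_formula (formula_code p) = 1.
Proof.
have [[E1 E2 E3] [E4 E5 E6]] := formula_codeE.
elim: p => [t1 t2|t1 t2|t|q IHq|q IHq r IHr|x q IHq];
  rewrite ?E1 ?E2 ?E3 ?E4 ?E5 ?E6 is_formulaE ?pr_gt0 // !argE /= eqxx ?is_term_code ?IHq ?IHr //.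
Qed.

Lemma is_formula_inv n : is_formula n = 1 -> exists p, formula_code p = n.
Proof.
elim/ltn_ind: n => n IH; have [->|n0] := posnP n; first by [].
rewrite is_formulaE //; have l1 := arg1_lt n0; have l2 := arg2_lt n0.
case: ifP => [le1|_].
  case: eqP => // E; case: eqP => // /is_term_inv[t1 E1]; case: eqP => // /is_term_inv[t2 E2] _.
  case: (hd n) le1 E => [|[|]] // _ E; [exists (FEq t1 t2) | exists (FLt t1 t2)];
    by rewrite [RHS]E -E1 -E2 -pr_code2.
case: ifP => _.
  case: eqP => // E; case: eqP => // /is_term_inv[t1 E1] _.
  by exists (FInt t1); rewrite [RHS]E -E1 -pr_code1.
case: ifP => _.
  case: eqP => // E; case: eqP => // /(IH _ l1)[q E1] _.
  by exists (FNot q); rewrite [RHS]E -E1 -pr_code1.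
case: ifP => _.
  case: eqP => // E; case: eqP => // /(IH _ l1)[q E1]; case: eqP => // /(IH _ l2)[r E2] _.
  by exists (FAnd q r); rewrite [RHS]E -E1 -E2 -pr_code2.
case: eqP => // E; case: eqP => // /(IH _ l2)[q E1] _.
by exists (FEx (arg1 n) q); rewrite [RHS]E -E1 -pr_code2.
Qed.

Lemma var_of_code x t : var_of x (term_code t) = (x \in term_vars t).
Proof.
have [E1 E2 E3] := term_codeE.
elim: t => [y|t1 IH1 t2 IH2|t IH]; rewrite ?E1 ?E2 ?E3 var_ofE ?pr_gt0 // !argE /=.
- by rewrite inE eq_sym.
- by rewrite IH1 IH2 mem_cat !eqb1.
- by rewrite IH eqb1.
Qed.

Lemma free_in_code x p : free_in x (formula_code p) = (x \in free_vars p).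
Proof.
have [[E1 E2 E3] [E4 E5 E6]] := formula_codeE.
elim: p => [t1 t2|t1 t2|t|q IHq|q IHq r IHr|y q IHq];
  rewrite ?E1 ?E2 ?E3 ?E4 ?E5 ?E6 free_inE ?pr_gt0 // !argE /= ?var_of_code ?IHq ?IHr ?mem_cat ?eqb1 //.
by rewrite mem_filter eq_sym.
Qed.

Lemma lt_code1 a x y : x < pr a (pr x y).
Proof. exact: ltn_trans (pr_ltl _ _) (pr_ltr _ _). Qed.

Lemma lt_code2 a x y z : y < pr a (pr x (pr y z)).
Proof. exact: ltn_trans (lt_code1 _ _ _) (pr_ltr _ _). Qed.

Lemma term_code_var x t : x \in term_vars t -> x < term_code t.
Proof.
have [E1 E2 E3] := term_codeE.
elim: t => [y|t1 IH1 t2 IH2|t IH]; rewrite ?E1 ?E2 ?E3 /=.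
- by rewrite inE => /eqP->; exact: lt_code1.
- by rewrite mem_cat => /orP[/IH1|/IH2] h; apply: (ltn_trans h); [exact: lt_code1 | exact: lt_code2].
- by move=> /IH h; apply: (ltn_trans h); exact: lt_code1.
Qed.

Lemma free_var_lt x p : x \in free_vars p -> x < formula_code p.
Proof.
have [[E1 E2 E3] [E4 E5 E6]] := formula_codeE.
elim: p => [t1 t2|t1 t2|t|q IHq|q IHq r IHr|y q IHq];
  rewrite ?E1 ?E2 ?E3 ?E4 ?E5 ?E6 /= ?mem_cat.
- by move=> /orP[] /term_code_var h; apply: (ltn_trans h); [exact: lt_code1 | exact: lt_code2].
- by move=> /orP[] /term_code_var h; apply: (ltn_trans h); [exact: lt_code1 | exact: lt_code2].
- by move=> /term_code_var h; apply: (ltn_trans h); exact: lt_code1.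
- by move=> /IHq h; apply: (ltn_trans h); exact: lt_code1.
- by move=> /orP[/IHq|/IHr] h; apply: (ltn_trans h); [exact: lt_code1 | exact: lt_code2].
- by rewrite mem_filter => /andP[_ /IHq h]; apply: (ltn_trans h); exact: lt_code2.
Qed.

(** Testing the variables below [n] is enough, as a code exceeds every free variable of its formula
    ([free_var_lt]). *)
Definition is_sentence n := (is_formula n == 1) && all (fun x => free_in x n != 1) (iota 0 n).

Lemma is_sentence_inv n : is_sentence n -> exists2 p, sentence p & formula_code p = n.
Proof.
move=> /andP[/eqP/is_formula_inv[p <-] /allP H]; exists p => //.
rewrite /sentence; apply/eqP; rewrite -size_eq0; case E: (free_vars p) => [|x s] //=.
have xp : x \in free_vars p by rewrite E inE eqxx.
have := H x; rewrite free_in_code xp mem_iota /= => /(_ _)/negP[] //.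
exact: free_var_lt.
Qed.

Lemma is_sentence_code p : sentence p -> is_sentence (formula_code p).
Proof.
move=> sp; rewrite /is_sentence is_formula_code eqxx /=; apply/allP => x _.
by rewrite free_in_code sp in_nil.
Qed.

Lemma Rec_is_sentence A : Rec A -> Rec (fun e => is_sentence (A e)).
Proof.
apply: (@Rec_comp1 (fun n => is_sentence n)); rewrite /is_sentence; rec_solve; first by apply: Rec_is_formula; rec_solve.
by apply: Rec_fvF; rec_solve.
Qed.

(** * Deciding the truth of sentences by recognizers *)

Lemma recursive_Rec (T : nat -> nat) :
  Rec (fun e => T (e 0)) -> recursive (fun v : 1.-tuple nat => T (thead v)).
Proof.
move=> [n [g [rg Tg]]].
have -> : (fun v : 1.-tuple nat => T (thead v)) = fun v => g [tuple tnth v ord0 | i < n].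
  by apply: funext => v; rewrite (Tg (fun=> thead v)).
by apply: (rec_comp (h := fun (i : 'I_n) v => tnth v ord0)) => // i; exact: rec_proj.
Qed.

Section Decide.
Variables (R : realType) (a : R) (D : nat) (val : (nat -> nat) -> R).
Variables Kadd Klam Klt Kint Keq : nat.
Hypothesis D0 : 0 < D.
Hypothesis val_surj : forall x, exists2 s : nat -> nat, (forall i, s i < D) & val s = x.

(** Of the eight tracks three hold the arguments; the others leave room for auxiliary tracks that
    are projected away. *)
Definition realizes K (P : R -> R -> R -> Prop) :=
  recognizes (D ^ 8) K (fun w => P (val (fun n => dig D 0 (w n))) (val (fun n => dig D 1 (w n)))
                            (val (fun n => dig D 2 (w n)))).

Hypothesis HKadd : realizes Kadd (fun x y z => z = (x + y)%R).
Hypothesis HKlam : realizes Klam (fun x y z => y = (a * x)%R).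
Hypothesis HKlt : realizes Klt (fun x y z => (x < y)%R).
Hypothesis HKint : realizes Kint (fun x y z => x \is a Num.int).
Hypothesis HKeq : realizes Keq (fun x y z => x = y).

Let KR L i j k K := renR L (D ^ 8) (ren3 D i j k) K.
Let vt x := 2 * x.
Let tt n := (2 * n).+1.

(* Track [vt x] holds the value of the variable [x], and track [tt n] that of the
   term with code [n]; [L] is the size of the alphabet. *)
Definition term_recognizer L n := tfold (fun n r1 r2 =>
  if hd n == 0 then KR L (vt (arg1 n)) (tt n) 0 Keq else
  if hd n == 1 then exR L D (tt (arg1 n)) (andR L r1 (exR L D (tt (arg2 n)) (andR L r2
      (KR L (tt (arg1 n)) (tt (arg2 n)) (tt n) Kadd))))
  else exR L D (tt (arg1 n)) (andR L r1 (KR L (tt (arg1 n)) (tt n) 0 Klam))) n.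

Definition formula_recognizer L n := tfold (fun n r1 r2 =>
  if hd n <= 1 then exR L D (tt (arg1 n)) (andR L (term_recognizer L (arg1 n)) (exR L D (tt (arg2 n))
      (andR L (term_recognizer L (arg2 n)) (if hd n == 0 then KR L (tt (arg1 n)) (tt (arg2 n)) 0 Keq
                               else KR L (tt (arg1 n)) (tt (arg2 n)) 0 Klt)))) else
  if hd n == 2 then exR L D (tt (arg1 n)) (andR L (term_recognizer L (arg1 n)) (KR L (tt (arg1 n)) 0 0 Kint)) else
  if hd n == 3 then notR L r1 else
  if hd n == 4 then andR L r1 r2 else exR L D (vt (arg1 n)) r2) n.

Lemma term_recognizerE L n : 0 < n -> term_recognizer L n =
  if hd n == 0 then KR L (vt (arg1 n)) (tt n) 0 Keq else
  if hd n == 1 then exR L D (tt (arg1 n)) (andR L (term_recognizer L (arg1 n)) (exR L D (tt (arg2 n))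
      (andR L (term_recognizer L (arg2 n)) (KR L (tt (arg1 n)) (tt (arg2 n)) (tt n) Kadd))))
  else exR L D (tt (arg1 n)) (andR L (term_recognizer L (arg1 n)) (KR L (tt (arg1 n)) (tt n) 0 Klam)).
Proof. exact: tfoldE. Qed.

Lemma formula_recognizerE L n : 0 < n -> formula_recognizer L n =
  if hd n <= 1 then exR L D (tt (arg1 n)) (andR L (term_recognizer L (arg1 n)) (exR L D (tt (arg2 n))
      (andR L (term_recognizer L (arg2 n)) (if hd n == 0 then KR L (tt (arg1 n)) (tt (arg2 n)) 0 Keq
                               else KR L (tt (arg1 n)) (tt (arg2 n)) 0 Klt)))) else
  if hd n == 2 then exR L D (tt (arg1 n)) (andR L (term_recognizer L (arg1 n)) (KR L (tt (arg1 n)) 0 0 Kint)) else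
  if hd n == 3 then notR L (formula_recognizer L (arg1 n)) else
  if hd n == 4 then andR L (formula_recognizer L (arg1 n)) (formula_recognizer L (arg2 n)) else exR L D (vt (arg1 n)) (formula_recognizer L (arg2 n)).
Proof. exact: tfoldE. Qed.

Ltac rec_full := repeat (cbv beta;
  lazymatch goal with
  | |- Rec (fun e => renR _ _ _ _) => apply: Rec_renR
  | |- Rec (fun e => exR _ _ _ _) => apply: Rec_exR
  | |- Rec (fun e => andR _ _ _) => apply: Rec_andR
  | |- Rec (fun e => notR _ _) => apply: Rec_notR
  | |- Rec (fun e => arg1 _) => apply: Rec_arg1
  | |- Rec (fun e => arg2 _) => apply: Rec_arg2
  | |- _ => rec_step
  end).

Lemma Rec_TR L n : Rec L -> Rec n -> Rec (fun e => term_recognizer (L e) (n e)).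
Proof. by apply: Rec_comp2; rewrite /term_recognizer /KR /tt /vt; apply: Rec_tfold; rec_full. Qed.

Lemma Rec_FR L n : Rec L -> Rec n -> Rec (fun e => formula_recognizer (L e) (n e)).
Proof.
by apply: Rec_comp2; rewrite /formula_recognizer /KR /tt /vt; apply: Rec_tfold; rec_full; apply: Rec_TR; rec_full.
Qed.

Definition env_of (E : tracks) (x : nat) : R := val (E (vt x)).

Definition recognizesE N K (P : tracks -> Prop) := recognizes (D ^ N) K (fun w => P (fun z i => dig D z (w i))).

Lemma recognizesE_ext N K P Q : (forall E : tracks, (forall z i, E z i < D) -> (P E <-> Q E)) ->
  recognizesE N K P -> recognizesE N K Q.
Proof. by move=> PQ; apply: recognizes_ext => w _; apply: PQ => z i; exact: dig_lt. Qed.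

Lemma recognizesE_KR N K P i j k : realizes K P ->
  recognizesE N (KR (D ^ N) i j k K) (fun E => P (val (E i)) (val (E j)) (val (E k))).
Proof.
by move=> HK; apply: (@recognizes_ren3 D 8 N K (fun s1 s2 s3 => P (val s1) (val s2) (val s3))).
Qed.

Lemma recognizesE_ex N K P x : x < N -> recognizesE N K P -> recognizesE N (exR (D ^ N) D x K)
  (fun E => exists2 y : nat -> nat, (forall i, y i < D) & P (retrack E x y)).
Proof. by move=> ltx HK; exact: recognizes_retrack. Qed.

Lemma recognizesE_and N K1 K2 P1 P2 : recognizesE N K1 P1 -> recognizesE N K2 P2 ->
  recognizesE N (andR (D ^ N) K1 K2) (fun E => P1 E /\ P2 E).
Proof. exact: recognizes_and. Qed.

Let ev E t := @eval (S_ a) (env_of E) t.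

Lemma env_retrack E n y : env_of (retrack E (tt n) y) = env_of E.
Proof.
apply: funext => x; rewrite /env_of /retrack; case: eqP => //; rewrite /vt /tt => /(congr1 odd).
by rewrite /= !oddM.
Qed.

Lemma env_update E x y : env_of (retrack E (vt x) y) = update (env_of E) x (val y).
Proof.
apply: funext => z; rewrite /env_of /retrack /update /vt eqn_pmul2l //.
by case: eqP.
Qed.

Lemma ev_retrack E n y t : ev (retrack E (tt n) y) t = ev E t.
Proof. by rewrite /ev env_retrack. Qed.

Lemma retrack_same E x y : retrack E x y x = y.
Proof. by rewrite /retrack eqxx. Qed.

Lemma retrack_other E x y z : z != x -> retrack E x y z = E z.
Proof. by rewrite /retrack => /negPf->. Qed.

Lemma tt_inj m n : (tt m == tt n) = (m == n).
Proof. by rewrite /tt eqSS eqn_pmul2l. Qed.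

(* Once the tracks of two terms hold their values, any binary relation between
   them can be tested, even if the terms, hence the tracks, coincide. *)
Lemma recognizesE_terms N K1 K2 K t1 t2 (P : R -> R -> tracks -> Prop) :
  tt (term_code t1) < N -> tt (term_code t2) < N ->
  recognizesE N K1 (fun E => val (E (tt (term_code t1))) = ev E t1) ->
  recognizesE N K2 (fun E => val (E (tt (term_code t2))) = ev E t2) ->
  recognizesE N K (fun E => P (val (E (tt (term_code t1)))) (val (E (tt (term_code t2)))) E) ->
  (forall u v E y, P u v (retrack E (tt (term_code t1)) y) <-> P u v E) ->
  (forall u v E y, P u v (retrack E (tt (term_code t2)) y) <-> P u v E) ->
  recognizesE N (exR (D ^ N) D (tt (term_code t1)) (andR (D ^ N) K1
    (exR (D ^ N) D (tt (term_code t2)) (andR (D ^ N) K2 K))))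
    (fun E => P (ev E t1) (ev E t2) E).
Proof.
move=> lt1 lt2 H1 H2 HK P1 P2.
apply: recognizesE_ext (recognizesE_ex lt1 (recognizesE_and H1 (recognizesE_ex lt2 (recognizesE_and H2 HK)))) => E _.
set x1 := tt _; set x2 := tt (term_code t2).
have key y1 y2 : val y1 = ev E t1 -> val y2 = ev E t2 ->
    P (val (retrack (retrack E x1 y1) x2 y2 x1)) (val (retrack (retrack E x1 y1) x2 y2 x2))
      (retrack (retrack E x1 y1) x2 y2) <-> P (ev E t1) (ev E t2) E.
  move=> v1 v2; rewrite P2 P1 retrack_same v2.
  have [E12|n12] := eqVneq x1 x2; last by rewrite retrack_other // retrack_same v1.
  have -> : t1 = t2 by apply: term_code_inj; apply/eqP; rewrite -tt_inj; apply/eqP.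
  by rewrite (_ : retrack _ _ _ x1 = y2) ?v2 // E12 retrack_same.
split.
- move=> [y1 _ [v1 [y2 _ [v2 PE]]]]; move: v1 v2; rewrite !retrack_same !ev_retrack => v1 v2.
  exact/(key _ _ v1 v2).
- move=> PE; have [y1 D1 v1] := val_surj (ev E t1); have [y2 D2 v2] := val_surj (ev E t2).
  exists y1 => //; split; first by rewrite retrack_same ev_retrack.
  exists y2 => //; split; first by rewrite retrack_same !ev_retrack.
  exact/(key _ _ v1 v2).
Qed.

Lemma recognizesE_term1 N K1 K t1 (P : R -> tracks -> Prop) :
  tt (term_code t1) < N ->
  recognizesE N K1 (fun E => val (E (tt (term_code t1))) = ev E t1) ->
  recognizesE N K (fun E => P (val (E (tt (term_code t1)))) E) ->
  (forall u E y, P u (retrack E (tt (term_code t1)) y) <-> P u E) ->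
  recognizesE N (exR (D ^ N) D (tt (term_code t1)) (andR (D ^ N) K1 K)) (fun E => P (ev E t1) E).
Proof.
move=> lt1 H1 HK P1; apply: recognizesE_ext (recognizesE_ex lt1 (recognizesE_and H1 HK)) => E _; split.
- by move=> [y1 _ []]; rewrite retrack_same ev_retrack => ->; rewrite P1.
- move=> PE; have [y1 D1 v1] := val_surj (ev E t1); exists y1 => //.
  by rewrite retrack_same ev_retrack P1 v1.
Qed.

Lemma tt_lt m n N : m < n -> tt n < N -> tt m < N.
Proof. by rewrite /tt; lia. Qed.

Lemma term_recognizer_correct N t : tt (term_code t) < N ->
  recognizesE N (term_recognizer (D ^ N) (term_code t)) (fun E => val (E (tt (term_code t))) = ev E t).
Proof.
have [E1 E2 E3] := term_codeE.
elim: t => [x|t1 IH1 t2 IH2|t IH] ltN.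
- rewrite term_recognizerE ?E1 ?pr_gt0 // !argE /= -E1.
  have H := recognizesE_KR N (vt x) (tt (term_code (Var x))) 0 HKeq.
  by apply: recognizesE_ext H => E _; rewrite /ev /= /env_of; split=> ->.
- have lt1 : term_code t1 < term_code (Add t1 t2) by rewrite E2; exact: lt_code1.
  have lt2 : term_code t2 < term_code (Add t1 t2) by rewrite E2; exact: lt_code2.
  have l1 := tt_lt lt1 ltN; have l2 := tt_lt lt2 ltN.
  rewrite {1}E2 term_recognizerE ?pr_gt0 // !argE /= -E2.
  have ne m : m < term_code (Add t1 t2) -> tt (term_code (Add t1 t2)) != tt m.
    by move=> lm; rewrite tt_inj gtn_eqF.
  have H := recognizesE_KR N (tt (term_code t1)) (tt (term_code t2)) (tt (term_code (Add t1 t2))) HKadd.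
  apply: (recognizesE_terms (P := fun u v E => val (E (tt (term_code (Add t1 t2)))) = (u + v)%R)) H _ _ => //.
  + exact: IH1.
  + exact: IH2.
  + by move=> u v E y; rewrite retrack_other ?ne.
  + by move=> u v E y; rewrite retrack_other ?ne.
- have lt1 : term_code t < term_code (Lam t) by rewrite E3; exact: lt_code1.
  have l1 := tt_lt lt1 ltN.
  rewrite {1}E3 term_recognizerE ?pr_gt0 // !argE /= -E3.
  have H := recognizesE_KR N (tt (term_code t)) (tt (term_code (Lam t))) 0 HKlam.
  apply: (recognizesE_term1 (P := fun u E => val (E (tt (term_code (Lam t)))) = (a * u)%R)) H _ => //.
    exact: IH.
  by move=> u E y; rewrite retrack_other // tt_inj gtn_eqF.
Qed.

Lemma formula_recognizer_correct N p : tt (formula_code p) < N ->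
  recognizesE N (formula_recognizer (D ^ N) (formula_code p)) (fun E => @sat (S_ a) (env_of E) p).
Proof.
have [[E1 E2 E3] [E4 E5 E6]] := formula_codeE.
elim: p => [t1 t2|t1 t2|t|q IHq|q IHq r IHr|x q IHq] ltN.
- have l1 : tt (term_code t1) < N by apply: tt_lt ltN; rewrite E1; exact: lt_code1.
  have l2 : tt (term_code t2) < N by apply: tt_lt ltN; rewrite E1; exact: lt_code2.
  rewrite {1}E1 formula_recognizerE ?pr_gt0 // !argE /=.
  have H := recognizesE_KR N (tt (term_code t1)) (tt (term_code t2)) 0 HKeq.
  exact: (recognizesE_terms (P := fun u v E => u = v) l1 l2 (term_recognizer_correct l1) (term_recognizer_correct l2) H).
- have l1 : tt (term_code t1) < N by apply: tt_lt ltN; rewrite E2; exact: lt_code1.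
  have l2 : tt (term_code t2) < N by apply: tt_lt ltN; rewrite E2; exact: lt_code2.
  rewrite {1}E2 formula_recognizerE ?pr_gt0 // !argE /=.
  have H := recognizesE_KR N (tt (term_code t1)) (tt (term_code t2)) 0 HKlt.
  exact: (recognizesE_terms (P := fun u v E => (u < v)%R) l1 l2 (term_recognizer_correct l1) (term_recognizer_correct l2) H).
- have l1 : tt (term_code t) < N by apply: tt_lt ltN; rewrite E3; exact: lt_code1.
  rewrite {1}E3 formula_recognizerE ?pr_gt0 // !argE /=.
  have H := recognizesE_KR N (tt (term_code t)) 0 0 HKint.
  exact: (recognizesE_term1 (P := fun u E => u \is a Num.int) l1 (term_recognizer_correct l1) H).
- have l1 : tt (formula_code q) < N by apply: tt_lt ltN; rewrite E4; exact: lt_code1.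
  rewrite {1}E4 formula_recognizerE ?pr_gt0 // !argE /=.
  exact: (recognizes_not (IHq l1)).
- have l1 : tt (formula_code q) < N by apply: tt_lt ltN; rewrite E5; exact: lt_code1.
  have l2 : tt (formula_code r) < N by apply: tt_lt ltN; rewrite E5; exact: lt_code2.
  rewrite {1}E5 formula_recognizerE ?pr_gt0 // !argE /=.
  exact: (recognizesE_and (IHq l1) (IHr l2)).
- have l1 : tt (formula_code q) < N by apply: tt_lt ltN; rewrite E6; exact: lt_code2.
  have lx : vt x < N.
    by have : tt x < N by [apply: tt_lt ltN; rewrite E6; exact: lt_code1]; rewrite /tt /vt; lia.
  rewrite {1}E6 formula_recognizerE ?pr_gt0 // !argE /=.
  apply: recognizesE_ext (recognizesE_ex lx (IHq l1)) => E _; split.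
    by move=> [y _]; rewrite env_update => h; exists (val y).
  move=> [c h]; have [y yD Ey] := val_surj c; exists y => //.
  by rewrite env_update Ey.
Qed.

Lemma sat_ext p (e e' : nat -> R) : {in free_vars p, e =1 e'} ->
  @sat (S_ a) e p <-> @sat (S_ a) e' p.
Proof.
have ev_ext t (f f' : nat -> R) : {in term_vars t, f =1 f'} ->
    @eval (S_ a) f t = @eval (S_ a) f' t.
  elim: t => [x|t1 IH1 t2 IH2|t IH] /= H; first by apply: H; rewrite inE.
    by rewrite IH1 1?IH2 // => x xt; apply: H; rewrite mem_cat xt ?orbT.
  by rewrite IH.
elim: p e e' => [t1 t2|t1 t2|t|q IHq|q IHq r IHr|x q IHq] e e' /= H.
- by rewrite !(ev_ext _ e e') // => x xt; apply: H; rewrite mem_cat xt ?orbT.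
- by rewrite !(ev_ext _ e e') // => x xt; apply: H; rewrite mem_cat xt ?orbT.
- by rewrite (ev_ext _ e e').
- by have := IHq _ _ H; tauto.
- have hq : {in free_vars q, e =1 e'} by move=> x h; apply: H; rewrite mem_cat h.
  have hr : {in free_vars r, e =1 e'} by move=> x h; apply: H; rewrite mem_cat h orbT.
  by have := IHq _ _ hq; have := IHr _ _ hr; tauto.
- have h c : {in free_vars q, update e x c =1 update e' x c}.
    by move=> y yq; rewrite /update; case: eqP => // /eqP yx; apply: H; rewrite mem_filter yx.
  by split=> -[c Hc]; exists c; apply/(IHq _ _ (h c)).
Qed.

Let Lb n := D ^ (tt n).+1.
(* Truth of a sentence does not depend on the word, so the constant word [0] is
   used: it has a factorization [s = e] as soon as a power of its letter is
   idempotent. *)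
Let pow n k := nat_rec (fun=> nat) (lt_ (Lb n) (formula_recognizer (Lb n) n) 0)
  (fun _ r => mul_ (formula_recognizer (Lb n) n) r (lt_ (Lb n) (formula_recognizer (Lb n) n) 0)) k.

Lemma ty0 n i j : i < j -> ty (Lb n) (formula_recognizer (Lb n) n) (fun=> 0) i j = pow n (j - i.+1).
Proof. by move=> ltij; rewrite /ty; elim: (j - i.+1) => //= k ->. Qed.

(** The types of the factors of a constant word are the powers of one element, and Ramsey's theorem
    finds an idempotent among them. *)
Lemma idem_exists p : exists k, let n := formula_code p in
  mul_ (formula_recognizer (Lb n) n) (pow n k) (pow n k) == pow n k.
Proof.
set n := formula_code p; have [WR _] := @formula_recognizer_correct (tt n).+1 p (ltnSn _).
have W0 : word (Lb n) (fun=> 0) by move=> i; rewrite expn_gt0 D0.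
have [k [s [e [kS k0 _ ke]]]] := fact_exists WR W0.
have kH := homo_lt kS.
exists (k 1 - (k 0).+1); rewrite /= -!ty0 // ke // -{3}(ke 0 2) //.
by rewrite (@ty_cat _ _ _ _ (k 1)) ?kH // !ke.
Qed.

Lemma idem_decides p k : let n := formula_code p in
  mul_ (formula_recognizer (Lb n) n) (pow n k) (pow n k) = pow n k -> sentence p ->
  theory (S_ a) p <-> acc_ (formula_recognizer (Lb n) n) (pow n k) (pow n k).
Proof.
set n := formula_code p => /= idem sp.
have [WR H] := @formula_recognizer_correct (tt n).+1 p (ltnSn _).
have W0 : word (Lb n) (fun=> 0) by move=> i; rewrite expn_gt0 D0.
(* [pow n k] is the type of [k.+1] letters, so the multiples of [k.+1] serve as cut points. *)
have tyk i j : i < j -> ty (Lb n) (formula_recognizer (Lb n) n) (fun=> 0) (k.+1 * i) (k.+1 * j) = pow n k.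
  elim: j => // j IH; rewrite ltnS leq_eqVlt => /orP[/eqP->|ltij].
    by rewrite ty0 ?ltn_pmul2l // mulnS; congr pow; lia.
  by rewrite (@ty_cat _ _ _ _ (k.+1 * j)) ?ltn_pmul2l // IH // ty0 ?ltn_pmul2l //
    (_ : _ - _ = k) // mulnS; lia.
have F : fact (Lb n) (formula_recognizer (Lb n) n) (fun=> 0) (fun i => k.+1 * i.+1) (pow n k) (pow n k).
  split=> [i|||i j ltij]; rewrite ?ltn_pmul2l ?muln1 //.
    by have := tyk 0 1 isT; rewrite muln0 muln1.
  by rewrite tyk.
rewrite -(H _ _ _ _ W0 F); split=> [[_ h]|h]; first exact: h.
split=> // e.
have hx : {in free_vars p, env_of (fun z _ => dig D z 0) =1 e} by move=> x; rewrite sp.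
by case: (sat_ext hx) => h1 _; exact: h1.
Qed.

Lemma theory_decidable : decidable_theory (theory (S_ a)).
Proof.
pose good n k := mul_ (formula_recognizer (Lb n) n) (pow n k) (pow n k) == pow n k.
(* On numbers that do not code a sentence the search for an idempotent stops at once; this makes the
   minimization regular. *)
have ex n : exists k, ~~ is_sentence n || good n k.
  have [/is_sentence_inv[p _ <-]|] := boolP (is_sentence n); last by exists 0.
  by have [k gk] := idem_exists p; exists k.
pose K n := ex_minn (ex n).
pose T n := nat_of_bool (is_sentence n && acc_ (formula_recognizer (Lb n) n) (pow n (K n)) (pow n (K n))).
have rL A : Rec A -> Rec (fun e => Lb (A e)) by move=> rA; rewrite /Lb /tt; rec_solve.
have rF A : Rec A -> Rec (fun e => formula_recognizer (Lb (A e)) (A e)) by move=> rA; apply: Rec_FR => //; exact: rL.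
have rlt A B C : Rec A -> Rec B -> Rec C -> Rec (fun e => lt_ (A e) (B e) (C e)).
  by move=> *; rewrite /lt_; rec_tac.
have rmul A B C : Rec A -> Rec B -> Rec C -> Rec (fun e => mul_ (A e) (B e) (C e)).
  by move=> *; rewrite /mul_ /bnd; rec_tac.
have racc A B C : Rec A -> Rec B -> Rec C -> Rec (fun e => acc_ (A e) (B e) (C e)).
  by move=> *; rewrite /acc_ /bnd; rec_tac.
have rpow A B : Rec A -> Rec B -> Rec (fun e => pow (A e) (B e)).
  move=> rA rB; apply: (@Rec_comp2 pow) rA rB; rewrite /pow; apply: Rec_prim; last exact: Rec_var.
    by apply: rlt; [apply: rL | apply: rF |]; rec_solve.
  apply: rmul; [by apply: rF; rec_solve | by rec_solve |].
  by apply: rlt; [apply: rL | apply: rF |]; rec_solve.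
have rK A : Rec A -> Rec (fun e => K (A e)).
  apply: Rec_comp1; apply: (@Rec_min (fun k e => ~~ is_sentence (e 0) || good (e 0) k)).
  - apply: Rec_orb; first by apply: Rec_negb; apply: Rec_is_sentence; rec_solve.
    by apply: Rec_eqn; [apply: rmul; [apply: rF | apply: rpow | apply: rpow] | apply: rpow];
      rec_solve.
  - by move=> e; rewrite /K; case: ex_minnP.
  - move=> e y; rewrite /K; case: ex_minnP => m _ min lt; apply/negP => /min.
    by rewrite leqNgt lt.
exists (fun v => T (thead v)); split.
- apply: recursive_Rec; apply: Rec_andb; first by apply: Rec_is_sentence; rec_solve.
  by apply: racc; [apply: rF | apply: rpow | apply: rpow]; rec_solve; apply: rK; rec_solve.
- move=> n [p tp <-]; rewrite /T -[thead _]/(formula_code p).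
  have sp : sentence p by case: tp.
  rewrite is_sentence_code //=; rewrite (_ : acc_ _ _ _ = true) //.
  apply/(idem_decides _ sp) => //; rewrite /K; case: ex_minnP => m.
  by rewrite is_sentence_code //= => /eqP.
- move=> n nT; rewrite /T -[thead _]/n; case: (boolP (is_sentence n)) => // /is_sentence_inv[p sp En].
  rewrite -En /=; case E: (acc_ _ _ _) => //; case: nT; exists p => //.
  apply/(idem_decides _ sp); last exact: E.
  rewrite /K; case: ex_minnP => m.
  by rewrite is_sentence_code //= => /eqP.
Qed.

End Decide.

(** * The diagonal sentence and its code *)

Fixpoint numeral n := if n is m.+1 then Add (numeral m) (Var 1) else Var 1.

(* The formula [one] will define the number 1 in [Var 1]; as [numeral n] has the
   value [n + 1], the inner equation says that [Var 0] is the code of [phi]. *)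
Definition diag one phi := FEx 1 (FAnd one (FEx 0
  (FAnd (FEq (Add (Var 0) (Var 1)) (numeral (formula_code phi))) phi))).

Lemma sentence_diag one phi : {subset free_vars one <= [:: 1]} ->
  {subset free_vars phi <= [:: 0]} -> sentence (diag one phi).
Proof.
move=> h1 h0; rewrite /sentence /=; apply/eqP; rewrite -[_ == _]negbK -has_filter.
apply/hasPn => y; rewrite mem_cat negbK => /orP[/h1|]; first by rewrite inE.
rewrite inE => /orP[//|]; rewrite mem_filter mem_cat => /andP[y0].
case/orP=> [|/h0]; last by rewrite inE (negbTE y0).
by elim: (formula_code phi) => [|n IH] /=; rewrite ?mem_cat inE // => /orP[/IH|].
Qed.

Lemma Rec_numeral A : Rec A -> Rec (fun e => term_code (numeral (A e))).
Proof.
move=> rA; pose add1 := fun t => pr 1 (pr t (pr (term_code (Var 1)) 0)).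
apply: (@Rec_ext (fun e => nat_rec (fun=> nat) (term_code (Var 1)) (fun _ t => add1 t) (A e))).
  move=> e; elim: (A e) => // n IH.
  have [_ addE _] := term_codeE.
  by rewrite [numeral n.+1]/= addE -IH.
apply: Rec_prim => //; first exact: Rec_const.
by rewrite /add1; rec_solve.
Qed.

Definition diag_code o n :=
  pr 5 (pr 1 (pr (pr 4 (pr o (pr (pr 5 (pr 0 (pr
    (pr 4 (pr (pr 0 (pr (term_code (Add (Var 0) (Var 1))) (pr (term_code (numeral n)) 0)))
      (pr n 0))) 0))) 0))) 0)).

Lemma diag_codeE one phi :
  formula_code (diag one phi) = diag_code (formula_code one) (formula_code phi).
Proof.
have [[eqE _ _] [_ andE exE]] := formula_codeE.
by rewrite !exE !andE !exE !andE eqE.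
Qed.

Local Open Scope ring_scope.

(** * Numeration in the base of a quadratic unit *)

Section Numeration.
Variables (R : realType) (b : R) (t : nat).
Hypotheses (t3 : (3 <= t)%N) (b1 : 1 < b) (bE : b ^+ 2 = t%:R * b - 1).

Let c := b^-1.

Lemma b_gt0 : 0 < b. Proof. by apply: lt_trans b1. Qed.

(** The roots of [X ^ 2 - t X + 1] have product 1 and sum [t]: the inverse [c] of [b] is also its
    conjugate. *)
Lemma cE : c = t%:R - b.
Proof.
have b0 := b_gt0; apply: (mulfI (lt0r_neq0 b0)); rewrite divff ?gt_eqF //.
by rewrite mulrBr -expr2 bE; ring.
Qed.

Lemma c_gt0 : 0 < c. Proof. by rewrite invr_gt0 b_gt0. Qed.

Lemma mulbc : b * c = 1. Proof. by rewrite divff ?gt_eqF ?b_gt0. Qed.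

Lemma t_ge3 : 3 <= t%:R :> R. Proof. by rewrite (ler_nat R 3). Qed.

Lemma c_lt1 : c < 1. Proof. by rewrite invf_lt1 ?b_gt0. Qed.

Lemma b_gt2 : 2 < b.
Proof. have := c_lt1; rewrite cE; have := t_ge3; lra. Qed.

Lemma b_ltt : b < t%:R.
Proof. have := c_gt0; rewrite cE; lra. Qed.

Lemma c_lt2 : 2 * c < 1.
Proof. by have := mulbc; have := b_gt2; have := c_gt0; nra. Qed.

Lemma subbc_gt1 : 1 < b - c.
Proof. have := b_gt2; have := c_lt1; lra. Qed.

(** A positive term would force unbounded growth. This does the work of convergence arguments: a
    fractional tail is determined, bounded and signed through its recurrence and boundedness
    alone. *)
Lemma double_bounded (z : nat -> R) (C : R) :
  (forall n, 2 * z n <= z n.+1) -> (forall n, z n <= C) -> forall n, z n <= 0.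
Proof.
move=> zS zC n; rewrite leNgt; apply/negP => z0.
have grow k : z n * k.+1%:R <= z (n + k)%N.
  elim: k => [|k IH]; first by rewrite addn0 mulr1.
  rewrite addnS; apply: le_trans (zS _); move: IH; rewrite -!natr1.
  have : 0 <= k%:R :> R by [].
  by move: (k%:R) => K K0 IH; nra.
have h0 : 0 <= `|C| / z n by rewrite divr_ge0 // ltW.
have := archi_boundP h0; rewrite ltr_pdivrMr // => h1.
have h2 := grow (Num.bound (`|C| / z n)); have h3 := zC (n + Num.bound (`|C| / z n))%N.
have h4 := ler_norm C; move: h1 h2 h3; rewrite -natr1.
by move: (_%:R) (z (_ + _)%N) => K w; nra.
Qed.

(* [U n] is the sum of the [u m * b ^ (m - n)], and [y n] that of the
   [v m / b ^ (m - n + 1)], for [m >= n]; [u] has finite support. *)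
Definition tailU (u : nat -> int) (U : nat -> R) :=
  (forall n, U n = (u n)%:~R + b * U n.+1) /\
  exists K, forall n, (K <= n)%N -> U n = 0.

Definition tailV (v : nat -> int) (y : nat -> R) :=
  (forall n, y n.+1 = b * y n - (v n)%:~R) /\ exists C, forall n, `|y n| <= C.

Lemma tailU_uniq u U U' : tailU u U -> tailU u U' -> forall n, U n = U' n.
Proof.
move=> [HU [K UK]] [HU' [K' UK']] n.
have H k : U (maxn K K' - k)%N = U' (maxn K K' - k)%N.
  elim: k => [|k IH]; first by rewrite subn0 UK ?leq_maxl // UK' ?leq_maxr.
  have [lek|ltk] := leqP (maxn K K') k.
    have E : (maxn K K' - k.+1 = maxn K K' - k)%N by lia.
    by rewrite E.
  by rewrite HU HU' subnSK // IH.
have [len|ltn] := leqP n (maxn K K'); first by rewrite -(subKn len).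
by rewrite UK ?UK' //; apply: leq_trans (ltnW ltn); rewrite ?leq_maxl ?leq_maxr.
Qed.

Lemma tailV_uniq v y y' : tailV v y -> tailV v y' -> forall n, y n = y' n.
Proof.
move=> [H [C yC]] [H' [C' yC']] n; apply/eqP; rewrite -subr_eq0 -normr_eq0.
rewrite eq_le normr_ge0 andbT.
apply: (@double_bounded (fun n => `|y n - y' n|) (C + C')) => {}n.
  have -> : y n.+1 - y' n.+1 = b * (y n - y' n) by rewrite H H'; ring.
  by rewrite normrM (gtr0_norm b_gt0) ler_wpM2r ?normr_ge0 ?ltW ?b_gt2.
by apply: le_trans (ler_normB _ _) _; apply: lerD.
Qed.

Lemma tailV_bound v y (B : R) : tailV v y -> (forall n, `|(v n)%:~R| <= B) ->
  forall n, `|y n| <= B.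
Proof.
move=> [H [C yC]] vB n; rewrite -subr_le0.
apply: (@double_bounded (fun n => `|y n| - B) (C - B)) => {}n; last by rewrite lerD2r.
have h1 : b * `|y n| <= `|y n.+1| + `|(v n)%:~R|.
  rewrite -{1}(gtr0_norm b_gt0) -normrM.
  by rewrite (_ : b * y n = y n.+1 + (v n)%:~R) ?ler_normD // H; ring.
have := vB n; have := b_gt2; have := normr_ge0 (y n); have := normr_ge0 ((v n)%:~R : R); nra.
Qed.

Lemma tailV_ge0 v y : tailV v y -> (forall n, 0 <= v n) -> 0 <= y 0%N.
Proof.
move=> [H [C yC]] v0; rewrite -oppr_le0.
suff : Num.max (- y 0%N) 0 <= 0 by rewrite ge_max => /andP[].
apply: (@double_bounded (fun n => Num.max (- y n) 0) `|C|) => n.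
  have [y0|y0] := leP (- y n) 0; first by rewrite mulr0 le_max lexx orbT.
  rewrite le_max H; apply/orP; left.
  have : 0 <= (v n)%:~R :> R by rewrite ler0z.
  by have := b_gt2; nra.
rewrite ge_max normr_ge0 andbT; apply: le_trans (ler_norm C).
by apply: le_trans (yC n); rewrite -normrN ler_norm.
Qed.

Lemma tailU_ge0 u U : tailU u U -> (forall n, 0 <= u n) -> 0 <= U 0%N.
Proof.
move=> [H [K UK]] u0.
have G k : 0 <= U (K - k)%N.
  elim: k => [|k IH]; first by rewrite subn0 UK.
  have [lek|ltk] := leqP K k; first by rewrite (_ : (K - k.+1 = K - k)%N) //; lia.
  by rewrite H subnSK // addr_ge0 ?ler0z // mulr_ge0 // ltW ?b_gt0.
by rewrite -(subnn K).
Qed.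

Lemma tailU_lin u1 U1 u2 U2 (k l : int) : tailU u1 U1 -> tailU u2 U2 ->
  tailU (fun n => k * u1 n + l * u2 n) (fun n => k%:~R * U1 n + l%:~R * U2 n).
Proof.
move=> [H [K UK]] [H' [K' UK']]; split=> [n|].
  by rewrite H H' intrD !intrM; ring.
exists (maxn K K') => n; rewrite geq_max => /andP[le1 le2].
by rewrite UK // UK' // !mulr0 addr0.
Qed.

Lemma tailV_lin v1 y1 v2 y2 (k l : int) : tailV v1 y1 -> tailV v2 y2 ->
  tailV (fun n => k * v1 n + l * v2 n) (fun n => k%:~R * y1 n + l%:~R * y2 n).
Proof.
move=> [H [C yC]] [H' [C' yC']]; split=> [n|].
  by rewrite H H' intrD !intrM; ring.
exists (`|k%:~R| * C + `|l%:~R| * C') => n.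
by apply: le_trans (ler_normD _ _) _; rewrite !normrM lerD // ler_wpM2l.
Qed.

Lemma tailU_sum K u : (forall n, (K <= n)%N -> u n = 0) ->
  exists2 U, tailU u U & U 0%N = \sum_(n < K) (u n)%:~R * b ^+ n.
Proof.
elim: K u => [|K IH] u uK.
  exists (fun=> 0); last by rewrite big_ord0.
  by split=> [n|]; [rewrite uK // mulr0 addr0 | exists 0%N].
have [U [H [K' UK]] U0] := IH (fun n => u n.+1) (fun n len => uK n.+1 len).
exists (fun n => if n is n'.+1 then U n' else (u 0%N)%:~R + b * U 0%N).
  split=> [[|n] //|]; exists K'.+1 => -[|n] //; exact: UK.
rewrite big_ord_recl expr0 mulr1 U0 mulr_sumr; congr (_ + _).
by apply: eq_bigr => i _; rewrite exprS; ring.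
Qed.

Lemma tailV_sum K v : (forall n, (K <= n)%N -> v n = 0) ->
  exists2 y, tailV v y & y 0%N = \sum_(n < K) (v n)%:~R * c ^+ n.+1.
Proof.
elim: K v => [|K IH] v vK.
  exists (fun=> 0); last by rewrite big_ord0.
  by split=> [n|]; [rewrite vK // mulr0 subr0 | exists 0 => n; rewrite normr0].
have [y [H [C yC]] y0] := IH (fun n => v n.+1) (fun n len => vK n.+1 len).
exists (fun n => if n is n'.+1 then y n' else c * ((v 0%N)%:~R + y 0%N)).
  split=> [[|n] //|].
    by rewrite mulrA mulbc; ring.
  exists (Num.max C `|c * ((v 0%N)%:~R + y 0%N)|) => -[|n].
    by rewrite le_max lexx orbT.
  by rewrite le_max yC.
rewrite big_ord_recl expr1 y0 mulrDr mulr_sumr mulrC; congr (_ + _).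
by apply: eq_bigr => i _; rewrite [in RHS]exprS; ring.
Qed.

(** With the partial sums [V n], the bounds [V n - B * c ^+ n] increase and [V n + B * c ^+ n]
    decrease, because [2 * c < 1]. The supremum of the former is the value of the series. *)
Lemma tailV_ex v (B : R) : (forall n, `|(v n)%:~R| <= B) -> exists y, tailV v y.
Proof.
move=> vB; pose V n := \sum_(i < n) (v i)%:~R * c ^+ i.+1.
have B0 : 0 <= B by apply: le_trans (vB 0%N).
have VS n : V n.+1 = V n + (v n)%:~R * c ^+ n.+1 by rewrite /V big_ord_recr.
have step n : `|(v n)%:~R * c ^+ n.+1| <= B * c ^+ n - B * c ^+ n.+1.
  have cn := exprn_gt0 n c_gt0.
  rewrite normrM (gtr0_norm (exprn_gt0 _ c_gt0)) exprS.
  have := vB n; have := c_lt2; have := c_gt0.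
  move: (c ^+ n) (`|_|) cn => C' w; move: B0 => B0 cn c0 c2 wB.
  have h1 : w * (c * C') <= B * (c * C') by rewrite ler_wpM2r // mulr_ge0 // ltW.
  have h2 : 0 <= B * C' by rewrite mulr_ge0 // ltW.
  nra.
have lo n k : V n - B * c ^+ n <= V (n + k)%N - B * c ^+ (n + k).
  elim: k => [|k IH]; first by rewrite addn0.
  apply: le_trans IH _; rewrite addnS VS.
  by have := step (n + k)%N; rewrite ler_norml => /andP[]; lra.
have hi n k : V (n + k)%N + B * c ^+ (n + k) <= V n + B * c ^+ n.
  elim: k => [|k IH]; first by rewrite addn0.
  apply: le_trans IH; rewrite addnS VS.
  by have := step (n + k)%N; rewrite ler_norml => /andP[]; lra.
have lohi n k : V n - B * c ^+ n <= V k + B * c ^+ k.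
  apply: le_trans (lo n k) _; apply: le_trans (hi k n); rewrite addnC.
  have : 0 <= B * c ^+ (k + n) by rewrite mulr_ge0 // exprn_ge0 // ltW ?c_gt0.
  lra.
pose A : set R := fun x => exists n, x = V n - B * c ^+ n.
have supA : has_sup A.
  split; first by exists (V 0%N - B * c ^+ 0), 0%N.
  by exists (V 0%N + B * c ^+ 0) => x [n ->]; exact: lohi.
pose x := sup A.
have x1 n : V n - B * c ^+ n <= x by apply: sup_upper_bound => //; exists n.
have x2 n : x <= V n + B * c ^+ n.
  by apply: sup_le_ub; [case: supA | move=> z [k ->]; exact: lohi].
exists (fun n => b ^+ n * (x - V n)); split=> [n|].
  rewrite VS exprS opprD addrA mulrBr mulrA; congr (_ - _).
  rewrite mulrCA -exprS -exprMn mulbc expr1n mulr1 //.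
exists B => n; rewrite normrM (gtr0_norm (exprn_gt0 _ b_gt0)).
rewrite -[leRHS]mulr1 -(expr1n _ n) -mulbc exprMn mulrCA ler_wpM2l ?exprn_ge0 ?(ltW b_gt0) //.
by rewrite ler_norml; have := x1 n; have := x2 n; lra.
Qed.

(** Greedy expansion: since [b < t], a remainder [0 <= r < 1] yields a digit [floor (b * r)] of at
    most [t - 1]. *)
Lemma ge0_digits (x : R) : 0 <= x -> exists u v : nat -> int,
  [/\ forall n, 0 <= u n <= t%:Z - 1, forall n, 0 <= v n <= t%:Z - 1,
    exists K, forall n, (K <= n)%N -> u n = 0
   & exists U y, [/\ tailU u U, tailV v y & x = U 0%N + y 0%N]].
Proof.
move=> x0.
have flP (r : R) : 0 <= r < 1 -> 0 <= Num.floor (b * r) <= t%:Z - 1.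
  move=> /andP[r0 r1]; rewrite floor_ge0 mulr_ge0 ?(ltW b_gt0) //=.
  rewrite -ltzD1 subrK -(ltr_int R); apply: le_lt_trans (ge_floor _) _ => //.
  by rewrite -pmulrn; apply: lt_trans b_ltt; rewrite -[ltRHS]mulr1 ltr_pM2l ?b_gt0.
have flF (r : R) : 0 <= b * r - (Num.floor (b * r))%:~R < 1.
  by rewrite subr_ge0 ge_floor //= ltrBlDl; have := lt_succ_floor (b * r); rewrite intrD addrC.
have IP N : forall x, 0 <= x < b ^+ N -> exists u U,
    [/\ forall n, 0 <= u n <= t%:Z - 1, forall n, (N <= n)%N -> u n = 0, tailU u U
      & 0 <= x - U 0%N < 1].
  elim: N => [|N IH] {x0}x /andP[x0].
    rewrite expr0 => x1; exists (fun=> 0), (fun=> 0); split=> //.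
    - by move=> _; rewrite lexx subr_ge0 lez_nat (leq_trans _ t3).
    - by split=> [n|]; [rewrite mulr0 addr0 | exists 0%N].
    - by rewrite subr0 x0.
  rewrite exprS => xb.
  (* [x] is divided by [b]; the remainder of the quotient supplies the lowest integral digit of
     [x]. *)
  have [|u [U [u1 u2 [U1 [K UK]] /andP[r0 r1]]]] := IH (c * x).
    rewrite mulr_ge0 ?(ltW c_gt0) //= -[ltRHS]mul1r -mulbc mulrAC mulrC.
    by rewrite ltr_pM2r ?c_gt0.
  set r := _ - _ in r0 r1.
  have rI : 0 <= r < 1 by rewrite r0.
  exists (fun n => if n is n'.+1 then u n' else Num.floor (b * r)).
  exists (fun n => if n is n'.+1 then U n' else (Num.floor (b * r))%:~R + b * U 0%N); split.
  - by move=> [|n] //; exact: flP.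
  - by move=> [|n] //; exact: u2.
  - by split=> [[]//|]; exists K.+1 => -[|n] //; exact: UK.
  - rewrite opprD addrA addrAC (_ : x - b * U 0%N = b * r); first exact: flF.
    by rewrite /r mulrBr mulrA mulbc mul1r.
have [N ltN] : exists N, x < b ^+ N.
  exists (Num.bound x); apply: lt_le_trans (archi_boundP x0) _.
  elim: (Num.bound x) => [|n IH]; first by rewrite expr0.
  rewrite exprS -natr1.
  have : 1 <= b ^+ n by rewrite exprn_ege1 // ltW.
  have := b_gt2; move: (b ^+ n) (n%:R) IH => B K; nra.
have [|u [U [u1 u2 TU rI]]] := IP N x; first by rewrite x0.
pose y := fix y n := if n is n'.+1 then b * y n' - (Num.floor (b * y n'))%:~R else x - U 0%N.
have yI n : 0 <= y n < 1 by case: n => //= n; exact: flF.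
exists u, (fun n => Num.floor (b * y n)); split=> //.
- by move=> n; exact: flP.
- by exists N.
- exists U, y; split=> //; last by rewrite /=; ring.
  split=> //; exists 1 => n; have /andP[h1 h2] := yI n.
  by rewrite ger0_norm // ltW.
Qed.

(* Here [U n = p n + q n * b] and [y n = - (P n + Q n * b)]: the tails of a null
   expansion lie in Z[b], and the conjugate of each of them is again bounded, so
   that the carries range over a finite set. *)
Definition carry (M : int) (e d p q P Q : nat -> int) :=
  [/\ forall n, p n = e n - q n.+1 /\ q n = p n.+1 + t%:Z * q n.+1,
      forall n, P n.+1 = d n - Q n /\ Q n.+1 = P n + t%:Z * Q n,
      P 0%N = p 0%N /\ Q 0%N = q 0%N,
      exists K, forall n, (K <= n)%N -> p n = 0 /\ q n = 0
    & forall n, [/\ `|p n| <= M, `|q n| <= M, `|P n| <= M & `|Q n| <= M]].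

(** Multiplication by [b] sends the coordinates [(p, q)] to [(- q, p + t * q)]. The same integers
    describe multiplication by [c] on the conjugate side ([step_c]), so one recurrence controls both
    embeddings. *)
Lemma step_b (p q e : int) :
  (e - q)%:~R + (p + t%:Z * q)%:~R * b = e%:~R + b * (p%:~R + q%:~R * b) :> R.
Proof.
rewrite rmorphB rmorphD rmorphM /= -pmulrn.
have -> : b * (p%:~R + q%:~R * b) = b * p%:~R + q%:~R * b ^+ 2 by ring.
rewrite bE; ring.
Qed.

Lemma cE2 : c ^+ 2 = t%:R * c - 1.
Proof.
have h := cE; have h2 := mulbc; rewrite expr2 {1}h mulrBl mulbc //.
Qed.

Lemma step_c (p q e : int) :
  (e - q)%:~R + (p + t%:Z * q)%:~R * c = e%:~R + c * (p%:~R + q%:~R * c) :> R.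
Proof.
rewrite rmorphB rmorphD rmorphM /= -pmulrn.
have -> : c * (p%:~R + q%:~R * c) = c * p%:~R + q%:~R * c ^+ 2 by ring.
rewrite cE2; ring.
Qed.

(** The two embeddings differ by [q * (b - c)] with [b - c > 1], hence [|q| <= 3 * B]; then
    [|p| <= 2 * B + 3 * B * c], which is below [4 * B] as [c < 1 / 2]. *)
Lemma carry_bound (p q : int) (B : int) :
  `|p%:~R + q%:~R * b| <= B%:~R :> R -> `|p%:~R + q%:~R * c| <= 2 * B%:~R :> R ->
  `|p| <= 4 * B /\ `|q| <= 4 * B.
Proof.
move=> h1 h2; have h3 := subbc_gt1; have h4 := c_gt0; have h5 := c_lt2.
have B0 : 0 <= B%:~R :> R by apply: le_trans h1.
have hq : `|q%:~R| <= 3 * B%:~R :> R.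
  have : `|q%:~R * (b - c)| <= 3 * B%:~R :> R.
    rewrite (_ : q%:~R * (b - c) = (p%:~R + q%:~R * b) - (p%:~R + q%:~R * c)); last by ring.
    by apply: le_trans (ler_normB _ _) _; lra.
  rewrite normrM (gtr0_norm (lt_trans ltr01 h3)); apply: le_trans.
  by rewrite ler_peMr // ltW.
have hp : `|p%:~R| <= 4 * B%:~R :> R.
  rewrite (_ : p%:~R = (p%:~R + q%:~R * c) - q%:~R * c); last by ring.
  apply: le_trans (ler_normB _ _) _; rewrite [X in _ + X]normrM (gtr0_norm h4).
  by move: (`|_ + _|) h2 (`|q%:~R|) hq (normr_ge0 (q%:~R : R)) => w hw v hv v0; nra.
by rewrite -!(ler_int R) !intrM !intr_norm; split=> //; lra.
Qed.

(** The integral tails lie in [Z[b]] because they are computed from the end of a finite support. As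
    the two halves cancel, [- y 0] equals [U 0] and lies in [Z[b]] too, and so do all later
    fractional tails. *)
Lemma carryP (e d : nat -> int) U y (B : int) :
  tailU e U -> tailV d y -> (forall n, `|e n| <= B) -> (forall n, `|d n| <= B) ->
  U 0%N + y 0%N = 0 -> exists p q P Q, carry (4 * B) e d p q P Q.
Proof.
move=> TU TV eB dB sum0.
have toR (u : nat -> int) n : `|u n| <= B -> `|(u n)%:~R| <= B%:~R :> R.
  by rewrite -intr_norm ler_int.
have [_ [K UK]] := TU.
have eK n : (K <= n)%N -> e n = 0.
  move=> len; have [/(_ n) H _] := TU; move: H; rewrite !UK ?(leq_trans len) //.
  by rewrite mulr0 addr0 => /esym/eqP; rewrite intr_eq0 => /eqP.
(* [f k] holds the coordinates of the tail at [K - k], while [g] continues from position 0 into the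
   fractional half. *)
pose f := fix f k : int * int := if k is k'.+1
  then (e (K - k)%N - (f k').2, (f k').1 + t%:Z * (f k').2) else (0, 0).
pose p n := (f (K - n)%N).1; pose q n := (f (K - n)%N).2.
pose g := fix g k : int * int := if k is k'.+1
  then (d k' - (g k').2, (g k').1 + t%:Z * (g k').2) else (p 0%N, q 0%N).
pose P n := (g n).1; pose Q n := (g n).2.
have pq0 n : (K <= n)%N -> p n = 0 /\ q n = 0.
  by rewrite /p /q -subn_eq0 => /eqP ->.
have pqS n : p n = e n - q n.+1 /\ q n = p n.+1 + t%:Z * q n.+1.
  have [len|ltn] := leqP K n.
    have [-> ->] := pq0 _ len; have [-> ->] := pq0 _ (leqW len).
    by rewrite eK // mulr0.
  by rewrite /p /q -(subnSK ltn) /= subnSK // subKn // ltnW.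
have B0 : 0 <= B%:~R :> R by rewrite ler0z (le_trans _ (eB 0%N)).
have c0 := c_gt0; have c2 := c_lt2; have bg := b_gt2; have bc := mulbc.
have SU : tailU e (fun n => (p n)%:~R + (q n)%:~R * b).
  split=> [n|]; last first.
    by exists K => n /pq0[-> ->]; rewrite mul0r addr0.
  by have [-> ->] := pqS n; rewrite step_b.
have SE n : (p n)%:~R + (q n)%:~R * b = U n := tailU_uniq SU TU n.
have yB := tailV_bound TV (fun n => toR d n (dB n)).
(* The tails are bounded upwards from [U 0 = - y 0]: passing to [n.+1] divides by [b > 2]. *)
have bS n : `|(p n)%:~R + (q n)%:~R * b| <= B%:~R :> R.
  elim: n => [|n IH].
    by rewrite SE (_ : U 0%N = - y 0%N) ?normrN //; apply/eqP; rewrite -addr_eq0 sum0.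
  move: IH; rewrite !SE; case: TU => /(_ n) -> _.
  have := toR e n (eB n); rewrite !ler_norml => /andP[h1 h2] /andP[h3 h4].
  apply/andP; split; nra.
(* The conjugates are bounded downwards from 0 at [K]: each step multiplies by [c < 1 / 2] and adds
   at most [B]. *)
have bS' n : `|(p n)%:~R + (q n)%:~R * c| <= 2 * B%:~R :> R.
  have H k : `|(p (K - k)%N)%:~R + (q (K - k)%N)%:~R * c| <= 2 * B%:~R :> R.
    elim: k => [|k IH].
      by rewrite subn0; have [-> ->] := pq0 _ (leqnn K); rewrite mul0r addr0 normr0 mulr_ge0.
    have [lek|ltk] := leqP K k; first by rewrite (_ : (K - k.+1 = K - k)%N) //; lia.
    have [-> ->] := pqS (K - k.+1)%N; rewrite subnSK // step_c.
    move: IH; set z := _ + _; move: (z) => {}z.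
    have := toR e (K - k.+1)%N (eB _); move: (e _)%:~R => w.
    rewrite !ler_norml => /andP[h1 h2] /andP[h3 h4]; apply/andP; split; nra.
  have [len|ltn] := leqP n K; first by rewrite -(subKn len).
  by have [-> ->] := pq0 _ (ltnW ltn); rewrite mul0r addr0 normr0 mulr_ge0.
have TE n : (P n)%:~R + (Q n)%:~R * b = - y n.
  elim: n => [|n IH]; first by rewrite SE; apply/eqP; rewrite -addr_eq0 sum0.
  by rewrite /P /Q /= -/(P n) -/(Q n) step_b IH; case: TV => -> _; ring.
(* In the fractional half the conjugates contract in the forward direction, starting from the bound
   just found at 0. *)
have bT' n : `|(P n)%:~R + (Q n)%:~R * c| <= 2 * B%:~R :> R.
  elim: n => [|n]; first exact: bS'.
  rewrite /P /Q /= -/(P n) -/(Q n) step_c.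
  set z := _ + _; move: (z) => {}z.
  have := toR d n (dB n); move: (d n)%:~R => w.
  rewrite !ler_norml => /andP[h1 h2] /andP[h3 h4]; apply/andP; split; nra.
exists p, q, P, Q; split=> //; first by exists K.
move=> n; have [-> ->] := carry_bound (bS n) (bS' n).
by have [|-> ->] := carry_bound _ (bT' n); rewrite // TE normrN.
Qed.

(** Any carries satisfying the recurrences are the coordinates of the tails, up to sign in the
    fractional half, by uniqueness of the tails; agreement at position 0 makes the halves cancel. *)
Lemma carry_sum0 M (e d p q P Q : nat -> int) U y :
  tailU e U -> tailV d y -> carry M e d p q P Q -> U 0%N + y 0%N = 0.
Proof.
move=> TU TV [pqS PQS [P0 Q0] [K pqK] bd].
have SU : tailU e (fun n => (p n)%:~R + (q n)%:~R * b).
  split=> [n|]; last by exists K => n /pqK[-> ->]; rewrite mul0r addr0.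
  by have [-> ->] := pqS n; rewrite step_b.
have SV : tailV d (fun n => - ((P n)%:~R + (Q n)%:~R * b)).
  split=> [n|]; first by have [-> ->] := PQS n; rewrite step_b; ring.
  exists (M%:~R + M%:~R * b) => n; have [_ _ h1 h2] := bd n.
  rewrite normrN; apply: le_trans (ler_normD _ _) _.
  rewrite normrM (gtr0_norm b_gt0) -!intr_norm lerD ?ler_int //.
  by rewrite ler_wpM2r ?ler_int // ltW ?b_gt0.
by rewrite (tailU_uniq TU SU) (tailV_uniq TV SV) P0 Q0 subrr.
Qed.

Lemma pow_bc n : exists p q : int, b ^+ n = p%:~R + q%:~R * b /\ c ^+ n = p%:~R + q%:~R * c.
Proof.
elim: n => [|n [p [q [E1 E2]]]]; first by exists 1, 0; rewrite !expr0 !mul0r addr0.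
exists (0 - q), (p + t%:Z * q); rewrite step_b step_c -E1 -E2 !exprS.
by rewrite !add0r.
Qed.

(** The two sums arise from each other by exchanging [b] and [c], that is, by conjugation in
    [Z[b]]. *)
Lemma conj_sum K (u v : nat -> int) : exists p q : int,
  \sum_(n < K) (u n)%:~R * b ^+ n + \sum_(n < K) (v n)%:~R * c ^+ n.+1 = p%:~R + q%:~R * b :> R /\
  \sum_(n < K) (u n)%:~R * c ^+ n + \sum_(n < K) (v n)%:~R * b ^+ n.+1 = p%:~R + q%:~R * c :> R.
Proof.
elim: K => [|K [p [q [E1 E2]]]].
  by exists 0, 0; rewrite !big_ord0 !mul0r addr0.
have [p1 [q1 [F1 F2]]] := pow_bc K; have [p2 [q2 [G1 G2]]] := pow_bc K.+1.
exists (p + u K * p1 + v K * (p2 + t%:Z * q2)), (q + u K * q1 - v K * q2).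
have cb : b = t%:R - c by rewrite cE; ring.
rewrite !big_ord_recr /=; split; rewrite addrACA.
  by rewrite E1 F1 G2 !(rmorphB, rmorphD, rmorphM) /= -pmulrn cE; ring.
by rewrite E2 F2 G1 !(rmorphB, rmorphD, rmorphM) /= -pmulrn [in LHS]cb; ring.
Qed.

(* The integers are the values whose fractional digits mirror the integral ones:
   [b ^ n + b ^- n] is an integer, and a mirrored value is its own conjugate. *)
Lemma int_digits (k : int) : exists K (e : nat -> int),
  [/\ forall n, `|e n| <= t%:Z - 1, forall n, (K <= n)%N -> e n = 0,
   k%:~R = \sum_(n < K) (e n)%:~R * b ^+ n + \sum_(n < K) (e n.+1)%:~R * c ^+ n.+1 :> R
 & k%:~R = b * (\sum_(n < K) (e n.+1)%:~R * b ^+ n + \sum_(n < K) (e n)%:~R * c ^+ n.+1) :> R].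
Proof.
(* The traces of the powers of [b]. An integer is expanded greedily in them, and
   [tau n.+1 <= t * tau n] bounds the digits by [t - 1]. *)
pose tau n : R := b ^+ n + c ^+ n.
have tau_int n : tau n \is a Num.int.
  have [p [q [E1 E2]]] := pow_bc n; apply/intrP; exists (p + p + q * t%:Z).
  rewrite /tau E1 E2 cE !(rmorphD, rmorphM) /= -pmulrn; ring.
have tau0 n : 0 < tau n by rewrite addr_gt0 ?exprn_gt0 ?b_gt0 ?c_gt0.
have tauS n : tau n.+1 <= t%:R * tau n.
  case: n => [|n].
    by rewrite /tau !expr1 !expr0 cE; have := t_ge3; lra.
  have -> : t%:R * tau n.+1 = tau n.+2 + tau n.
    rewrite /tau mulrDr ![_ ^+ n.+2]exprS ![_ ^+ n.+1]exprS.
    have := bE; have := cE2; rewrite !expr2.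
    move: (b ^+ n) (c ^+ n) => X Y h1 h2.
    have -> : b * (b * X) = (b * b) * X by ring.
    have -> : c * (c * Y) = (c * c) * Y by ring.
    by rewrite h1 h2; ring.
  by rewrite lerDl ltW.
(* The digit [e 0] has weight 1, not [tau 0 = 2], since it is the centre of the mirror. The base
   case works because [tau 1 = t]: an integer below [t] is itself a digit. *)
have main J : forall x : R, x \is a Num.int -> 0 <= x < tau J.+1 -> exists e : nat -> int,
    [/\ forall n, 0 <= e n <= t%:Z - 1, forall n, (J < n)%N -> e n = 0
      & x = (e 0%N)%:~R + \sum_(n < J) (e n.+1)%:~R * tau n.+1].
  elim: J => [|J IH] x xI /andP[x0 xlt].
    have [k0 E] := intrP xI; exists (fun n => if n is 0%N then k0 else 0).
    rewrite big_ord0 addr0 E; split=> // [[|n]|[|n]] //.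
      move: x0 xlt; rewrite E ler0z /tau !expr1 cE addrC subrK pmulrn ltr_int => -> /=.
      by rewrite -ltzD1 subrK.
    by have := t3; lia.
  pose dd := Num.floor (x / tau J.+1).
  have d0 : 0 <= dd by rewrite floor_ge0 divr_ge0 // ltW.
  have d1 : dd <= t%:Z - 1.
    rewrite -ltzD1 subrK -(ltr_int R); apply: le_lt_trans (ge_floor _) _ => //.
    by rewrite -pmulrn ltr_pdivrMr //; apply: lt_le_trans xlt _.
  have h1 : dd%:~R * tau J.+1 <= x by rewrite -ler_pdivlMr // ge_floor.
  have h2 : x < (dd%:~R + 1) * tau J.+1.
    by rewrite -ltr_pdivrMr //; have := lt_succ_floor (x / tau J.+1); rewrite intrD.
  have [||e [e1 e2 e3]] := IH (x - dd%:~R * tau J.+1).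
  - by rewrite rpredB ?rpredM ?tau_int ?intr_int.
  - by rewrite subr_ge0 h1 /= ltrBlDl; move: h2; rewrite mulrDl mul1r.
  exists (fun n => if n == J.+1 then dd else e n); split.
  - by move=> n; case: eqP => // _; rewrite d0.
  - by move=> n ltn; rewrite gtn_eqF // e2 // ltnW.
  - rewrite big_ord_recr /= eqxx addrA; apply/eqP; rewrite -subr_eq e3; apply/eqP.
    congr (_ + _); apply: eq_bigr => n _.
    by rewrite eqSS ltn_eqF.
have nonneg (x : R) : x \is a Num.int -> 0 <= x -> exists K (e : nat -> int),
    [/\ forall n, 0 <= e n <= t%:Z - 1, forall n, (K < n)%N -> e n = 0
      & x = (e 0%N)%:~R + \sum_(n < K) (e n.+1)%:~R * tau n.+1].
  move=> xI x0; exists (Num.bound x); apply: main => //; rewrite x0 /=.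
  apply: lt_le_trans (archi_boundP x0) _.
  apply: le_trans (_ : b ^+ (Num.bound x).+1 <= _).
    elim: (Num.bound x) => [|n IH]; first by rewrite expr1 ltW ?b_gt0.
    rewrite exprS -natr1.
    have : 1 <= b ^+ n.+1 by rewrite exprn_ege1 // ltW.
    by have := b_gt2; move: (b ^+ n.+1) (n%:R) IH => B K; nra.
  by rewrite lerDl exprn_ge0 // ltW ?c_gt0.
have [K [e [e1 e2 e3]]] : exists K (e : nat -> int),
    [/\ forall n, `|e n| <= t%:Z - 1, forall n, (K < n)%N -> e n = 0
      & k%:~R = (e 0%N)%:~R + \sum_(n < K) (e n.+1)%:~R * tau n.+1 :> R].
  have [k0|k0] := leP 0 k.
    have [||K [e [e1 e2 e3]]] := nonneg k%:~R; rewrite ?ler0z ?intr_int //.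
    exists K, e; split=> // n; have /andP[h1 h2] := e1 n; by rewrite ger0_norm.
  have [||K [e [e1 e2 e3]]] := nonneg (- k%:~R).
    by rewrite rpredN intr_int.
    by rewrite oppr_ge0 lerz0 ltW.
  exists K, (fun n => - e n); split.
  - by move=> n; have /andP[h1 h2] := e1 n; rewrite normrN ger0_norm.
  - by move=> n /e2 ->; rewrite oppr0.
  - rewrite rmorphN /= -[LHS]opprK e3 opprD -sumrN; congr (_ + _).
    by apply: eq_bigr => n _; rewrite rmorphN mulNr.
have shiftS (z : R) : \sum_(n < K.+1) (e n)%:~R * z ^+ n =
    (e 0%N)%:~R + \sum_(n < K) (e n.+1)%:~R * z ^+ n.+1.
  by rewrite big_ord_recl expr0 mulr1.
have dropS (z : R) : \sum_(n < K.+1) (e n.+1)%:~R * z ^+ n.+1 =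
    \sum_(n < K) (e n.+1)%:~R * z ^+ n.+1.
  by rewrite big_ord_recr /= e2 // mul0r addr0.
have tauE : \sum_(n < K) (e n.+1)%:~R * tau n.+1 =
    \sum_(n < K) (e n.+1)%:~R * b ^+ n.+1 + \sum_(n < K) (e n.+1)%:~R * c ^+ n.+1.
  by rewrite -big_split /=; apply: eq_bigr => n _; rewrite mulrDr.
exists K.+1, e; split=> //.
- by rewrite shiftS dropS -addrA -tauE.
- rewrite mulrDr !mulr_sumr.
  under eq_bigr do rewrite mulrCA -exprS.
  under [X in _ + X]eq_bigr do rewrite exprS mulrCA (mulrA b) mulbc mul1r.
  by rewrite dropS shiftS addrCA -tauE.
Qed.

(** * Regularity of the basic relations *)

Variables (p0 q0 r0 : int) (M : nat).
(** [M] bounds the carries given by [carryP] for digits up to [t - 1]. The coefficients [p0], [q0],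
    [r0] come from [r0 * a = p0 + q0 * b], and the summand 3 covers those of addition. *)
Hypothesis MP : 4 * ((`|p0| + `|q0| + `|r0| + 3) * (t%:Z - 1)) <= M%:Z.

(* A letter codes two signed digits bounded by [M], one for each half of the
   expansion of a real number. *)
Definition W := M.*2.+1.
Definition D := (W * W)%N.
Definition dgu (x : nat) : int := (x %% W)%N%:Z - M%:Z.
Definition dgv (x : nat) : int := (x %/ W)%N%:Z - M%:Z.
Definition enc (x y : int) : nat := (absz (x + M%:Z)%R + absz (y + M%:Z)%R * W)%N.

Lemma D_gt0 : (0 < D)%N. Proof. by []. Qed.

Lemma enc_dg x y : `|x| <= M%:Z -> `|y| <= M%:Z ->
  [/\ (enc x y < D)%N, dgu (enc x y) = x & dgv (enc x y) = y].
Proof.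
move=> hx hy; have ltx : (absz (x + M%:Z)%R < W)%N by rewrite /W; lia.
have lty : (absz (y + M%:Z)%R < W)%N by rewrite /W; lia.
rewrite /enc /dgu /dgv; split.
- by rewrite addnC idx_lt.
- by rewrite addnC idx_mod //; lia.
- by rewrite addnC idx_div //; lia.
Qed.

Lemma dg_bound x : (x < D)%N -> `|dgu x| <= M%:Z /\ `|dgv x| <= M%:Z.
Proof.
move=> ltx; have h1 : (x %% W < W)%N by rewrite ltn_mod.
have h2 : (x %/ W < W)%N by rewrite ltn_divLR.
by rewrite /dgu /dgv; move: (x %% W)%N (x %/ W)%N h1 h2 => p q; rewrite /W; lia.
Qed.

(** Numbers are written with digits up to [t - 1]; the larger ones, up to [M], are there for
    carries. *)
Definition small x := (`|dgu x| <= t%:Z - 1) && (`|dgv x| <= t%:Z - 1).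

Definition Val (s : nat -> nat) (x : R) := (forall n, small (s n)) /\
  exists U y, [/\ tailU (dgu \o s) U, tailV (dgv \o s) y & x = U 0%N + y 0%N].

Definition Valid (s : nat -> nat) :=
  (forall n, small (s n)) /\ exists K, forall n, (K <= n)%N -> dgu (s n) = 0.

Lemma Val_uniq s x x' : Val s x -> Val s x' -> x = x'.
Proof.
move=> [_ [U [y [HU HV ->]]]] [_ [U' [y' [HU' HV' ->]]]].
by rewrite (tailU_uniq HU HU') (tailV_uniq HV HV').
Qed.

Lemma Val_valid s x : Val s x -> Valid s.
Proof.
move=> [sm [U [y [[HU [K UK]] _ _]]]]; split=> //; exists K => n len.
have := HU n; rewrite !UK ?(leqW len) // mulr0 addr0 => /esym/eqP.
by rewrite intr_eq0 => /eqP.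
Qed.

Lemma Valid_val s : Valid s -> exists x, Val s x.
Proof.
move=> [sm [K sK]].
have [U HU _] := tailU_sum sK.
have [|y Hy] := @tailV_ex (dgv \o s) (t%:Z - 1)%:~R.
  by move=> n; rewrite -intr_norm ler_int; case/andP: (sm n).
by exists (U 0%N + y 0%N); split=> //; exists U, y.
Qed.

Lemma tM : t%:Z - 1 <= M%:Z.
Proof.
have h := MP; have t0 : 0 <= t%:Z - 1 by lia.
by move: (t%:Z - 1) t0 h => T t0; nia.
Qed.

Lemma mk_stream (u v : nat -> int) (C : int) : C <= M%:Z ->
  (forall n, `|u n| <= C) -> (forall n, `|v n| <= C) -> exists s : nat -> nat,
  [/\ forall n, (s n < D)%N, dgu \o s = u & dgv \o s = v].
Proof.
move=> CM uC vC; have H n := enc_dg (le_trans (uC n) CM) (le_trans (vC n) CM).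
exists (fun n => enc (u n) (v n)); split=> [n||]; try (apply: funext => n /=); by have [] := H n.
Qed.

Lemma mk_val (u v : nat -> int) : (forall n, `|u n| <= t%:Z - 1) ->
  (forall n, `|v n| <= t%:Z - 1) -> exists s : nat -> nat,
  [/\ forall n, (s n < D)%N, forall n, small (s n), dgu \o s = u & dgv \o s = v].
Proof.
move=> uC vC; have [s [sD su sv]] := mk_stream tM uC vC; exists s; split=> // n.
by rewrite /small -[dgu _]/((dgu \o s) n) -[dgv _]/((dgv \o s) n) su sv uC vC.
Qed.

Lemma ge0_val x : 0 <= x -> exists s : nat -> nat, [/\ forall n, (s n < D)%N, Val s x
  & forall n, 0 <= dgu (s n) /\ 0 <= dgv (s n)].
Proof.
move=> x0; have [u [v [u1 v1 _ [U [y [HU Hy E]]]]]] := ge0_digits x0.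
have [||s [sD sm su sv]] := @mk_val u v; try by [move=> n;
  have := u1 n; have := v1 n; lia].
exists s; split=> // [|n]; first by split=> //; exists U, y; rewrite su sv.
rewrite -[dgu _]/((dgu \o s) n) -[dgv _]/((dgv \o s) n) su sv.
by have := u1 n; have := v1 n => /andP[-> _] /andP[-> _].
Qed.

Lemma ex_val x : exists s : nat -> nat, (forall n, (s n < D)%N) /\ Val s x.
Proof.
have [x0|x0] := leP 0 x; first by have [s [sD Vs _]] := ge0_val x0; exists s.
have [|u [v [u1 v1 _ [U [y [HU Hy E]]]]]] := @ge0_digits (- x).
  by rewrite oppr_ge0 ltW.
have [||s [sD sm su sv]] := @mk_val (fun n => 0 * u n + (-1) * u n) (fun n => 0 * v n + (-1) * v n);
  try by [move=> n; have := u1 n; have := v1 n; lia].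
exists s; split=> //; split=> //.
exists (fun n => 0%:~R * U n + (-1)%:~R * U n), (fun n => 0%:~R * y n + (-1)%:~R * y n).
rewrite su sv; split; [exact: tailU_lin | exact: tailV_lin |].
by rewrite -[x]opprK E !mulrN1z; ring.
Qed.

Notation regular := (regular D 8).
Let RGex x P h := @regular_ex D 8 D_gt0 P x h.

Definition V3 (P : R -> R -> R -> Prop) s0 s1 s2 :=
  exists x y z, [/\ Val s0 x, Val s1 y, Val s2 z & P x y z].
Definition regular_rel P := regular (fun E => V3 P (E 0%N) (E 1%N) (E 2%N)).

Lemma regular_valid : regular (fun E => Valid (E 0%N)).
Proof.
apply: regular_ext (@regular_loc D 8 (fun=> true) (fun l => dgu (l 0%N) == 0) (fun l _ => small (l 0%N))) => //.
move=> E _; split=> [[_ sm [K sK]]|[sm [K sK]]].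
  by split=> //; exists K => n /sK/eqP.
by split=> //; exists K => n /sK ->.
Qed.

(** The combination is formed digit by digit without normalizing, and the recognizer guesses carries
    showing that the result is a null expansion. *)
Lemma regular_rel_lin (k1 k2 k3 : int) : `|k1| + `|k2| + `|k3| <= `|p0| + `|q0| + `|r0| + 3 ->
  regular_rel (fun x y z => k1%:~R * x + k2%:~R * y + k3%:~R * z = 0).
Proof.
move=> hk.
pose cc l := 1 * (k1 * dgu (l 0%N) + k2 * dgu (l 1%N)) + k3 * dgu (l 2%N).
pose dd l := 1 * (k1 * dgv (l 0%N) + k2 * dgv (l 1%N)) + k3 * dgv (l 2%N).
(* Track 3 holds the carries [p] and [P] in its two halves, track 4 holds [q] and [Q]; [I] joins the
   two halves at position 0. *)
pose I (l : nat -> nat) := (dgv (l 3%N) == dgu (l 3%N)) && (dgv (l 4%N) == dgu (l 4%N)).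
pose F (l : nat -> nat) := [&& dgu (l 0%N) == 0, dgu (l 1%N) == 0, dgu (l 2%N) == 0,
  dgu (l 3%N) == 0 & dgu (l 4%N) == 0].
pose S (l l' : nat -> nat) := [&& [&& small (l 0%N), small (l 1%N) & small (l 2%N)],
  dgu (l 3%N) == cc l - dgu (l' 4%N), dgu (l 4%N) == dgu (l' 3%N) + t%:Z * dgu (l' 4%N),
  dgv (l' 3%N) == dd l - dgv (l 4%N) & dgv (l' 4%N) == dgv (l 3%N) + t%:Z * dgv (l 4%N)].
apply: regular_ext (@RGex 3 _ isT (@RGex 4 _ isT (regular_loc D 8 I F S))) => // E ED.
rewrite /V3 /=; split.
- move=> [s3 D3 [s4 D4 [/andP[/eqP i1 /eqP i2] HS [K HF]]]]; rewrite /S /F /retrack /= in i1 i2 HS HF.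
  have sm n : [/\ small (E 0%N n), small (E 1%N n) & small (E 2%N n)].
    by have /andP[/and3P[]] := HS n.
  have [|x Vx] := @Valid_val (E 0%N).
    by split=> [n|]; [case: (sm n) | exists K => n /HF/and5P[/eqP]].
  have [|y Vy] := @Valid_val (E 1%N).
    by split=> [n|]; [case: (sm n) | exists K => n /HF/and5P[_ /eqP]].
  have [|z Vz] := @Valid_val (E 2%N).
    by split=> [n|]; [case: (sm n) | exists K => n /HF/and5P[_ _ /eqP]].
  exists x, y, z; split=> //.
  have [_ [U1 [y1 [HU1 Hy1 ->]]]] := Vx; have [_ [U2 [y2 [HU2 Hy2 ->]]]] := Vy.
  have [_ [U3 [y3 [HU3 Hy3 ->]]]] := Vz.
  have HU := tailU_lin 1 k3 (tailU_lin k1 k2 HU1 HU2) HU3.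
  have Hy := tailV_lin 1 k3 (tailV_lin k1 k2 Hy1 Hy2) Hy3.
  have CA : carry M%:Z (fun n => cc (fun z => E z n)) (fun n => dd (fun z => E z n))
      (dgu \o s3) (dgu \o s4) (dgv \o s3) (dgv \o s4).
    split=> [n|n|||n].
    + by have /and5P[_ /eqP h1 /eqP h2 _ _] := HS n; split; [exact: h1 | exact: h2].
    + by have /and5P[_ _ _ /eqP h1 /eqP h2] := HS n; split; [exact: h1 | exact: h2].
    + by rewrite /= i1 i2.
    + by exists K => n /HF/and5P[_ _ _ /eqP h1 /eqP h2]; split; [exact: h1 | exact: h2].
    + by have [h1 h2] := dg_bound (D3 n); have [h3 h4] := dg_bound (D4 n).
  have := carry_sum0 HU Hy CA; rewrite /= => <-; ring.
- move=> [x [y [z [Vx Vy Vz E0]]]].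
  have [_ [K1 F1]] := Val_valid Vx; have [_ [K2 F2]] := Val_valid Vy.
  have [_ [K3 F3]] := Val_valid Vz.
  have [s1 [U1 [y1 [HU1 Hy1 Ex]]]] := Vx; have [s2 [U2 [y2 [HU2 Hy2 Ey]]]] := Vy.
  have [s3 [U3 [y3 [HU3 Hy3 Ez]]]] := Vz.
  have HU := tailU_lin 1 k3 (tailU_lin k1 k2 HU1 HU2) HU3.
  have Hy := tailV_lin 1 k3 (tailV_lin k1 k2 Hy1 Hy2) Hy3.
  pose B := (`|k1| + `|k2| + `|k3|) * (t%:Z - 1).
  have T0 : 0 <= t%:Z - 1 by lia.
  have BM : 4 * B <= M%:Z.
    by apply: le_trans MP; rewrite ler_wpM2l // ler_wpM2r.
  have bdd (u1 u2 u3 : int) : `|u1| <= t%:Z - 1 -> `|u2| <= t%:Z - 1 -> `|u3| <= t%:Z - 1 ->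
      `|1 * (k1 * u1 + k2 * u2) + k3 * u3| <= B.
    move=> h1 h2 h3; rewrite mul1r; apply: le_trans (ler_normD _ _) _.
    apply: le_trans (lerD (ler_normD _ _) (lexx _)) _.
    by rewrite !normrM /B !mulrDl !lerD // ler_wpM2l.
  have [|||p [q [P [Q CA]]]] := @carryP _ _ _ _ B HU Hy.
  + by move=> n; have /andP[h1 _] := s1 n; have /andP[h2 _] := s2 n; have /andP[h3 _] := s3 n; exact: bdd.
  + by move=> n; have /andP[_ h1] := s1 n; have /andP[_ h2] := s2 n; have /andP[_ h3] := s3 n; exact: bdd.
  + by move: E0; rewrite Ex Ey Ez => <-; ring.
  have [pq PQ [i1 i2] [K pqK] bd] := CA.
  have [||st3 [D3 u3 v3]] := @mk_stream p P (4 * B) BM; try by [move=> n; case: (bd n)].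
  have [||st4 [D4 u4 v4]] := @mk_stream q Q (4 * B) BM; try by [move=> n; case: (bd n)].
  exists st3 => //; exists st4 => //; rewrite /retrack /=.
  have {}u3 n : dgu (st3 n) = p n by rewrite -u3. have {}v3 n : dgv (st3 n) = P n by rewrite -v3.
  have {}u4 n : dgu (st4 n) = q n by rewrite -u4. have {}v4 n : dgv (st4 n) = Q n by rewrite -v4.
  split.
  + by rewrite /I u3 u4 v3 v4 i1 i2 !eqxx.
  + move=> n; rewrite /S s1 s2 s3 !u3 !v3 !u4 !v4 /=.
    have [h1 h2] := pq n; have [h3 h4] := PQ n.
    by rewrite {1}h1 {1}h2 {1}h3 {1}h4 /cc /dd /= !eqxx.
  + exists (maxn (maxn K1 K2) (maxn K3 K)) => n; rewrite !geq_max => /andP[/andP[l1 l2] /andP[l3 l4]].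
    have [P0 Q0] := pqK _ l4.
    by rewrite /F F1 // F2 // F3 // u3 u4 P0 Q0 eqxx.
Qed.

Lemma regular_V3 P i j k : regular_rel P -> regular (fun E => V3 P (E i) (E j) (E k)).
Proof. by move=> rP; exact: (@regular_ren3 D 8 D_gt0 isT (V3 P) i j k). Qed.

Lemma regular_rel_eq : regular_rel (fun x y z => x = y).
Proof.
have H : regular_rel _ := @regular_rel_lin 1 (-1) 0 ltac:(lia); apply: (regular_ext D_gt0 _ H).
move=> E _; split=> -[x [y [z [Vx Vy Vz E0]]]]; exists x, y, z; split=> //.
  by apply/eqP; rewrite -subr_eq0 -E0; apply/eqP; ring.
by rewrite E0; ring.
Qed.

Lemma regular_rel_add : regular_rel (fun x y z => z = x + y).
Proof.
have H : regular_rel _ := @regular_rel_lin 1 1 (-1) ltac:(lia); apply: (regular_ext D_gt0 _ H).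
move=> E _; split=> -[x [y [z [Vx Vy Vz E0]]]]; exists x, y, z; split=> //.
  by apply/eqP; rewrite eq_sym -subr_eq0 -E0; apply/eqP; ring.
by rewrite E0; ring.
Qed.

(** Multiplication by [b] shifts the digits, the first fractional digit becoming the integral digit
    0. As expansions are not unique, [y] is compared by value with the shifted stream on track 3. *)
Lemma regular_rel_mulb : regular_rel (fun x y z => y = b * x).
Proof.
pose I (l : nat -> nat) := dgu (l 3%N) == dgv (l 0%N).
pose F (l : nat -> nat) := (dgu (l 0%N) == 0) && (dgu (l 3%N) == 0).
pose S (l l' : nat -> nat) := [&& small (l 0%N), small (l 3%N),
  dgu (l' 3%N) == dgu (l 0%N) & dgv (l 3%N) == dgv (l' 0%N)].
have H := @RGex 3 _ isT (regular_and (regular_loc D 8 I F S) (regular_V3 3 1 2 regular_rel_eq)).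
apply: (regular_ext D_gt0 _ H) => E ED; rewrite /V3 /retrack /=.
have shiftE s s' x : Val s x -> dgu (s' 0%N) = dgv (s 0%N) -> (forall n, small (s' n)) ->
    (forall n, dgu (s' n.+1) = dgu (s n)) -> (forall n, dgv (s' n) = dgv (s n.+1)) -> Val s' (b * x).
  move=> [_ [U [y [[HU [K UK]] [HV [C yC]] ->]]]] e0 sm e1 e2; split=> //.
  exists (fun n => if n is n'.+1 then U n' else (dgv (s 0%N))%:~R + b * U 0%N), (fun n => y n.+1).
  split; last by rewrite HV /=; ring.
    split=> [[|n] /=|]; first by rewrite e0.
      by rewrite e1; exact: HU.
    by exists K.+1 => -[|n] //; exact: UK.
  by split=> [n|]; [rewrite HV /= e2 | exists C].
split.
- move=> [s sD [[/eqP i0 HS [K HF]] [x [y [z [Vs Vy Vz E0]]]]]].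
  have [|x' Vx] := @Valid_val (E 0%N).
    by split=> [n|]; [case/and4P: (HS n) | exists K => n /HF/andP[/eqP]].
  have Vs' : Val s (b * x').
    by apply: (shiftE _ _ _ Vx) => // n; have /and4P[? ? /eqP ? /eqP ?] := HS n.
  by exists x', y, z; split=> //; rewrite -(Val_uniq Vs Vs').
- move=> [x [y [z [Vx Vy Vz E0]]]]; have [sm [K sK]] := Val_valid Vx.
  have [||s [sD sm' su sv]] := @mk_val
    (fun n => if n is n'.+1 then dgu (E 0%N n') else dgv (E 0%N 0%N)) (fun n => dgv (E 0%N n.+1)).
  + by move=> [|n]; [case/andP: (sm 0%N) | case/andP: (sm n)].
  + by move=> n; case/andP: (sm n.+1).
  have su' n : dgu (s n) = if n is n'.+1 then dgu (E 0%N n') else dgv (E 0%N 0%N).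
    by rewrite -[LHS]/((dgu \o s) n) su.
  have sv' n : dgv (s n) = dgv (E 0%N n.+1) by rewrite -[LHS]/((dgv \o s) n) sv.
  exists s => //; split; last first.
    exists (b * x), y, z; split=> //.
    by apply: (shiftE _ _ _ Vx) => // n; rewrite ?su' ?sv'.
  split; first by rewrite /I su'.
    by move=> n; rewrite /S sm sm' su' sv' !eqxx.
  exists K.+1 => -[|n] // len; rewrite /F su' !sK ?eqxx //; exact: leqW.
Qed.

(** With [b * x] on an auxiliary track, [y = a * x] is a linear relation with coefficients [p0],
    [q0], [- r0]. *)
Lemma regular_rel_lam (a : R) : r0 != 0 -> r0%:~R * a = p0%:~R + q0%:~R * b ->
  regular_rel (fun x y z => y = a * x).
Proof.
move=> rn0 aE; have [|H] := pselect (regular_rel (fun x s y => p0%:~R * x + q0%:~R * s + (- r0)%:~R * y = 0)); last first.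
  by case: H; apply: regular_rel_lin; rewrite normrN; lia.
move=> Hlin; have H := @RGex 3 _ isT (regular_and (regular_V3 0 3 2 regular_rel_mulb) (regular_V3 0 3 1 Hlin)).
have rr : r0%:~R != 0 :> R by rewrite intr_eq0.
apply: (regular_ext D_gt0 _ H) => E ED; rewrite /V3 /retrack /=; split.
- move=> [s sD [[x [y [z [Vx Vs Vz E0]]]] [x' [y' [z' [Vx' Vs' Vy E1]]]]]].
  exists x, z', z; split=> //; move: E1; rewrite (Val_uniq Vx' Vx) (Val_uniq Vs' Vs) E0 => E1.
  apply: (mulfI rr); rewrite mulrA aE; apply/eqP; rewrite eq_sym -subr_eq0 -E1 rmorphN; apply/eqP; ring.
- move=> [x [y [z [Vx Vy Vz E0]]]]; have [s [sD Vs]] := ex_val (b * x).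
  exists s => //; split; first by exists x, (b * x), z.
  exists x, (b * x), y; split=> //.
  by rewrite E0 rmorphN /= mulNr !mulrA aE; ring.
Qed.

Lemma regular_rel_true : regular_rel (fun x y z => True).
Proof.
have V i := @regular_ren3 D 8 D_gt0 isT (fun s _ _ => Valid s) i 0 0 regular_valid.
apply: (regular_ext D_gt0 _ (regular_and (V 0%N) (regular_and (V 1%N) (V 2%N)))) => E _; split.
  by move=> [/Valid_val[x Vx] [/Valid_val[y Vy] /Valid_val[z Vz]]]; exists x, y, z.
by move=> [x [y [z [/Val_valid ? /Val_valid ? /Val_valid ? _]]]].
Qed.

(** The sign cannot be read off an arbitrary signed expansion, but a non-negative number has one
    with non-negative digits; track 3 guesses it. *)
Lemma regular_rel_ge0 : regular_rel (fun x y z => 0 <= x).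
Proof.
pose S (l l' : nat -> nat) := (0 <= dgu (l 3%N)) && (0 <= dgv (l 3%N)).
have H := @RGex 3 _ isT (regular_and (regular_loc D 8 xpredT xpredT S)
  (regular_and (regular_V3 3 0 1 regular_rel_eq) (regular_V3 0 1 2 regular_rel_true))).
apply: (regular_ext D_gt0 _ H) => E _; rewrite /retrack /=; split.
- move=> [s sD [[_ HS _] [[w [x [y [Vw Vx Vy E0]]]] [_ [_ [z [_ _ Vz _]]]]]]].
  exists x, y, z; split=> //; rewrite -E0.
  have [_ [U [y' [HU Hy ->]]]] := Vw; rewrite addr_ge0 //.
    by apply: (tailU_ge0 HU) => n; case/andP: (HS n).
  by apply: (tailV_ge0 Hy) => n; case/andP: (HS n).
- move=> [x [y [z [Vx Vy Vz x0]]]]; have [s [sD Vs s0]] := ge0_val x0.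
  exists s => //; split; first split=> //.
    by move=> n; apply/andP; case: (s0 n).
    by exists 0%N.
  by split; [exists x, x, y | exists x, y, z].
Qed.

Lemma regular_rel_lt : regular_rel (fun x y z => x < y).
Proof.
have H := @RGex 3 _ isT (regular_and (regular_V3 3 1 2 regular_rel_ge0)
  (regular_and (regular_V3 0 3 1 regular_rel_add) (regular_not (regular_V3 0 1 1 regular_rel_eq)))).
apply: (regular_ext D_gt0 _ H) => E _; rewrite /retrack /=; split.
- move=> [s sD [[d [_ [z [Vd _ Vz d0]]]] [[x [d' [y [Vx Vd' Vy E0]]]] ne]]].
  exists x, y, z; split=> //; rewrite lt_neqAle E0 -(Val_uniq Vd Vd') lerDl d0 andbT.
  apply/eqP => E1; apply: ne; exists x, y, y; split=> //.
  by rewrite E0 -(Val_uniq Vd Vd').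
- move=> [x [y [z [Vx Vy Vz ltxy]]]]; have [s [sD Vs]] := ex_val (y - x).
  exists s => //; split; last split.
  + by exists (y - x), y, z; split=> //; rewrite subr_ge0 ltW.
  + by exists x, (y - x), y; split=> //; rewrite addrC subrK.
  + move=> [x' [y' [_ [Vx' Vy' _ E0]]]].
    by move: ltxy; rewrite (Val_uniq Vx Vx') E0 (Val_uniq Vy Vy') ltxx.
Qed.

(** For a finite expansion, [b] times the value with exchanged halves is the conjugate of the
    original value. The recognizer thus asks for a finite expansion of [x] and equality with the
    conjugate, which forces [q = 0] in [x = p + q * b]. *)
Lemma regular_rel_int : regular_rel (fun x y z => x \is a Num.int).
Proof.
pose F (l : nat -> nat) := (dgu (l 3%N) == 0) && (dgv (l 3%N) == 0).
pose S (l l' : nat -> nat) := [&& small (l 3%N), small (l 4%N),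
  dgu (l 4%N) == dgv (l 3%N) & dgv (l 4%N) == dgu (l 3%N)].
have H := @RGex 3 _ isT (@RGex 4 _ isT (regular_and (regular_loc D 8 xpredT F S)
  (regular_and (regular_V3 3 0 1 regular_rel_eq) (regular_V3 4 0 2 regular_rel_mulb)))).
apply: (regular_ext D_gt0 _ H) => E _; rewrite /F /S /retrack /=; split.
- move=> [s3 D3 [s4 D4 [[_ HS [K HF]] [[w [x [y [V3 Vx Vy E0]]]] [w' [x' [z [V4 Vx' Vz E1]]]]]]]].
  exists x, y, z; split=> //.
  have K0 n : (K <= n)%N -> dgu (s3 n) = 0 /\ dgv (s3 n) = 0 by move=> /HF/andP[/eqP ? /eqP ?].
  have [U3 HU3 EU3] := tailU_sum (fun n len => (K0 n len).1 : (dgu \o s3) n = 0).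
  have [U4 HU4 EU4] := tailU_sum (fun n len => (K0 n len).2 : (dgv \o s3) n = 0).
  have [y3 Hy3 Ey3] := tailV_sum (fun n len => (K0 n len).2 : (dgv \o s3) n = 0).
  have [y4 Hy4 Ey4] := tailV_sum (fun n len => (K0 n len).1 : (dgu \o s3) n = 0).
  have V3' : Val s3 (U3 0%N + y3 0%N).
    by split=> [n|]; [case/and4P: (HS n) | exists U3, y3].
  have V4' : Val s4 (U4 0%N + y4 0%N).
    split=> [n|]; first by case/and4P: (HS n).
    exists U4, y4; split=> //.
      by rewrite (_ : dgu \o s4 = dgv \o s3) //; apply: funext => n; have /and4P[_ _ /eqP ? _] := HS n.
    by rewrite (_ : dgv \o s4 = dgu \o s3) //; apply: funext => n; have /and4P[_ _ _ /eqP ?] := HS n.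
  have [p [q [P1 P2]]] := conj_sum K (dgu \o s3) (dgv \o s3).
  have X1 : x = p%:~R + q%:~R * b by rewrite -E0 (Val_uniq V3 V3') EU3 Ey3 P1.
  have X2 : x = p%:~R + q%:~R * b^-1.
    rewrite (Val_uniq Vx Vx') E1 (Val_uniq V4 V4') EU4 Ey4 -P2 addrC mulrDr !mulr_sumr.
    congr (_ + _); apply: eq_bigr => i _; rewrite !exprS mulrCA //.
    by rewrite (mulrA b) divff ?mul1r // gt_eqF // (lt_trans ltr01 b1).
  have q0' : q%:~R = 0 :> R.
    have h := subbc_gt1; have : q%:~R * (b - b^-1) = 0 by rewrite mulrBr; apply/eqP; rewrite subr_eq0;
      apply/eqP; apply: (addrI p%:~R); rewrite -X1.
    by move/eqP; rewrite mulf_eq0 => /orP[/eqP//|/eqP h0]; move: h; rewrite h0 ltr10.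
  by rewrite X1 q0' mul0r addr0 intr_int.
- move=> [x [y [z [Vx Vy Vz xI]]]]; have [k Ek] := intrP xI.
  have [K [e [e1 e2 e3 e4]]] := int_digits k.
  have [||s3 [D3 sm3 u3 v3]] := @mk_val e (fun n => e n.+1); try by move=> n; exact: e1.
  have [||s4 [D4 sm4 u4 v4]] := @mk_val (fun n => e n.+1) e; try by move=> n; exact: e1.
  have eS n : (K <= n)%N -> e n.+1 = 0 by move=> len; apply: e2; exact: leqW.
  have [U3 HU3 EU3] := tailU_sum e2.
  have [U4 HU4 EU4] := tailU_sum eS.
  have [y3 Hy3 Ey3] := tailV_sum eS.
  have [y4 Hy4 Ey4] := tailV_sum e2.
  have V3 : Val s3 x.
    split=> //; exists U3, y3; split; rewrite ?u3 ?v3 //.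
    by rewrite EU3 Ey3 Ek e3.
  exists s3 => //; exists s4 => //; split; [split=> //|split].
  + move=> n; rewrite sm3 sm4 -[dgu (s4 n)]/((dgu \o s4) n) -[dgv (s3 n)]/((dgv \o s3) n).
    rewrite -[dgv (s4 n)]/((dgv \o s4) n) -[dgu (s3 n)]/((dgu \o s3) n).
    by rewrite u3 u4 v3 v4 !eqxx.
  + exists K => n len; rewrite -[dgv (s3 n)]/((dgv \o s3) n) -[dgu (s3 n)]/((dgu \o s3) n).
    by rewrite u3 v3 e2 // eS // eqxx.
  + by exists x, x, y.
  + exists (U4 0%N + y4 0%N), x, z; split=> //.
      by split=> //; exists U4, y4; rewrite u4 v4.
    by rewrite EU4 Ey4 Ek e4.
Qed.

(** The decision procedure needs every stream to have a value; invalid ones get 0. *)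
Definition val_of s : R := if pselect (exists x, Val s x) is left h then projT1 (cid h) else 0.

Lemma val_ofP s x : Val s x -> val_of s = x.
Proof.
move=> Vx; rewrite /val_of; case: pselect => [h|[]]; last by exists x.
by apply: Val_uniq Vx; case: (cid h).
Qed.

Lemma val_of_junk s : ~ Valid s -> val_of s = 0.
Proof. by move=> nV; rewrite /val_of; case: pselect => // h; case: nV; case: (h) => x /Val_valid. Qed.

Lemma val_surj x : exists2 s, (forall n, (s n < D)%N) & val_of s = x.
Proof. by have [s [sD Vs]] := ex_val x; exists s => //; exact: val_ofP. Qed.

(** Each argument is replaced, on tracks 3 to 5, by a valid stream of the same value; an invalid
    stream is replaced by an expansion of 0. *)
Lemma regular_val P : regular_rel P -> regular (fun E => P (val_of (E 0%N)) (val_of (E 1%N)) (val_of (E 2%N))).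
Proof.
move=> rP.
have lin0 : regular_rel _ := @regular_rel_lin 1 0 0 ltac:(lia).
pose norm s s' := Valid s' /\ val_of s = val_of s'.
have rnorm : regular (fun E => norm (E 0%N) (E 1%N)).
  have V0 := regular_valid.
  apply: (regular_ext D_gt0 _ (regular_or D_gt0 (regular_V3 0 1 1 regular_rel_eq) (regular_and (regular_not V0) (regular_V3 1 1 1 lin0)))) => E _.
  split=> [[[x [y [_ [Vx Vy _ E0]]]]|[nV [x [x1 [x2 [Vx _ _ E0]]]]]]|[Vs E0]].
  - by split; [exact: Val_valid Vy | rewrite (val_ofP Vx) (val_ofP Vy)].
  - split; first exact: Val_valid Vx.
    by rewrite val_of_junk // (val_ofP Vx); move: E0; rewrite !mul0r !addr0 mul1r.
  - have [x Vx] := Valid_val Vs; case: (pselect (Valid (E 0%N))) => V.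
      by left; have [y Vy] := Valid_val V; exists y, x, x; split=> //;
        move: E0; rewrite (val_ofP Vx) (val_ofP Vy).
    right; split=> //; exists x, x, x; split=> //.
    by move: E0; rewrite val_of_junk // (val_ofP Vx) => <-; ring.
have rn i j := @regular_ren3 D 8 D_gt0 isT (fun s s' _ => norm s s') i j 0 rnorm.
have H := @RGex 3 _ isT (@RGex 4 _ isT (@RGex 5 _ isT
  (regular_and (regular_and (rn 0%N 3%N) (regular_and (rn 1%N 4%N) (rn 2%N 5%N))) (regular_V3 3 4 5 rP)))).
apply: (regular_ext D_gt0 _ H) => E _; rewrite /retrack /=; split.
- move=> [s3 _ [s4 _ [s5 _ [[[_ ->] [[_ ->] [_ ->]]] [x [y [z [Vx Vy Vz]]]]]]]].
  by rewrite (val_ofP Vx) (val_ofP Vy) (val_ofP Vz).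
- move=> PE.
  have [s3 [D3 V3']] := ex_val (val_of (E 0%N)); have [s4 [D4 V4]] := ex_val (val_of (E 1%N)).
  have [s5 [D5 V5]] := ex_val (val_of (E 2%N)).
  exists s3 => //; exists s4 => //; exists s5 => //; split; last first.
    by exists (val_of (E 0%N)), (val_of (E 1%N)), (val_of (E 2%N)).
  have nV s s' : Val s' (val_of s) -> norm s s'.
    by move=> V; split; [exact: Val_valid V | rewrite (val_ofP V)].
  by split; [exact: nV | split; exact: nV].
Qed.

End Numeration.

(** * Quadratic units *)

Lemma pigeonhole (f : nat -> nat) B : (forall i, f i < B)%N ->
  exists i j, [/\ (i < j)%N, (j <= B)%N & f i = f j].
Proof.
move=> fB; apply: contrapT => none.
have u : uniq [seq f i | i <- iota 0 B.+1].
  rewrite map_inj_in_uniq ?iota_uniq // => i j; rewrite !mem_iota /= !add0n !ltnS => hi hj E.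
  by case: (ltngtP i j) => // h; case: none; [exists i, j | exists j, i].
have sub : {subset [seq f i | i <- iota 0 B.+1] <= iota 0 B}.
  by move=> v /mapP[i _ ->]; rewrite mem_iota /= fB.
by have := uniq_leq_size u sub; rewrite size_map !size_iota ltnn.
Qed.

Section Dirichlet.
Variable R : realType.
Implicit Type s : R.

(** The index, among [n.+1] equal subintervals of the unit interval, of the one containing the
    fractional part of [s]. *)
Definition box (n : nat) s := `|Num.floor (n.+1%:R * (s - (Num.floor s)%:~R))|%N.

Lemma box_lt n s : (box n s < n.+1)%N.
Proof.
have h1 := ge_floor s; have h2 := lt_succ_floor s.
rewrite /box; set x := n.+1%:R * _; have x0 : 0 <= x by rewrite mulr_ge0 ?ler0n // subr_ge0.
have f0 : 0 <= Num.floor x by rewrite floor_ge0.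
suff : Num.floor x < n.+1%:Z by lia.
rewrite -(ltr_int R); apply: le_lt_trans (ge_floor _) _ => //.
rewrite -pmulrn /x -[ltRHS]mulr1 ltr_pM2l // ltrBlDl.
by move: h2; rewrite intrD.
Qed.

Lemma box_close n s s' : box n s = box n s' ->
  `|s - s' - (Num.floor s - Num.floor s')%:~R| < n.+1%:R^-1.
Proof.
have n0 : 0 < n.+1%:R :> R by rewrite ltr0n.
pose x u : R := n.+1%:R * (u - (Num.floor u)%:~R).
have x0 u : 0 <= Num.floor (x u).
  by rewrite floor_ge0 mulr_ge0 ?ler0n // subr_ge0 ge_floor.
rewrite /box -!/(x _) => E; have {}E : Num.floor (x s) = Num.floor (x s').
  by have := x0 s; have := x0 s'; lia.
have h1 := ge_floor (x s); have h2 := lt_succ_floor (x s).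
have h3 := ge_floor (x s'); have h4 := lt_succ_floor (x s').
rewrite -[ltRHS]mul1r ltr_pdivlMr // mulrC -{1}(gtr0_norm n0) -normrM.
rewrite (_ : n.+1%:R * _ = x s - x s'); last by rewrite /x rmorphB; ring.
by move: h1 h2 h3 h4; rewrite E !intrD ltr_norml => *; apply/andP; split; lra.
Qed.

Lemma dirichlet s (n : nat) : exists (y : nat) (x : int),
  [/\ (0 < y)%N, (y <= n.+1)%N & `|y%:R * s - x%:~R| < n.+1%:R^-1].
Proof.
have [i [j [ltij lej E]]] := @pigeonhole (fun i => box n (i%:R * s)) n.+1 (fun i => box_lt _ _).
exists (j - i)%N, (Num.floor (j%:R * s) - Num.floor (i%:R * s)).
split; [by rewrite subn_gt0 | by apply: leq_trans (leq_subr _ _) lej |].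
by rewrite natrB 1?ltnW // mulrBl; apply: box_close.
Qed.

Lemma dirichlet2 s1 s2 (n : nat) : exists (y : nat) (x1 x2 : int),
  [/\ (0 < y)%N, `|y%:R * s1 - x1%:~R| < n.+1%:R^-1 & `|y%:R * s2 - x2%:~R| < n.+1%:R^-1].
Proof.
pose f i := (box n (i%:R * s1) * n.+1 + box n (i%:R * s2))%N.
have fB i : (f i < n.+1 * n.+1)%N by apply: idx_lt; exact: box_lt.
have [i [j [ltij _ E]]] := pigeonhole fB.
have E1 : box n (j%:R * s1) = box n (i%:R * s1).
  by have := congr1 (fun x => x %/ n.+1)%N E; rewrite /f !idx_div ?box_lt.
have E2 : box n (j%:R * s2) = box n (i%:R * s2).
  by have := congr1 (fun x => x %% n.+1)%N E; rewrite /f !idx_mod ?box_lt.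
exists (j - i)%N, (Num.floor (j%:R * s1) - Num.floor (i%:R * s1)).
exists (Num.floor (j%:R * s2) - Num.floor (i%:R * s2)).
by rewrite subn_gt0 ltij natrB 1?ltnW // !mulrBl; split=> //; exact: box_close.
Qed.

Lemma nonsquare_neq (d : nat) : (forall x, x * x != d)%N ->
  forall (x : int) (y : nat), (0 < y)%N -> x * x != d%:Z * (y%:Z * y%:Z).
Proof.
move=> nsq x y y0; apply/eqP => E.
have {}E : (`|x| ^ 2 = d * y ^ 2)%N by apply/eqP; rewrite -eqz_nat; apply/eqP; lia.
have yx : (y %| `|x|)%N by rewrite -(@dvdn_pexp2r _ _ 2) // E dvdn_mull.
have := nsq (`|x| %/ y)%N; move: E; rewrite -{1}(divnK yx) expnMn => /eqP.
by rewrite eqn_pmul2r ?expn_gt0 ?y0 // expnS expn1 => ->.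
Qed.

Lemma absz_sq (x : int) : (`|x| * `|x|)%N%:Z = x * x.
Proof. by rewrite PoszM abszE -normrM ger0_norm // -expr2 sqr_ge0. Qed.

Lemma absz_eq (p q : int) : 0 <= p -> 0 <= q -> `|q|%N = `|p|%N -> q == p.
Proof. by move=> p0 q0 /(congr1 Posz); rewrite !gez0_abs // => ->. Qed.

(** The classical argument: Dirichlet's approximations [x / y] to [sqrt d] have bounded norms
    [x ^ 2 - d * y ^ 2]; two different ones with the same norm [k] and congruent modulo [k] have a
    quotient that is an integral unit of norm 1. *)
Lemma pell (d : nat) : (forall x, x * x != d)%N ->
  exists X Y : nat, (0 < Y)%N /\ (X * X = d * (Y * Y) + 1)%N.
Proof.
move=> nsq; pose s : R := Num.sqrt d%:R.
have s0 : 0 <= s by exact: sqrtr_ge0.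
have s2 : s * s = d%:R by rewrite -expr2 sqr_sqrtr.
have /boolp.choice [g gP] : forall n : nat, exists xy : int * nat,
    [/\ (0 < xy.2)%N, (xy.2 <= n.+1)%N & `|xy.2%:R * s - xy.1%:~R| < n.+1%:R^-1].
  by move=> n; have [y [x H]] := dirichlet s n; exists (x, y).
pose nm n : int := (g n).1 * (g n).1 - d%:Z * ((g n).2%:Z * (g n).2%:Z).
have nm0 n : nm n != 0 by rewrite subr_eq0 nonsquare_neq //; case: (gP n).
pose dist n := `|(g n).2%:R * s - (g n).1%:~R|.
have nmE n : (nm n)%:~R = - (((g n).2%:R * s - (g n).1%:~R) * ((g n).2%:R * s + (g n).1%:~R)) :> R.
  by rewrite /nm rmorphB !rmorphM /= -!pmulrn -s2; ring.
have dist0 n : 0 < dist n.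
  rewrite normr_gt0; apply/eqP => E; have := nmE n; rewrite E mul0r oppr0 => /eqP.
  by rewrite intr_eq0 (negPf (nm0 n)).
(* The absolute norm is at most [dist n * (2 * y * s + dist n)], where [dist n * y <= 1],
   [dist n < 1] and [s <= d]. *)
pose C : nat := (2 * d + 2)%N.
have nmC n : `|nm n| <= C%:Z.
  rewrite -(ler_int R) intr_norm nmE normrN normrM -/(dist n) -pmulrn.
  have [y0 yn dn] := gP n; rewrite -/(dist n) in dn.
  have h1 : `|(g n).2%:R * s + (g n).1%:~R| <= 2 * ((g n).2%:R * s) + dist n.
    rewrite (_ : _ + _ = 2 * ((g n).2%:R * s) - ((g n).2%:R * s - (g n).1%:~R)); last by ring.
    apply: le_trans (ler_normB _ _) _; rewrite -/(dist n) lerD2r ger0_norm //.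
    by rewrite !mulr_ge0.
  have h2 : (g n).2%:R <= n.+1%:R :> R by rewrite ler_nat.
  have h3 : dist n * n.+1%:R < 1 by rewrite -ltr_pdivlMr // mul1r.
  have h4 : s <= d%:R.
    rewrite -s2; case: (posnP d) s2 => [->|d0 s2]; first by move: s0 => ?; nra.
    have : 1 <= d%:R :> R by rewrite (ler_nat R 1).
    by move: s0; rewrite -s2; nra.
  have d0 := dist0 n; have h5 : dist n < 1.
    by apply: le_lt_trans h3; rewrite ler_peMr ?(ltW d0) // (ler_nat R 1).
  apply: le_trans (_ : dist n * (2 * ((g n).2%:R * s) + dist n) <= _); first by rewrite ler_wpM2l ?(ltW d0).
  have h6 : dist n * (g n).2%:R <= 1.
    by apply: le_trans (ltW h3); rewrite ler_wpM2l // ltW.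
  rewrite /C natrD natrM mulrDr.
  have h7 : dist n * (2 * ((g n).2%:R * s)) <= 2 * d%:R.
    rewrite (_ : _ * _ = 2 * ((dist n * (g n).2%:R) * s)); last by ring.
    rewrite ler_wpM2l //; apply: le_trans h4; rewrite -[leRHS]mul1r ler_wpM2r //.
  have h8 : dist n * dist n <= 1 by nra.
  by rewrite lerD // (le_trans h8) // (ler_nat R 1).
(* Codes the norm together with the residues of both coordinates modulo it. *)
pose f n : nat := (absz (nm n + C%:Z)%R * (C.+1 * C.+1) +
   (`|((g n).1 %% nm n)%Z|%N * C.+1 + `|((g n).2%:Z %% nm n)%Z|%N))%N.
have mC (x : int) n : (`|(x %% nm n)%Z| < C.+1)%N.
  have h1 := modz_ge0 x (nm0 n); have h2 := ltz_mod x (nm0 n); have := nmC n.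
  by move: (x %% nm n)%Z h1 h2 => z; lia.
have mC2 n : (`|((g n).1 %% nm n)%Z|%N * C.+1 + `|((g n).2%:Z %% nm n)%Z|%N < C.+1 * C.+1)%N.
  exact: idx_lt.
have f2 n : (f n < (2 * C).+1 * (C.+1 * C.+1))%N.
  rewrite /f; have h : (absz (nm n + C%:Z)%R < (2 * C).+1)%N by have := nmC n; lia.
  have le : ((absz (nm n + C%:Z)%R).+1 * (C.+1 * C.+1) <= (2 * C).+1 * (C.+1 * C.+1))%N.
    by rewrite leq_mul2r h orbT.
  apply: leq_trans le; rewrite (mulSn (absz _)) addnC ltn_add2r; exact: mC2.
have [v vP] := @infinite_pigeonhole (fun=> True) f _ (fun N => ex_intro2 _ _ N.+1 (ltnSn N) I) f2.
have [n1 _ [_ fn1]] := vP 0%N.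
(* [n2] is taken so large that its approximation is strictly better; this will exclude the trivial
   unit. *)
have [n2 ltn2 [_ fn2]] := vP (Num.bound (dist n1)^-1).
have {}fE : f n1 = f n2 by rewrite fn1.
have C1 n : (absz (nm n + C%:Z)%R)%:Z = nm n + C%:Z by have := nmC n; lia.
have E0 : nm n1 = nm n2.
  have := congr1 (fun x => x %/ (C.+1 * C.+1))%N fE; rewrite /f !idx_div ?mC2 //.
  by have := C1 n1; have := C1 n2; lia.
have Er : (`|((g n1).1 %% nm n1)%Z|%N * C.+1 + `|((g n1).2%:Z %% nm n1)%Z| =
          `|((g n2).1 %% nm n2)%Z|%N * C.+1 + `|((g n2).2%:Z %% nm n2)%Z|)%N.
  by have := congr1 (fun x => x %% (C.+1 * C.+1))%N fE; rewrite /f !idx_mod.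
have mE (x y : int) : `|(x %% nm n1)%Z|%N = `|(y %% nm n2)%Z|%N -> (nm n1 %| x - y)%Z.
  have := modz_ge0 x (nm0 n1); have := modz_ge0 y (nm0 n2).
  by rewrite -E0 -eqz_mod_dvd => h1 h2 h; exact: absz_eq.
have Ex : (nm n1 %| (g n1).1 - (g n2).1)%Z.
  by apply: mE; have := congr1 (fun x => x %/ C.+1)%N Er; rewrite !idx_div.
have Ey : (nm n1 %| (g n1).2%:Z - (g n2).2%:Z)%Z.
  by apply: mE; have := congr1 (fun x => x %% C.+1)%N Er; rewrite !idx_mod.
have neq : dist n2 < dist n1.
  have [_ _ h] := gP n2; rewrite -/(dist n2) in h; apply: lt_trans h _.
  rewrite -[dist n1]invrK ltf_pV2 ?posrE ?ltr0n ?invr_gt0 //.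
  have h0 : 0 <= (dist n1)^-1 by rewrite invr_ge0 ltW.
  by apply: lt_trans (archi_boundP h0) _; rewrite ltr_nat ltnW // ltnS.
have [y10 _ _] := gP n1; have [y20 _ _] := gP n2.
move: Ex Ey E0 neq y10 y20 (nm0 n1); rewrite /dist /nm.
case: (g n1) (g n2) => x1 y1 [x2 y2] /= + + E0 + y10 y20 k0.
set k := x1 * x1 - _ in E0 k0 * => /dvdzP[m Em] /dvdzP[n En] neq.
(* [X + Y * sqrt d] is [(x1 - y1 * sqrt d) * (x2 + y2 * sqrt d) / k], with the division carried out
   through the congruences. *)
pose X := x2 * m + 1 - d%:Z * (y2%:Z * n).
pose Y := m * y2%:Z - x2 * n.
have XE : k * X = x1 * x2 - d%:Z * (y1%:Z * y2%:Z).
  have -> : x1 = x2 + m * k by rewrite -Em; ring.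
  have -> : y1%:Z = y2%:Z + n * k by rewrite -En; ring.
  rewrite (_ : _ - _ = k * (x2 * m - d%:Z * (y2%:Z * n)) + (x2 * x2 - d%:Z * (y2%:Z * y2%:Z))).
    by rewrite -E0 /X; ring.
  by ring.
have YE : k * Y = x1 * y2%:Z - x2 * y1%:Z.
  have -> : x1 = x2 + m * k by rewrite -Em; ring.
  have -> : y1%:Z = y2%:Z + n * k by rewrite -En; ring.
  by rewrite /Y; ring.
have XY1 : X * X = d%:Z * (Y * Y) + 1.
  have kk : k * k != 0 by rewrite mulf_neq0.
  apply: (mulfI kk); rewrite (_ : k * k * (X * X) = (k * X) * (k * X)); last by ring.
  rewrite (_ : k * k * (d%:Z * (Y * Y) + 1) = d%:Z * ((k * Y) * (k * Y)) + k * k); last by ring.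
  rewrite XE YE (_ : k * k = k * (x2 * x2 - d%:Z * (y2%:Z * y2%:Z))); last by rewrite -E0.
  by rewrite /k; ring.
have Y0 : Y != 0.
  apply/eqP => Y0; move: YE; rewrite Y0 mulr0 => /esym/eqP; rewrite subr_eq0 => /eqP Exy.
  have Ey : y1%:Z * y1%:Z = y2%:Z * y2%:Z :> int.
    apply: (mulfI k0).
    have h1 : k * (y2%:Z * y2%:Z) = (x1 * y2%:Z) * (x1 * y2%:Z) - d%:Z * (y1%:Z * y1%:Z * (y2%:Z * y2%:Z)).
      by rewrite /k; ring.
    have h2 : k * (y1%:Z * y1%:Z) = (x2 * y1%:Z) * (x2 * y1%:Z) - d%:Z * (y1%:Z * y1%:Z * (y2%:Z * y2%:Z)).
      by rewrite E0; ring.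
    by rewrite h1 h2 Exy.
  have {}Ey : (y1 * y1 = y2 * y2)%N by apply/eqP; rewrite -eqz_nat !PoszM Ey.
  have y12 : y1 = y2.
    by case: (ltngtP y1 y2) => // h; have := ltn_mul h h; rewrite Ey ltnn.
  have y2n0 : y2%:Z != 0 by rewrite eqz_nat -lt0n.
  have x12 : x1 = x2 by apply: (mulIf y2n0); rewrite Exy y12.
  by move: neq; rewrite y12 x12 ltxx.
exists `|X|%N, `|Y|%N; split; first by rewrite absz_gt0.
by apply/eqP; rewrite -eqz_nat PoszD absz_sq (PoszM d) absz_sq XY1.
Qed.

Lemma quadratic_int (a : R) : quadratic a -> exists A B C : int,
  A != 0 /\ A%:~R * (a * a) + B%:~R * a + C%:~R = 0.
Proof.
move=> [u [v [w [u0 E]]]].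
have dR (x : rat) : (denq x)%:~R != 0 :> R by rewrite intr_eq0 denq_neq0.
have rE (x : rat) : ratr x = (numq x)%:~R / (denq x)%:~R :> R by [].
exists (numq u * denq v * denq w), (numq v * denq u * denq w), (numq w * denq u * denq v).
split; first by rewrite !mulf_neq0 ?numq_eq0 ?denq_neq0.
move: E; rewrite !rE => E; rewrite !rmorphM /=.
have {E} := congr1 (fun x => (denq u)%:~R * (denq v)%:~R * (denq w)%:~R * x) E.
rewrite mulr0 => <-; field; by rewrite !dR.
Qed.

(** [2 * A * a + B] is a square root of the discriminant [d], up to sign. If [d] is not a square,
    the Pell unit [b = X + Y * sqrt d] has norm 1 and trace [t = 2 * X], and multiplying by [Y]
    expresses the root through [b]. *)
Lemma quadratic_unit (a : R) : quadratic a -> exists (t : nat) (b : R) (p q r : int),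
  [/\ (3 <= t)%N, 1 < b, b ^+ 2 = t%:R * b - 1, r != 0 & r%:~R * a = p%:~R + q%:~R * b].
Proof.
move=> /quadratic_int[A [B [C [A0 E]]]].
have DE : (B * B - 4 * A * C)%:~R = (2 * A%:~R * a + B%:~R) ^+ 2 :> R.
  rewrite rmorphB !rmorphM /= (_ : C%:~R = - (A%:~R * (a * a) + B%:~R * a)); first by ring.
  by apply/eqP; rewrite -addr_eq0 addrC -E.
have D0 : 0 <= B * B - 4 * A * C by rewrite -(ler0z R) DE sqr_ge0.
have [d dE] : exists d : nat, B * B - 4 * A * C = d%:Z by exists (absz (B * B - 4 * A * C)%R); rewrite gez0_abs.
have [[x /eqP xx]|nsq] := pselect (exists x, x * x == d)%N.
  (* Here [a] is rational, so [q = 0] and any unit will do; this one has the least trace allowed. *)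
  exists 3%N, ((3 + Num.sqrt 5) / 2).
  have s0 : 0 <= Num.sqrt 5 :> R by exact: sqrtr_ge0.
  have s2 : Num.sqrt 5 ^+ 2 = 5 :> R by rewrite sqr_sqrtr.
  have bb : ((3 + Num.sqrt 5) / 2) ^+ 2 = 3 * ((3 + Num.sqrt 5) / 2) - 1 :> R.
    by rewrite exprMn sqrrD s2; field.
  have b1 : 1 < (3 + Num.sqrt 5) / 2 :> R by rewrite ltr_pdivlMr //; lra.
  have : (2 * A%:~R * a + B%:~R - x%:R) * (2 * A%:~R * a + B%:~R + x%:R) = 0.
    rewrite -subr_sqr -DE dE -xx -pmulrn natrM; ring.
  move=> /eqP; rewrite mulf_eq0 => /orP[|] /eqP h.
    exists (x%:Z - B), 0, (2 * A); split=> //; first by rewrite mulf_neq0.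
    by rewrite intrM intrB -pmulrn mul0r addr0; apply/eqP; rewrite -subr_eq0 -h; apply/eqP; ring.
  exists (- x%:Z - B), 0, (2 * A); split=> //; first by rewrite mulf_neq0.
  by rewrite intrM intrB intrN -pmulrn mul0r addr0; apply/eqP; rewrite -subr_eq0 -h; apply/eqP; ring.
have [|X [Y [Y0 XY]]] := @pell d; first by move=> x; apply/negP => h; apply: nsq; exists x.
pose s : R := Num.sqrt d%:R.
have s0 : 0 <= s by exact: sqrtr_ge0.
have s2 : s * s = d%:R by rewrite -expr2 sqr_sqrtr.
have d2 : (2 <= d)%N.
  by case: d {dE XY s s0 s2} nsq => [|[|d]] // []; [exists 0%N | exists 1%N].
have X2 : (2 <= X)%N by nia.
have XYR : X%:R * X%:R = d%:R * (Y%:R * Y%:R) + 1 :> R by rewrite -!natrM XY natrD.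
have bb : (X%:R + Y%:R * s) ^+ 2 = (X * 2)%N%:R * (X%:R + Y%:R * s) - 1.
  rewrite natrM expr2.
  rewrite (_ : _ * _ = X%:R * X%:R + 2 * (X%:R * (Y%:R * s)) + (s * s) * (Y%:R * Y%:R)); last by ring.
  rewrite (_ : _ - 1 = 2 * (X%:R * X%:R) + 2 * (X%:R * (Y%:R * s)) - 1); last by ring.
  by rewrite s2 XYR; ring.
have b1 : 1 < X%:R + Y%:R * s.
  by rewrite (@lt_le_trans _ _ X%:R) ?(ltr_nat R 1) // lerDl mulr_ge0.
have : (2 * A%:~R * a + B%:~R - s) * (2 * A%:~R * a + B%:~R + s) = 0.
  rewrite -subr_sqr -DE dE -pmulrn expr2 s2; ring.
have Y0' : Y%:Z != 0 by lia.
move=> /eqP; rewrite mulf_eq0 => /orP[|] /eqP h.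
  exists (X * 2)%N, (X%:R + Y%:R * s), (- X%:Z - Y%:Z * B), 1, (2 * A * Y%:Z).
  split=> //; [by lia | by rewrite !mulf_neq0 |].
  rewrite !(intrM, intrB, intrN) -!pmulrn mul1r; apply/eqP; rewrite -subr_eq0 -(mulr0 Y%:R) -h.
  by apply/eqP; ring.
exists (X * 2)%N, (X%:R + Y%:R * s), (X%:Z - Y%:Z * B), (-1), (2 * A * Y%:Z).
split=> //; [by lia | by rewrite !mulf_neq0 |].
rewrite !(intrM, intrB, intrN) -!pmulrn mulN1r; apply/eqP; rewrite -subr_eq0 -(mulr0 Y%:R) -h.
by apply/eqP; ring.
Qed.

End Dirichlet.

Lemma quadratic_decidable (R : realType) (a : R) :
  quadratic a -> decidable_theory (theory (S_ a)).
Proof.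
move=> /quadratic_unit[t [b [p [q [r [t3 b1 bE r0 aE]]]]]].
pose M := absz (4 * ((`|p| + `|q| + `|r| + 3) * (t%:Z - 1)))%R.
have MP : (4 * ((`|p| + `|q| + `|r| + 3) * (t%:Z - 1)) <= M%:Z)%R by rewrite /M lez_abs.
have base P : regular_rel b t M P -> exists K, realizes (D M) (val_of b t M) K P.
  by move=> /(regular_val t3 b1 bE MP)[K HK]; exists K.
have [Kadd H1] := base _ (regular_rel_add t3 b1 bE MP).
have [Klam H2] := base _ (regular_rel_lam t3 b1 bE MP r0 aE).
have [Klt H3] := base _ (regular_rel_lt t3 b1 bE MP).
have [Kint H4] := base _ (regular_rel_int t3 b1 bE MP).
have [Keq H5] := base _ (regular_rel_eq t3 b1 bE MP).
exact: (theory_decidable (D_gt0 M) (val_surj t3 b1 bE MP) H1 H2 H3 H4 H5).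
Qed.

(** * Coding finite relations *)

Section Nrm.
Variable R : realType.
Implicit Type x y : R.

(** The distance from [x] to the nearest integer. *)
Definition nrm x : R :=
  Num.min (x - (Num.floor x)%:~R) ((Num.floor x)%:~R + 1 - x).

Lemma nrm_le x (k : int) : nrm x <= `|x - k%:~R|.
Proof.
rewrite /nrm ge_min; have [lek|ltk] := leP k (Num.floor x); apply/orP; [left|right].
  have h : k%:~R <= (Num.floor x)%:~R :> R by rewrite ler_int.
  by apply: le_trans (ler_norm _); lra.
have h : (Num.floor x)%:~R + 1 <= k%:~R :> R by rewrite -(intrD _ _ 1) ler_int lezD1.
by rewrite -normrN; apply: le_trans (ler_norm _); lra.
Qed.

Lemma nrm_ex x : exists k : int, nrm x = `|x - k%:~R|.
Proof.
have h1 := ge_floor x; have h2 := lt_succ_floor x; rewrite intrD in h2.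
rewrite /nrm; case: (leP (x - (Num.floor x)%:~R) ((Num.floor x)%:~R + 1 - x)) => h.
  by exists (Num.floor x); rewrite ger0_norm // subr_ge0.
exists (Num.floor x + 1); rewrite intrD distrC ger0_norm; last by rewrite subr_ge0 ltW.
by [].
Qed.

Lemma nrm_half x : nrm x <= 1 / 2.
Proof.
by rewrite /nrm ge_min; case: (leP (x - (Num.floor x)%:~R) (1 / 2)) => //= h; lra.
Qed.

Lemma nrmD x y : nrm (x + y) <= nrm x + nrm y.
Proof.
have [k ->] := nrm_ex x; have [l ->] := nrm_ex y.
apply: le_trans (nrm_le _ (k + l)) _; apply: le_trans (ler_normD _ _).
by rewrite intrD opprD addrACA.
Qed.

Lemma nrmN x : nrm (- x) = nrm x.
Proof.
have H z : nrm (- z) <= nrm z.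
  by have [k ->] := nrm_ex z; apply: le_trans (nrm_le _ (- k)) _; rewrite intrN -opprD normrN.
by apply/eqP; rewrite eq_le H; have := H (- x); rewrite opprK.
Qed.

Lemma nrmB x y : nrm (x - y) <= nrm x + nrm y.
Proof. by rewrite -(nrmN y) nrmD. Qed.

Lemma nrm_int x (k : int) : nrm (x + k%:~R) = nrm x.
Proof.
have H z (l : int) : nrm (z + l%:~R) <= nrm z.
  have [m ->] := nrm_ex z; apply: le_trans (nrm_le _ (m + l)) _.
  by rewrite intrD opprD addrACA subrr addr0.
by apply/eqP; rewrite eq_le H; have := H (x + k%:~R) (- k); rewrite intrN addrK.
Qed.

End Nrm.

(** * Kronecker's theorem for the multiples of [(a, a ^ 2)] *)

Section Kronecker.
Variables (R : realType) (a : R).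
Hypothesis nq : forall u v w : int, u != 0 -> u%:~R * (a * a) + v%:~R * a + w%:~R != 0.

Lemma irrational_mul (r : nat) (k : int) : (0 < r)%N -> r%:R * a - k%:~R != 0.
Proof.
move=> r0; apply/eqP => E.
have := @nq (r%:Z * r%:Z) 0 (- (k * k)); rewrite mulf_neq0 ?eqz_nat -?lt0n // => /(_ isT)/negP; apply.
apply/eqP; transitivity ((r%:R * a - k%:~R) * (r%:R * a + k%:~R)); last by rewrite E mul0r.
by rewrite intrN !intrM -!pmulrn; ring.
Qed.

Lemma nrm_gt0 (r : nat) : (0 < r)%N -> 0 < nrm (r%:R * a).
Proof.
move=> r0; have [k ->] := nrm_ex (r%:R * a).
by rewrite normr_gt0 irrational_mul.
Qed.

(** A vanishing determinant would be an integral quadratic relation for [a]; by [nq] its leading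
    coefficient vanishes, so [(r1, k1)] and [(r2, k2)] are proportional. *)
Lemma small_pair (e : R) : 0 < e -> exists (r1 r2 : nat) (k1 l1 k2 l2 : int),
  let x1 := r1%:R * a - k1%:~R in let y1 := r1%:R * (a * a) - l1%:~R in
  let x2 := r2%:R * a - k2%:~R in let y2 := r2%:R * (a * a) - l2%:~R in
  [/\ `|x1| < e, `|y1| < e, `|x2| < e, `|y2| < e & x1 * y2 - y1 * x2 != 0].
Proof.
move=> e0.
have dir (f : R) : 0 < f -> exists (r : nat) (k l : int),
    [/\ (0 < r)%N, `|r%:R * a - k%:~R| < f & `|r%:R * (a * a) - l%:~R| < f].
  move=> f0; have fV0 : 0 <= f^-1 by rewrite invr_ge0 ltW.
  have [r [k [l [r0 h1 h2]]]] := dirichlet2 a (a * a) (Num.bound f^-1).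
  have h : (Num.bound f^-1).+1%:R^-1 < f.
    rewrite -[ltRHS]invrK ltf_pV2 ?posrE ?ltr0n ?invr_gt0 //.
    by apply: lt_trans (archi_boundP fV0) _; rewrite ltr_nat.
  by exists r, k, l; split=> //; [apply: lt_trans h1 h | apply: lt_trans h2 h].
have [r1 [k1 [l1 [r10 h1 h2]]]] := dir e e0.
have x10 : 0 < `|r1%:R * a - k1%:~R| by rewrite normr_gt0 irrational_mul.
have r1R : 0 < r1%:R :> R by rewrite ltr0n.
(* The second bound excludes proportionality: it makes [r1 * |x2|] smaller than [|x1|], whereas
   proportionality would give [r1 * |x2| = r2 * |x1|]. *)
have f0 : 0 < Num.min e (`|r1%:R * a - k1%:~R| / r1%:R) by rewrite lt_min e0 divr_gt0.
have [r2 [k2 [l2 [r20 h3 h4]]]] := dir _ f0.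
move: h3 h4; rewrite !lt_min => /andP[h3 h5] /andP[h4 _].
exists r1, r2, k1, l1, k2, l2; split=> //; apply/eqP => E.
have E2 : (r1%:Z * k2 - k1 * r2%:Z)%:~R * (a * a) + (l1 * r2%:Z - r1%:Z * l2)%:~R * a +
    (k1 * l2 - l1 * k2)%:~R = 0 :> R.
  by rewrite -E !intrB !intrM -!pmulrn; ring.
have [E3|n3] := eqVneq (r1%:Z * k2 - k1 * r2%:Z) 0; last by have := nq (l1 * r2%:Z - r1%:Z * l2) (k1 * l2 - l1 * k2) n3; rewrite E2 eqxx.
have E4 : r1%:R * (r2%:R * a - k2%:~R) = r2%:R * (r1%:R * a - k1%:~R) :> R.
  apply/eqP; rewrite -subr_eq0 (_ : _ - _ = - (r1%:Z * k2 - k1 * r2%:Z)%:~R).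
    by rewrite E3 oppr0.
  by rewrite intrB !intrM -!pmulrn; ring.
have : r1%:R * `|r2%:R * a - k2%:~R| < `|r1%:R * a - k1%:~R| by rewrite mulrC -ltr_pdivlMr.
rewrite -{1}(gtr0_norm r1R) -normrM E4 normrM ger0_norm // -[ltRHS]mul1r ltr_pM2r //.
by rewrite ltNge (ler_nat R 1) r20.
Qed.

Lemma int_shift (z : int) (T : nat) : `|z| <= T%:Z ->
  exists r : nat, [/\ r%:Z = z + T.+1%:Z, (0 < r)%N & (r <= 2 * T + 1)%N].
Proof. by move=> h; exists (absz (z + T.+1%:Z)%R); split; lia. Qed.

(** Two short independent vectors span a fine lattice. Rounding down the coordinates [al], [be] of
    the target costs less than [e], and since the target may be reduced modulo 1 the coefficients
    are bounded uniformly. *)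
Lemma kronecker (e : R) : 0 < e -> exists T : nat, forall x y : R, exists r : nat,
  [/\ (0 < r)%N, (r <= T)%N, nrm (r%:R * a - x) < e & nrm (r%:R * (a * a) - y) < e].
Proof.
move=> e0; have e2 : 0 < e / 2 by rewrite divr_gt0.
have [r1 [r2 [k1 [l1 [k2 [l2 []]]]]]] := small_pair e2.
set x1 := _ - k1%:~R; set y1 := _ - l1%:~R; set x2 := _ - k2%:~R; set y2 := _ - l2%:~R.
move=> hx1 hy1 hx2 hy2 det0; set det := _ - _ in det0.
pose C := (e / `|det| + 1) * (r1 + r2)%:R.
have dp : 0 < `|det| by rewrite normr_gt0.
have C0 : 0 <= C by rewrite mulr_ge0 // addr_ge0 // divr_ge0 // ltW.
pose T0 := Num.bound C; have T0P := archi_boundP C0.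
exists (2 * T0 + 1)%N => x y.
(* The combination [rr] found below may be negative, but is at least [- T0]. The target is moved in
   advance so that [T0.+1] can be added to it. *)
pose x' := x - T0.+1%:R * a; pose y' := y - T0.+1%:R * (a * a).
pose u := x' - (Num.floor x')%:~R; pose v := y' - (Num.floor y')%:~R.
have u1 : `|u| <= 1.
  rewrite ger0_norm ?subr_ge0 ?ge_floor // lerBlDl ltW //.
  by have := lt_succ_floor x'; rewrite intrD.
have v1 : `|v| <= 1.
  rewrite ger0_norm ?subr_ge0 ?ge_floor // lerBlDl ltW //.
  by have := lt_succ_floor y'; rewrite intrD.
pose al := (u * y2 - v * x2) / det; pose be := (x1 * v - y1 * u) / det.
have bnd (p q s w : R) : `|p| <= 1 -> `|s| <= 1 -> `|q| < e / 2 -> `|w| < e / 2 ->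
    `|(p * q - s * w) / det| <= e / `|det|.
  move=> hp hs hq hw; rewrite normrM normfV ler_wpM2r ?invr_ge0 ?(ltW dp) //.
  apply: le_trans (ler_normB _ _) _; rewrite !normrM.
  have := normr_ge0 q; have := normr_ge0 w; have := normr_ge0 p; have := normr_ge0 s; nra.
have alB : `|al| <= e / `|det| by exact: bnd.
have beB : `|be| <= e / `|det|.
  by rewrite /be (mulrC x1) (mulrC y1); exact: bnd.
have fl (z : R) : `|z| <= e / `|det| -> `|(Num.floor z)%:~R| <= e / `|det| + 1 :> R.
  rewrite !ler_norml => /andP[h1 h2]; have h3 := ge_floor z; have h4 := lt_succ_floor z.
  by rewrite intrD in h4; apply/andP; split; lra.
pose n1 := Num.floor al; pose n2 := Num.floor be.
have ux : u = al * x1 + be * x2.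
  by rewrite /al /be /det; field.
have vy : v = al * y1 + be * y2.
  by rewrite /al /be /det; field.
pose rr := n1 * r1%:Z + n2 * r2%:Z.
have rrB : `|rr| <= T0%:Z.
  rewrite -(ler_int R) intr_norm -pmulrn; apply: le_trans (ltW T0P).
  rewrite intrD !intrM -!pmulrn; apply: le_trans (ler_normD _ _) _.
  rewrite !normrM !normr_nat /C natrD mulrDr.
  by apply: lerD; rewrite ler_wpM2r // fl.
have [r [rE rl rh]] := int_shift rrB.
have rR : r%:R = rr%:~R + T0.+1%:R :> R by rewrite pmulrn rE intrD -pmulrn.
have close (w z1 z2 : R) (f m1 m2 : int) : `|z1| < e / 2 -> `|z2| < e / 2 ->
    w - f%:~R = al * z1 + be * z2 ->
    nrm (n1%:~R * (z1 + m1%:~R) + n2%:~R * (z2 + m2%:~R) - w) < e.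
  move=> h1 h2 hw.
  rewrite (_ : _ - w = (n1%:~R * z1 + n2%:~R * z2 - (w - f%:~R)) + (n1 * m1 + n2 * m2 - f)%:~R); last first.
    by rewrite intrB intrD !intrM; ring.
  rewrite nrm_int hw; apply: le_lt_trans (nrm_le _ 0) _; rewrite subr0.
  rewrite (_ : _ - _ = - ((al - n1%:~R) * z1 + (be - n2%:~R) * z2)); last by ring.
  rewrite normrN; apply: le_lt_trans (ler_normD _ _) _; rewrite !normrM.
  have g1 := ge_floor al; have g2 := lt_succ_floor al; rewrite intrD in g2.
  have g3 := ge_floor be; have g4 := lt_succ_floor be; rewrite intrD in g4.
  rewrite (ger0_norm (_ : 0 <= al - _)) ?subr_ge0 // (ger0_norm (_ : 0 <= be - _)) ?subr_ge0 //.
  have := normr_ge0 z1; have := normr_ge0 z2; rewrite -/n1 -/n2 in g1 g2 g3 g4 *.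
  by move: (`|z1|) (`|z2|) h1 h2 => s1 s2 *; nra.
exists r; split=> //.
- have := @close x' x1 x2 (Num.floor x') k1 k2 hx1 hx2 ux.
  rewrite /x1 /x2 !subrK (_ : _ - x' = r%:R * a - x) // rR /x' /rr intrD !intrM -!pmulrn; ring.
- have := @close y' y1 y2 (Num.floor y') l1 l2 hy1 hy2 vy.
  rewrite /y1 /y2 !subrK (_ : _ - y' = r%:R * (a * a) - y) // rR /y' /rr intrD !intrM -!pmulrn; ring.
Qed.

(** * Tolerances and chains of selected indices *)

Section Chain.
Variable del : R.
Hypothesis del0 : 0 < del.

(** The least distance of [q * a] to the integers for [0 < q <= j]. The initial value 1 is harmless
    for [j > 0], since such distances are at most 1/2. *)
Fixpoint rho (j : nat) : R := if j is j'.+1 then Num.min (rho j') (nrm (j%:R * a)) else 1.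

Lemma rho_gt0 j : 0 < rho j.
Proof. by elim: j => //= j IH; rewrite lt_min IH nrm_gt0. Qed.

Lemma rho_le i j : (i <= j)%N -> rho j <= rho i.
Proof.
elim: j => [|j IH]; first by rewrite leqn0 => /eqP->.
rewrite leq_eqVlt => /orP[/eqP->//|]; rewrite ltnS => /IH; apply: le_trans.
by rewrite /= ge_min lexx.
Qed.

Lemma rho_nrm q j : (0 < q)%N -> (q <= j)%N -> rho j <= nrm (q%:R * a).
Proof.
case: q => // q _ le; apply: le_trans (rho_le le) _.
by rewrite /= ge_min lexx orbT.
Qed.

Lemma rho_glb (z : R) j : (0 < j)%N ->
  (forall q, (0 < q)%N -> (q <= j)%N -> z <= nrm (q%:R * a)) -> z <= rho j.
Proof.
move=> j0 H; have z1 : z <= 1.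
  by apply: le_trans (H 1%N isT j0) _; apply: le_trans (nrm_half _) _; lra.
elim: j {j0} H => // j IH H; rewrite /= le_min H // andbT.
by apply: IH => q q0 le; apply: H => //; exact: leqW.
Qed.

Definition hits (th : R) (T : nat) := forall x y : R, exists r : nat,
  [/\ (0 < r)%N, (r <= T)%N, nrm (r%:R * a - x) < th & nrm (r%:R * (a * a) - y) < del].

Lemma hits_ex th : 0 < th -> exists T, `[< hits th T >].
Proof.
move=> th0; have m0 : 0 < Num.min th del by rewrite lt_min th0.
have [T HT] := kronecker m0; exists T; apply/asboolP => x y.
have [r [r0 rT h1 h2]] := HT x y; exists r; split=> //.
  by move: h1; rewrite lt_min => /andP[].
by move: h2; rewrite lt_min => /andP[].
Qed.

Lemma quarter_gt0 j : 0 < rho j / 4.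
Proof. by rewrite divr_gt0 ?rho_gt0. Qed.

(** Minimality gives monotonicity in [j], and makes every [T] that hits with a tolerance up to
    [rho j / 4] an upper bound of [hit_time j]; the definability of [rad] rests on this. *)
Definition hit_time j := ex_minn (hits_ex (quarter_gt0 j)).

Lemma hit_timeP j : hits (rho j / 4) (hit_time j).
Proof. by rewrite /hit_time; case: ex_minnP => T /asboolP. Qed.

Lemma hit_time_min j th T : th <= rho j / 4 -> hits th T -> (hit_time j <= T)%N.
Proof.
move=> le H; rewrite /hit_time; case: ex_minnP => T' _; apply; apply/asboolP => x y.
have [r [r0 rT h1 h2]] := H x y; exists r; split=> //; exact: lt_le_trans h1 le.
Qed.

Lemma hit_time_le i j : (i <= j)%N -> (hit_time i <= hit_time j)%N.
Proof.
move=> le; apply: hit_time_min (hit_timeP j).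
by rewrite ler_wpM2r ?invr_ge0 // rho_le.
Qed.

Lemma hit_time_gt0 j : (0 < hit_time j)%N.
Proof. by have [r [r0 rT _ _]] := hit_timeP j 0 0; apply: leq_trans r0 rT. Qed.

Lemma rho_hit j : rho (hit_time j) < rho j / 4.
Proof.
have [r [r0 rT h _]] := hit_timeP j 0 0; rewrite subr0 in h.
by apply: le_lt_trans h; exact: rho_nrm.
Qed.

(** Half of [rho]: two distinct indices at most [hit_time j] apart have multiples of [a] at least
    [2 * rad j] apart, so no [d] is within [rad j] of both. *)
Definition rad j := rho (hit_time j) / 2.

Lemma rad_le i j : (i <= j)%N -> rad j <= rad i.
Proof. by move=> le; rewrite ler_wpM2r ?invr_ge0 // rho_le // hit_time_le. Qed.

(* The next selected index: since an index [j] with [j - r < n0] stays away from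
   [r a], and one with [j - r >= n0] has [hit_time j >= hit_time n0 >= r' - j],
   no index strictly between [r] and [r'] comes too close to [r' a]. *)
Lemma next_selected r y : (0 < r)%N -> exists r' : nat,
  [/\ (r < r')%N, nrm (r'%:R * (a * a) - y) < del,
      nrm ((r' - r)%N%:R * a) + rad r' <= rad r &
      forall j d, (r < j < r')%N -> nrm (r'%:R * a - d) < rad r' -> rad j <= nrm (j%:R * a - d)].
Proof.
move=> r0.
(* [n0] is the first return time to within [2 * rad r]. *)
have [n0 [n00 n0P n0m]] : exists n0 : nat, [/\ (0 < n0)%N, nrm (n0%:R * a) < rho (hit_time r)
    & forall q, (0 < q)%N -> (q < n0)%N -> rho (hit_time r) <= nrm (q%:R * a)].
  have ex : exists q : nat, (0 < q)%N && (nrm (q%:R * a) < rho (hit_time r)).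
    have [q [q0 _ h _]] := hit_timeP (hit_time r) 0 0; exists q; rewrite q0 /=.
    by rewrite subr0 in h; apply: lt_trans h _; have := rho_gt0 (hit_time r); lra.
  exists (ex_minn ex); case: ex_minnP => m /andP[m0 mP] min; split=> // q q0 ltq.
  by rewrite leNgt; apply/negP => h; have := min q; rewrite q0 h leqNgt ltq => /(_ isT).
(* The step [s] nearly returns in the first coordinate, which keeps the new interval inside the old
   one, and moves the second coordinate to the prescribed [y]. It returns so closely that
   [s >= n0]. *)
have [s [s0 sT h1 h2]] := hit_timeP n0 0 (y - r%:R * (a * a)); rewrite subr0 in h1.
have rn0 : rho n0 <= nrm (n0%:R * a) by exact: rho_nrm.
have rg := rho_gt0 n0.
have sn0 : (n0 <= s)%N.
  rewrite leqNgt; apply/negP => lts; have := n0m _ s0 lts.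
  by rewrite leNgt; apply/negP; rewrite negbK; lra.
have hr' : rho (hit_time (r + s)) < rho n0 / 4.
  apply: lt_le_trans (rho_hit _) _; rewrite ler_wpM2r ?invr_ge0 //.
  by apply: rho_le; apply: leq_trans sn0 (leq_addl _ _).
have nest : nrm (s%:R * a) + rad (r + s) <= rad r by rewrite /rad; lra.
exists (r + s)%N; split.
- by rewrite -addn1 leq_add2l.
- by rewrite natrD (_ : _ - y = s%:R * (a * a) - (y - r%:R * (a * a))) //; ring.
- by rewrite addKn.
move=> j d /andP[ltrj ltj] hd.
have [ltn|len] := ltnP (j - r) n0.
  have h3 : rho (hit_time r) <= nrm ((j - r)%N%:R * a) by apply: n0m => //; rewrite subn_gt0.
  have h4 : nrm (r%:R * a - d) < rad r.
    rewrite (_ : _ - d = ((r + s)%N%:R * a - d) - s%:R * a); last by rewrite natrD; ring.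
    by apply: le_lt_trans (nrmB _ _) _; lra.
  have h5 : nrm ((j - r)%N%:R * a) <= nrm (j%:R * a - d) + nrm (r%:R * a - d).
    by apply: le_trans (nrmB _ _); rewrite natrB 1?ltnW // (_ : _ * a = j%:R * a - d - (r%:R * a - d)) //; ring.
  by have := rad_le (ltnW ltrj); move: h4; rewrite /rad; lra.
have lej : (n0 <= j)%N by apply: leq_trans len (leq_subr _ _).
have h3 : rho (hit_time j) <= nrm ((r + s - j)%N%:R * a).
  apply: rho_nrm; first by rewrite subn_gt0.
  by apply: leq_trans (hit_time_le lej); apply: leq_trans sT; lia.
have h5 : nrm ((r + s - j)%N%:R * a) <= nrm ((r + s)%N%:R * a - d) + nrm (j%:R * a - d).
  by apply: le_trans (nrmB _ _); rewrite natrB 1?ltnW // (_ : _ * a = (r + s)%N%:R * a - d - (j%:R * a - d)) //; ring.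
by have := rad_le (ltnW ltj); rewrite /rad in hd *; lra.
Qed.

Lemma path_le_last r rs : path ltn r rs -> (r <= last r rs)%N.
Proof.
elim: rs r => //= x rs IH r /andP[ltr /IH]; apply: leq_trans; exact: ltnW.
Qed.

Lemma path_mem_last r rs j : path ltn r rs -> j \in rs -> (j <= last r rs)%N.
Proof.
elim: rs r => //= x rs IH r /andP[_ px]; rewrite inE => /orP[/eqP->|]; last exact: IH.
exact: path_le_last px.
Qed.

Lemma selected_chain (ys : seq R) r : (0 < r)%N -> exists rs : seq nat,
  [/\ size rs = size ys, path ltn r rs,
      forall i, (i < size ys)%N -> nrm ((nth 0%N rs i)%:R * (a * a) - nth 0 ys i) < del
    & forall d, nrm ((last r rs)%:R * a - d) < rad (last r rs) ->
      forall j, (r <= j <= last r rs)%N -> (nrm (j%:R * a - d) < rad j) = (j \in r :: rs)].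
Proof.
elim: ys r => [|y ys IH] r r0.
  exists [::]; split=> // d hd j /=; rewrite -eqn_leq => /eqP <-.
  by rewrite inE eqxx.
have [r' [ltr hy nest junk]] := next_selected y r0.
have [rs [srs prs hrs sel]] := IH r' (leq_ltn_trans (leq0n r) ltr).
exists (r' :: rs); split=> /=; [by rewrite srs | by rewrite ltr | by case=> [|i] //; exact: hrs |].
move=> d hd j /andP[lej jle]; have hsel := sel d hd.
have ler'l := path_le_last prs.
have hr' : nrm (r'%:R * a - d) < rad r' by rewrite hsel ?inE ?eqxx // leqnn.
have rs_gt i : i \in r' :: rs -> (r' <= i)%N.
  rewrite inE => /orP[/eqP->//|]; elim: rs r' prs {ltr hy nest junk srs hrs sel hd jle hsel ler'l hr'} => //= x rs IH' z /andP[ltz pz].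
  by rewrite inE => /orP[/eqP->|/(IH' _ pz)]; [exact: ltnW | apply: leq_trans; exact: ltnW].
have [ltj|lej'] := ltnP j r'; last by rewrite hsel ?lej' // [in RHS]inE gtn_eqF // (leq_trans ltr).
rewrite inE orbC; case: (boolP (j \in _)) => [/rs_gt|_ /=]; first by rewrite leqNgt ltj.
have [->|nej] := eqVneq j r.
  rewrite (_ : _ - d = (r'%:R * a - d) - (r' - r)%N%:R * a); last by rewrite natrB 1?ltnW //; ring.
  by apply: le_lt_trans (nrmB _ _) _; lra.
by apply/negbTE; rewrite -leNgt; apply: junk => //; rewrite ltj andbT ltn_neqAle eq_sym nej.
Qed.

End Chain.

(* First-order properties in [S_ a]: [Low j z] means [z <= rho j], [Hit] means
   [hits], [Exc del j d] that [j] is selected by [d], that is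
   [nrm (j * a - d) < rad j], and [Dec del j u] that [u] is the least natural
   number with [j * a ^ 2] near [u * a]. *)
Definition isint (x : R) := x \is a Num.int.
Definition pos (x : R) := x < x + x.
Definition isnat (x : R) := isint x /\ ~ x + x < x.
Definition Near (x y e : R) := exists k, [/\ isint k, x < y + k + e & y + k < x + e].
Definition Near0 (x e : R) := exists k, [/\ isint k, x < k + e & k < x + e].
Definition Low (j z : R) := forall q, isint q -> pos q -> ~ j < q -> ~ Near0 (a * q) z.
Definition Hit (del th T : R) := forall x y, exists r, [/\ isint r, pos r, ~ T < r,
  Near (a * r) x th & Near (a * (a * r)) y del].
Definition Exc (del j d : R) := exists T eta th, [/\ isint T, pos T,
  Low j (th + th + (th + th)), Hit del th T & Low T (eta + eta) /\ Near (a * j) d eta].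
Definition Dec (del j u : R) := Near (a * (a * j)) (a * u) del /\
  forall v, isnat v -> v < u -> ~ Near (a * (a * j)) (a * v) del.
Definition Sel (del d L S j : R) := [/\ isint j, L < j, ~ S < j & Exc del j d].
Definition One (o : R) := [/\ isint o, pos o & forall z, isint z -> pos z -> ~ z < o].
Definition Rel (del d L S x z : R) := [/\ isnat x, isnat z & exists j j', [/\ Sel del d L S j,
  Sel del d L S j', j < j', forall i, Sel del d L S i -> j < i -> ~ i < j' &
  Dec del j (x + x) /\ exists2 o, One o & Dec del j' (z + z + o)]].

Lemma posE x : pos x = (0 < x).
Proof. by rewrite /pos ltrDl. Qed.

Lemma isint_nat (n : nat) : isint n%:R.
Proof. by rewrite /isint natr_int. Qed.

Lemma isint_pos x : isint x -> pos x -> exists2 n : nat, (0 < n)%N & x = n%:R.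
Proof.
move=> /intrP[k ->]; rewrite posE ltr0z => k0; exists `|k|%N; first by rewrite absz_gt0 gt_eqF.
by rewrite pmulrn gez0_abs // ltW.
Qed.

Lemma pos_nat (n : nat) : (0 < n)%N -> pos n%:R.
Proof. by rewrite posE ltr0n. Qed.

Lemma isnatP x : isnat x <-> exists n : nat, x = n%:R.
Proof.
rewrite /isnat gtrDl; split=> [[xI /negP]|[n ->]]; last first.
  by split; [exact: isint_nat | apply/negP; rewrite -leNgt ler0n].
rewrite -leNgt le_eqVlt => /orP[/eqP<-|]; first by exists 0%N.
by rewrite -posE => /(isint_pos xI)[n _ ->]; exists n.
Qed.

Lemma OneP o : One o <-> o = 1.
Proof.
split=> [[oI o0 H]|->]; last first.
  split; [exact: (isint_nat 1) | exact: (pos_nat (ltn0Sn 0)) | move=> z zI /(isint_pos zI)[n n0 ->]].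
  by apply/negP; rewrite -leNgt (ler_nat R 1).
have [n n0 E] := isint_pos oI o0; have /negP := H 1 (isint_nat 1) (pos_nat (ltn0Sn 0)); rewrite -leNgt E.
by rewrite (ler_nat R n 1) => n1; have -> : n = 1%N by apply/eqP; rewrite eqn_leq n1.
Qed.

Lemma NearP x y e : Near x y e <-> nrm (x - y) < e.
Proof.
split=> [[k [/intrP[m ->] h1 h2]]|h].
  by apply: le_lt_trans (nrm_le _ m) _; rewrite ltr_norml; apply/andP; split; lra.
have [m E] := nrm_ex (x - y); move: h; rewrite E ltr_norml => /andP[h1 h2].
by exists m%:~R; split; [exact: intr_int | lra | lra].
Qed.

Lemma Near0P x e : Near0 x e <-> nrm x < e.
Proof.
rewrite -[x]subr0 -NearP; split=> -[k [kI h1 h2]]; exists k; move: h1 h2; rewrite ?add0r ?subr0 //.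
Qed.

Lemma LowP (j : nat) z : (0 < j)%N -> Low j%:R z <-> z <= rho j.
Proof.
move=> j0; split=> [H|le q qI q0 qj].
  apply: rho_glb => // q q0 qj; rewrite leNgt; apply/negP => h'.
  apply: (H q%:R (isint_nat q) (pos_nat q0)); first by rewrite ltr_nat ltnNge qj.
  by apply/Near0P; rewrite mulrC.
have [n n0 E] := isint_pos qI q0; rewrite Near0P E mulrC.
apply/negP; rewrite -leNgt; apply: le_trans le _; apply: rho_nrm => //.
by move/negP: qj; rewrite E ltr_nat -leqNgt.
Qed.

Lemma HitP del th (T : nat) : Hit del th T%:R <-> hits del th T.
Proof.
split=> H x y.
  have [r [rI r0 rT h1 h2]] := H x y; have [n n0 E] := isint_pos rI r0.
  exists n; split=> //; first by move/negP: rT; rewrite E ltr_nat -leqNgt.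
    by move/NearP: h1; rewrite E (mulrC a).
  by move/NearP: h2; rewrite E mulrA (mulrC (a * a)).
have [n [n0 nT h1 h2]] := H x y; exists n%:R; split.
- exact: isint_nat.
- exact: pos_nat.
- by apply/negP; rewrite ltr_nat -leqNgt.
- by apply/NearP; rewrite mulrC.
- by apply/NearP; rewrite mulrA mulrC.
Qed.

(** Every admissible [T] is at least [hit_time j], hence every admissible [eta] is at most [rad j],
    and this value is attained. An existential quantifier thus replaces the computation of [rho] and
    [hit_time]. *)
Lemma ExcP del (del0 : 0 < del) (j : nat) d : (0 < j)%N ->
  Exc del j%:R d <-> nrm (j%:R * a - d) < rad del0 j.
Proof.
move=> j0; split.
  move=> [T [eta [th [TI T0 /(LowP _ j0) h1 h2 [h3 /NearP h4]]]]].
  have [n n0 E] := isint_pos TI T0; move: h2 h3; rewrite E => /HitP h2 /(LowP _ n0) h3.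
  rewrite mulrC; apply: lt_le_trans h4 _; rewrite /rad.
  have le : (hit_time del0 j <= n)%N by apply: hit_time_min h2; lra.
  by have := rho_le le; lra.
move=> h; exists (hit_time del0 j)%:R, (rad del0 j), (rho j / 4).
have t0 := hit_time_gt0 del0 j; split.
- exact: isint_nat.
- exact: pos_nat.
- by apply/LowP => //; lra.
- exact/HitP/hit_timeP.
- by split; [apply/LowP => //; rewrite /rad; lra | apply/NearP; rewrite mulrC].
Qed.

(** Distinct naturals up to [M] have multiples of [a] at least [rho M = 2 * del] apart modulo 1, so
    at most one of them is within [del]. *)
Lemma DecP (M j u v : nat) : let del := rho M / 2 in (u <= M)%N ->
  nrm (j%:R * (a * a) - u%:R * a) < del -> (v <= M)%N -> Dec del j%:R v%:R <-> v = u.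
Proof.
move=> del uM hu vM.
have aaj : a * (a * j%:R) = j%:R * (a * a) by ring.
have uniq (x y : nat) : (x <= M)%N -> (y < x)%N -> nrm (j%:R * (a * a) - x%:R * a) < del ->
    nrm (j%:R * (a * a) - y%:R * a) < del -> False.
  move=> xM ltyx hx hy; have := rho_nrm (_ : (0 < x - y)%N) (leq_trans (leq_subr y x) xM).
  rewrite subn_gt0 => /(_ ltyx); rewrite leNgt => /negP; apply.
  rewrite natrB 1?ltnW // (_ : _ * a = (j%:R * (a * a) - y%:R * a) - (j%:R * (a * a) - x%:R * a)); last by ring.
  by apply: le_lt_trans (nrmB _ _) _; move: hx hy; rewrite /del; lra.
rewrite /Dec NearP aaj (mulrC a v%:R); split.
  move=> [hv min]; case: (ltngtP v u) => // h; exfalso.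
    exact: (uniq u v uM h hu hv).
  exact: (uniq v u vM h hv hu).
move=> ->; split=> // w /isnatP[n ->]; rewrite ltr_nat NearP (mulrC a n%:R) => ltn hn.
exact: (uniq u n).
Qed.

(* A finite relation is coded by the sequence 2x, 2z+1 over its pairs (x, z):
   a consecutive pair (even, odd) comes from one element of the relation. *)
Lemma finite_relation_coded (l : seq (nat * nat)) : exists del d L S, forall x z : R,
  Rel del d L S x z <-> exists2 p : nat * nat, p \in l & x = p.1%:R /\ z = p.2%:R.
Proof.
pose u i := if odd i then (2 * (nth (0, 0) l i./2).2 + 1)%N else (2 * (nth (0, 0) l i./2).1)%N.
pose n := (2 * size l)%N.
pose M := (\max_(i < n) u i)%N.
have uM i : (i < n)%N -> (u i <= M)%N by move=> ltin; apply: (leq_bigmax (Ordinal ltin)).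
pose del := rho M / 2; have del0 : 0 < del by rewrite divr_gt0 ?rho_gt0.
pose ys := mkseq (fun i => (u i)%:R * a) n.
(* The chain starts at index 1, which the strict lower bound [L = 1] will remove from the selected
   ones. *)
have [rs [srs prs hrs sel]] := selected_chain del0 ys (ltn0Sn 0).
rewrite size_mkseq in srs hrs.
pose last_r := last 1%N rs; pose d := last_r%:R * a.
have hd : nrm (d - d) < rad del0 last_r.
  rewrite subrr; apply: le_lt_trans (nrm_le _ 0) _; rewrite subrr normr0.
  by rewrite divr_gt0 ?rho_gt0.
have {}sel := sel d hd.
have gt1 j : j \in rs -> (1 < j)%N by move/(allP (order_path_min ltn_trans prs)).
have srt : sorted ltn rs by exact: path_sorted prs.
have lel j : j \in rs -> (j <= last_r)%N.
  exact: path_mem_last prs.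
have SelP j : Sel del d 1 last_r%:R j <-> exists2 m, m \in rs & j = m%:R.
  split=> [[jI j1 /negP jS hE]|[m mrs ->]].
    have [m m0 E] : exists2 m : nat, (0 < m)%N & j = m%:R.
      by apply: isint_pos => //; rewrite posE (lt_trans ltr01 j1).
    move: j1 jS hE; rewrite E (ltr_nat R 1) -leNgt ler_nat => m1 mS /(ExcP del0 d m0).
    by rewrite sel ?mS ?(ltnW m1) // inE gtn_eqF //= => mrs; exists m.
  have m1 := gt1 m mrs; split.
  - exact: isint_nat.
  - by rewrite (ltr_nat R 1).
  - by apply/negP; rewrite -leNgt ler_nat lel.
  - by apply/(ExcP del0 d (ltnW m1)); rewrite sel ?inE ?mrs ?orbT // (ltnW m1) lel.
have ltrs i k : (i < k)%N -> (k < n)%N -> (nth 0%N rs i < nth 0%N rs k)%N.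
  move=> lti ltk; apply: (sorted_ltn_nth ltn_trans 0%N srt); rewrite ?inE ?srs //.
  exact: ltn_trans ltk.
have hu i : (i < n)%N -> nrm ((nth 0%N rs i)%:R * (a * a) - (u i)%:R * a) < del.
  by move=> lti; have := hrs i lti; rewrite nth_mkseq.
have rs_nth m : m \in rs -> exists2 i, (i < n)%N & m = nth 0%N rs i.
  by move=> /(nthP 0%N)[i lti <-]; exists i; rewrite -?srs.
have u_decode i v : (i < n)%N -> Dec del (nth 0%N rs i)%:R v%:R -> v = u i.
  move=> lti hD; have vM : (v <= M)%N.
    (* [DecP] says nothing about values above [M]; the minimality in [Dec] excludes them, since
       [u i] is smaller and fits. *)
    rewrite leqNgt; apply/negP => ltM; case: hD => _ /(_ (u i)%:R); case.
    - by apply/isnatP; exists (u i).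
    - by rewrite ltr_nat (leq_ltn_trans (uM _ lti)).
    - by apply/NearP; have := hu i lti; rewrite (mulrC (u i)%:R) (_ : a * (a * _) = (nth 0%N rs i)%:R * (a * a)) //; ring.
  exact/(DecP (uM _ lti) (hu _ lti) vM).
have u_dec i : (i < n)%N -> Dec del (nth 0%N rs i)%:R (u i)%:R.
  by move=> lti; apply/(DecP (uM _ lti) (hu _ lti) (uM _ lti)).
exists del, d, 1, last_r%:R => x z; split.
- move=> [/isnatP[p ->] /isnatP[q ->] [j [j' [/SelP[m mrs ->] /SelP[m' mrs' ->]]]]].
  rewrite ltr_nat => ltm nb [hD [o /OneP-> hD']].
  have [i lti Em] := rs_nth m mrs; have [k ltk Em'] := rs_nth m' mrs'.
  rewrite Em in hD ltm nb; rewrite Em' in hD' ltm nb.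
  have Ei : (p + p)%N = u i by apply: u_decode => //; rewrite natrD.
  have Ek : (q + q + 1)%N = u k by apply: u_decode => //; rewrite !natrD.
  have ltik : (i < k)%N.
    rewrite ltnNge; apply/negP; rewrite leq_eqVlt => /orP[/eqP E|/ltrs/(_ lti) h].
      by rewrite E ltnn in ltm.
    by have := ltn_trans ltm h; rewrite ltnn.
  have kE : k = i.+1.
    apply/eqP; rewrite eqn_leq ltik andbT leqNgt; apply/negP => ltk'.
    have lti1 : (i.+1 < n)%N by exact: ltn_trans ltk.
    apply: (nb (nth 0%N rs i.+1)%:R); last by rewrite ltr_nat ltrs.
      by apply/SelP; exists (nth 0%N rs i.+1) => //; rewrite mem_nth // srs.
    by rewrite ltr_nat ltrs.
  rewrite kE /u /= in Ek; rewrite /u in Ei.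
  (* Parity: the first entry is [p + p], so [i] is even and both entries belong to the same pair of
     [l]. *)
  case oi : (odd i) Ei Ek => /= Ei Ek; first by move: Ei; move: (nth _ _ _).2 => y'; lia.
  exists (nth (0%N, 0%N) l i./2); first by apply: mem_nth; rewrite ltn_half_double -mul2n.
  have hu2 : (uphalf i = i./2)%N by rewrite uphalf_half oi.
  rewrite hu2 in Ek; move: Ei Ek; move: (nth _ _ _) => pq Ei Ek.
  by split; congr (_%:R); lia.
- move=> [[p q] pl [-> ->]]; set i := index (p, q) l.
  have lti : (i < size l)%N by rewrite index_mem.
  have Ei : nth (0%N, 0%N) l i = (p, q) by exact: nth_index.
  have lt1 : (2 * i < n)%N by rewrite /n; lia.
  have lt2 : ((2 * i).+1 < n)%N by rewrite /n; lia.
  have u1 : u (2 * i)%N = (p + p)%N.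
    by rewrite /u mul2n odd_double /= doubleK Ei /=; lia.
  have u2 : u (2 * i).+1 = (q + q + 1)%N.
    by rewrite /u mul2n /= odd_double /= uphalf_double Ei /=; lia.
  split; [by apply/isnatP; exists p | by apply/isnatP; exists q |].
  exists (nth 0%N rs (2 * i))%:R, (nth 0%N rs (2 * i).+1)%:R; split.
  + by apply/SelP; exists (nth 0%N rs (2 * i)) => //; rewrite mem_nth // srs.
  + by apply/SelP; exists (nth 0%N rs (2 * i).+1) => //; rewrite mem_nth // srs.
  + by rewrite ltr_nat ltrs.
  + move=> j /SelP[m /rs_nth[k ltk ->] ->]; rewrite !ltr_nat => h1 h2.
    have lt_ik : (2 * i < k)%N.
      rewrite ltnNge; apply/negP; rewrite leq_eqVlt => /orP[/eqP E|/ltrs/(_ lt1) h].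
        by rewrite E ltnn in h1.
      by have := ltn_trans h1 h; rewrite ltnn.
    have lt_ki : (k < (2 * i).+1)%N.
      rewrite ltnNge; apply/negP; rewrite leq_eqVlt => /orP[/eqP E|/ltrs/(_ ltk) h].
        by rewrite E ltnn in h2.
      by have := ltn_trans h2 h; rewrite ltnn.
    by move: lt_ki; rewrite ltnS leqNgt lt_ik.
  + split; first by rewrite -natrD -u1; exact: u_dec.
    exists 1; first exact/OneP.
    have -> : q%:R + q%:R + 1 = (u (2 * i).+1)%:R :> R by rewrite u2 !natrD.
    exact: u_dec.
Qed.

End Kronecker.

(** * Definability of the recursive functions *)

Section Definable.
Variables (R : realType) (a : R).
Implicit Types e : nat -> R.

Definition rtail e := fun i => e i.+1.

(** Dependence on finitely many entries leaves room for a variable larger than all renamed ones. *)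
Definition below N (T : Type) (F : (nat -> R) -> T) :=
  forall e e', (forall i, (i < N)%N -> e i = e' i) -> F e = F e'.

(* All renamings [s] of the variables are allowed, so that a named binder can be
   chosen fresh without capture. *)
Definition definable_term (T : (nat -> R) -> R) := (exists N, below N T) /\
  forall s : nat -> nat, exists tm, forall e, @eval (S_ a) e tm = T (fun i => e (s i)).

Definition definable (P : (nat -> R) -> Prop) := (exists N, below N P) /\
  forall s : nat -> nat, exists p, forall e, @sat (S_ a) e p <-> P (fun i => e (s i)).

Lemma definable_ext P Q : (forall e, P e <-> Q e) -> definable P -> definable Q.
Proof. by move=> PQ; rewrite (_ : P = Q) //; apply: funext => e; apply/propext. Qed.

Lemma definable_term_var i : definable_term (fun e => e i).
Proof. by split; [exists i.+1 => e e' -> | move=> s; exists (Var (s i))]. Qed.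

Lemma below_max (T1 T2 T : Type) N1 N2 (F1 : _ -> T1) (F2 : _ -> T2) (op : T1 -> T2 -> T) :
  below N1 F1 -> below N2 F2 -> below (maxn N1 N2) (fun e => op (F1 e) (F2 e)).
Proof.
by move=> h1 h2 e e' E; congr op; [apply: h1 | apply: h2] => i lt; apply: E;
  rewrite leq_max lt ?orbT.
Qed.

Lemma definable_term_add T1 T2 : definable_term T1 -> definable_term T2 -> definable_term (fun e => T1 e + T2 e).
Proof.
move=> [[N1 h1] D1] [[N2 h2] D2]; split; first by exists (maxn N1 N2); exact: below_max.
move=> s; have [t1 E1] := D1 s; have [t2 E2] := D2 s.
by exists (Add t1 t2) => e; rewrite /= E1 E2.
Qed.

Lemma definable_term_lam T : definable_term T -> definable_term (fun e => a * T e).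
Proof.
move=> [[N h] D]; split; first by exists N => e e' E; rewrite (h e e').
by move=> s; have [t E] := D s; exists (Lam t) => e; rewrite /= E.
Qed.

Lemma definable_eq T1 T2 : definable_term T1 -> definable_term T2 -> definable (fun e => T1 e = T2 e).
Proof.
move=> [[N1 h1] D1] [[N2 h2] D2]; split; first by exists (maxn N1 N2); exact: below_max.
move=> s; have [t1 E1] := D1 s; have [t2 E2] := D2 s.
by exists (FEq t1 t2) => e; rewrite /= E1 E2.
Qed.

Lemma definable_lt T1 T2 : definable_term T1 -> definable_term T2 -> definable (fun e => T1 e < T2 e).
Proof.
move=> [[N1 h1] D1] [[N2 h2] D2]; split.
  by exists (maxn N1 N2); exact: (below_max (fun x y => is_true (x < y)) h1 h2).
move=> s; have [t1 E1] := D1 s; have [t2 E2] := D2 s.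
by exists (FLt t1 t2) => e; rewrite /= E1 E2.
Qed.

Lemma definable_int T : definable_term T -> definable (fun e => isint (T e)).
Proof.
move=> [[N h] D]; split; first by exists N => e e' E; rewrite (h e e').
by move=> s; have [t E] := D s; exists (FInt t) => e; rewrite /= E.
Qed.

Lemma definable_not P : definable P -> definable (fun e => ~ P e).
Proof.
move=> [[N h] D]; split; first by exists N => e e' E; rewrite (h e e').
by move=> s; have [p E] := D s; exists (FNot p) => e; rewrite /= E.
Qed.

Lemma definable_and P Q : definable P -> definable Q -> definable (fun e => P e /\ Q e).
Proof.
move=> [[N1 h1] D1] [[N2 h2] D2]; split; first by exists (maxn N1 N2); exact: below_max.
move=> s; have [p E1] := D1 s; have [q E2] := D2 s.
by exists (FAnd p q) => e; rewrite /= E1 E2.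
Qed.

Lemma definable_ex (P : R -> (nat -> R) -> Prop) :
  definable (fun e => P (e 0%N) (rtail e)) -> definable (fun e => exists c, P c e).
Proof.
move=> [[N h] D].
have hP c e e' : (forall i, (i < N)%N -> e i = e' i) -> P c e = P c e'.
  by move=> E; apply: (h (scons c e) (scons c e')) => -[|i] //= lt; apply: E; exact: ltnW.
split; first by exists N => e e' E; apply/propext; split=> -[c Pc]; exists c; move: Pc; rewrite (hP c e e').
move=> s; pose z := (\max_(i < N) s i).+1.
have [p E] := D (scons z s); exists (FEx z p) => e /=.
have EP c : P (update e z c z) (fun i => update e z c (s i)) = P c (fun i => e (s i)).
  rewrite {1}/update eqxx; apply: hP => i lti; rewrite /update ltn_eqF // ltnS.
  exact: (leq_bigmax (F := fun i : 'I_N => s i) (Ordinal lti)).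
by split=> -[c]; [move=> /E /=; rewrite EP => ? | move=> Pc]; exists c => //; apply/E; rewrite /= EP.
Qed.

Definition renaming (F : (nat -> R) -> nat -> R) := exists s : nat -> nat, forall e i, F e i = e (s i).

Lemma renaming_scons (T : (nat -> R) -> R) F : (exists j, forall e, T e = e j) -> renaming F ->
  renaming (fun e => scons (T e) (F e)).
Proof.
by move=> [j Tj] [s Fs]; exists (scons j s) => e [|i] /=.
Qed.

Lemma definable_VR P F : definable P -> renaming F -> definable (fun e => P (F e)).
Proof.
move=> [[N h] D] [s Fs]; have FE e : F e = fun i => e (s i) by apply: funext => i.
split.
  exists (\max_(i < N) s i).+1 => e e' E; apply: h => i lti; rewrite !Fs; apply: E; rewrite ltnS.
  exact: (leq_bigmax (F := fun i : 'I_N => s i) (Ordinal lti)).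
move=> s'; have [p E] := D (s' \o s); exists p => e; rewrite E FE //.
Qed.

Lemma definable_or P Q : definable P -> definable Q -> definable (fun e => P e \/ Q e).
Proof.
move=> dP dQ; apply: (@definable_ext (fun e => ~ (~ P e /\ ~ Q e))); last by do 2?apply: definable_not => //; apply: definable_and; apply: definable_not.
move=> e; split=> [h|[p|q] []//].
by case: (pselect (P e)) => p; [left | right; apply: contrapT => q; apply: h].
Qed.

Lemma definable_imp P Q : definable P -> definable Q -> definable (fun e => P e -> Q e).
Proof.
move=> dP dQ; apply: (@definable_ext (fun e => ~ P e \/ Q e)); last by apply: definable_or => //; exact: definable_not.
by move=> e; split=> [[//|//]|h]; case: (pselect (P e)) => p; [right; exact: h | left].
Qed.

Lemma definable_all (P : R -> (nat -> R) -> Prop) :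
  definable (fun e => P (e 0%N) (rtail e)) -> definable (fun e => forall c, P c e).
Proof.
move=> dP; apply: (@definable_ext (fun e => ~ exists c, ~ P c e)); last by apply/definable_not/definable_ex/definable_not.
by move=> e; split=> [h c|h [c]]; [apply: contrapT => n; apply: h; exists c | apply].
Qed.

Lemma definable_ex2 (P Q : R -> (nat -> R) -> Prop) :
  definable (fun e => P (e 0%N) (rtail e)) -> definable (fun e => Q (e 0%N) (rtail e)) ->
  definable (fun e => exists2 c, P c e & Q c e).
Proof.
move=> dP dQ; apply: (@definable_ext (fun e => exists c, P c e /\ Q c e)); last by apply/definable_ex/definable_and.
by move=> e; split=> [[c [? ?]]|[c]]; exists c.
Qed.

Lemma definable_and3 P Q S : definable P -> definable Q -> definable S -> definable (fun e => [/\ P e, Q e & S e]).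
Proof.
move=> dP dQ dS; apply: (@definable_ext (fun e => P e /\ Q e /\ S e)); last by do 2?apply: definable_and.
by move=> e; split=> [[? []]|[]].
Qed.

Lemma definable_and4 P Q S T : definable P -> definable Q -> definable S -> definable T -> definable (fun e => [/\ P e, Q e, S e & T e]).
Proof.
move=> dP dQ dS dT; apply: (@definable_ext (fun e => P e /\ Q e /\ S e /\ T e)); last by do 3?apply: definable_and.
by move=> e; split=> [[? [? []]]|[]].
Qed.

Lemma definable_and5 P Q S T U : definable P -> definable Q -> definable S -> definable T -> definable U ->
  definable (fun e => [/\ P e, Q e, S e, T e & U e]).
Proof.
move=> dP dQ dS dT dU; apply: (@definable_ext (fun e => P e /\ Q e /\ S e /\ T e /\ U e));
  last by do 4?apply: definable_and.
by move=> e; split=> [[? [? [? []]]]|[]].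
Qed.

Lemma definable_forall_lt n (P : nat -> (nat -> R) -> Prop) : (forall i, (i < n)%N -> definable (P i)) ->
  definable (fun e => forall i, (i < n)%N -> P i e).
Proof.
elim: n => [|n IH] dP.
  apply: (@definable_ext (fun e => e 0%N = e 0%N)) => //; apply: definable_eq; exact: definable_term_var.
apply: (@definable_ext (fun e => P n e /\ forall i, (i < n)%N -> P i e)).
  move=> e; split=> [[Pn H] i|H]; last by split=> [|i lt]; apply: H => //; exact: leqW.
  by rewrite ltnS leq_eqVlt => /orP[/eqP->|/H].
by apply: definable_and; [exact: dP | apply: IH => i lt; apply: dP; exact: leqW].
Qed.

Ltac dp_step := cbv beta;
  lazymatch goal with
  | |- definable_term (fun e => _ + _) => apply: definable_term_add
  | |- definable_term (fun e => a * _) => apply: definable_term_lam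
  | |- definable_term _ => exact: definable_term_var
  | |- definable (fun e => _ /\ _) => apply: definable_and
  | |- definable (fun e => _ \/ _) => apply: definable_or
  | |- definable (fun e => [/\ _, _ & _]) => apply: definable_and3
  | |- definable (fun e => [/\ _, _, _ & _]) => apply: definable_and4
  | |- definable (fun e => [/\ _, _, _, _ & _]) => apply: definable_and5
  | |- definable (fun e => ~ _) => apply: definable_not
  | |- definable (fun e => exists x, _) => apply: definable_ex
  | |- definable (fun e => exists2 x, _ & _) => apply: definable_ex2
  | |- definable (fun e => is_true (_ < _)) => apply: definable_lt
  | |- definable (fun e => is_true (isint _)) => apply: definable_int
  | |- definable (fun e => _ = _) => apply: definable_eq
  | |- definable (fun e => _ -> _) => first [apply: definable_imp | apply: definable_all]
  | |- renaming (fun e => scons _ _) => apply: renaming_scons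
  | |- renaming _ => by eexists => ? ?; reflexivity
  | |- exists j, forall e, _ = e j => by eexists => ?; reflexivity
  end.
Ltac dp_tac := repeat dp_step.

Lemma definable_Rel : definable (fun e => Rel a (e 0%N) (e 1%N) (e 2%N) (e 3%N) (e 4%N) (e 5%N)).
Proof.
by rewrite /Rel /Sel /Dec /Exc /Hit /Low /Near0 /Near /isnat /One /pos; dp_tac.
Qed.

Lemma definable_isnat i : definable (fun e => isnat (e i)).
Proof. by rewrite /isnat; dp_tac. Qed.

Lemma definable_One i : definable (fun e => One (e i)).
Proof. by rewrite /One /pos; dp_tac. Qed.

(** * Graphs of recursive functions *)

Definition isv n (e : nat -> R) (v : n.-tuple nat) := forall i : 'I_n, e i = (tnth v i)%:R.
Definition Graph n (f : n.-tuple nat -> nat) (e : nat -> R) :=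
  exists2 v, isv (rtail e) v & e 0%N = (f v)%:R.

Lemma nat_tuple n (e : nat -> R) :
  (forall i, (i < n)%N -> isnat (e i)) <-> exists v : n.-tuple nat, isv e v.
Proof.
split=> [H|[v vE] i lti]; last by apply/isnatP; exists (tnth v (Ordinal lti)); rewrite -vE.
have /boolp.choice [g gP] : forall i : nat, exists m : nat, (i < n)%N -> e i = m%:R.
  move=> i; have [lti|] := ltnP i n; last by exists 0%N.
  by have /isnatP[m E] := H i lti; exists m.
by exists [tuple g i | i < n] => i; rewrite tnth_mktuple gP.
Qed.

Lemma isv_inj n e (v w : n.-tuple nat) : isv e v -> isv e w -> v = w.
Proof.
move=> Ev Ew; apply: eq_from_tnth => i; apply/eqP.
by rewrite -(eqr_nat R) -Ev -Ew.
Qed.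

Lemma isv_cons n (e : nat -> R) y (v : n.-tuple nat) :
  isv e [tuple of y :: v] <-> e 0%N = y%:R /\ isv (rtail e) v.
Proof.
split=> [H|[H0 H] i].
  split; first by have := H ord0.
  by move=> i; have := H (lift ord0 i); rewrite /= /rtail tnthS.
case: (unliftP ord0 i) => [j ->|->]; last by rewrite H0.
by have := H j; rewrite tnthS.
Qed.

Lemma isv_cons_inv n (e : nat -> R) (w : n.+1.-tuple nat) : isv e w ->
  exists y (v : n.-tuple nat), [/\ w = [tuple of y :: v], e 0%N = y%:R & isv (rtail e) v].
Proof.
case/tupleP: w => y v Hw; exists y, v; case/isv_cons: Hw => h1 h2; split=> //.
Qed.

Lemma Graph_eq n (f : n.-tuple nat -> nat) e (v : n.-tuple nat) :
  isv (rtail e) v -> Graph f e <-> e 0%N = (f v)%:R.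
Proof. by move=> Hv; split=> [[w /(isv_inj Hv) <-]|E] //; exists v. Qed.

Arguments Graph_eq {n f e} v.

Lemma definable_nats n k : definable (fun e => forall i, (i < n)%N -> isnat (e (k + i)%N)).
Proof. by apply: definable_forall_lt => i _; exact: definable_isnat. Qed.

Fixpoint cat_env m (w e : nat -> R) : nat -> R :=
  if m is m'.+1 then scons (w 0%N) (cat_env m' (rtail w) e) else e.

Lemma cat_envl m w e i : (i < m)%N -> cat_env m w e i = w i.
Proof. by elim: m w i => // m IH w [|i] //= lti; rewrite IH. Qed.

Lemma cat_envr m w e i : cat_env m w e (m + i)%N = e i.
Proof. by elim: m w => //= m IH w. Qed.

Lemma definable_ex_cat m P : definable P -> definable (fun e => exists w, P (cat_env m w e)).
Proof.
elim: m P => [|m IH] P dP.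
  by apply: definable_ext dP => e; split=> [Pe|[_ //]]; exists e.
apply: (@definable_ext (fun e => exists w, exists c, P (scons c (cat_env m w e)))).
  move=> e; split=> [[w [c H]]|[w H]]; first by exists (scons c w).
  by exists (rtail w), (w 0%N).
apply: (IH (fun e => exists c, P (scons c e))); apply: definable_ex; apply: (definable_VR dP).
by apply: renaming_scons; [eexists => ?; reflexivity | eexists => ? ?; reflexivity].
Qed.

(** The [m] intermediate values are quantified together: [cat_env] puts them in front, which moves
    the entry for the result to position [m]. *)
Lemma Graph_comp m n (g : m.-tuple nat -> nat) (h : 'I_m -> n.-tuple nat -> nat) :
  definable (Graph g) -> (forall i, definable (Graph (h i))) ->
  definable (Graph (fun v => g [tuple h i v | i < m])).
Proof.
move=> dg dh.
pose G1 (E : nat -> R) := Graph g (scons (E m) E).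
pose G2 (i : 'I_m) (E : nat -> R) := Graph (h i) (scons (E i) (fun j => E (m.+1 + j)%N)).
apply: (@definable_ext (fun e => (forall i, (i < n)%N -> isnat (e (1 + i)%N)) /\
    exists w, G1 (cat_env m w e) /\ forall i : 'I_m, G2 i (cat_env m w e))).
  move=> e; have tailE w : (fun j => cat_env m w e (m.+1 + j)%N) = rtail e.
    by apply: funext => j; rewrite addSnnS cat_envr.
  have key (v : n.-tuple nat) w c : isv (rtail e) v ->
      isv (rtail (scons c (fun j => cat_env m w e (m.+1 + j)%N))) v.
    by rewrite -[rtail (scons _ _)]/(fun j => cat_env m w e (m.+1 + j)%N) tailE.
  have em w : cat_env m w e m = e 0%N by have := cat_envr m w e 0; rewrite addn0.
  split=> [[/nat_tuple[v vE] [w [HG1 HG2]]]|[v vE E0]].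
    have {}vE : isv (rtail e) v by move=> i; exact: vE.
    exists v => //; move: HG1; rewrite /G1.
    have wE : isv (cat_env m w e) [tuple h i v | i < m].
      by move=> i; rewrite tnth_mktuple; have /(Graph_eq v) := HG2 i; apply; exact: key.
    by move/(Graph_eq [tuple h i v | i < m])=> /(_ wE); rewrite /= em.
  split; first by apply/nat_tuple; exists v.
  pose w (i : nat) : R := if insub i is Some j then (h j v)%:R else 0.
  have wE (i : 'I_m) : w i = (h i v)%:R.
    by rewrite /w insubT //= => lt; congr (h _ v)%:R; apply: val_inj.
  exists w; split.
    exists [tuple h i v | i < m]; last by rewrite /= em.
    by move=> i; rewrite -[rtail _]/(cat_env m w e) cat_envl // wE tnth_mktuple.
  by move=> i; exists v; [exact: key | rewrite /= cat_envl // wE].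
apply: definable_and; first exact: definable_nats.
apply: (@definable_ex_cat m (fun E => G1 E /\ forall i, G2 i E)); apply: definable_and.
  by apply: (definable_VR dg); apply: renaming_scons; eexists => *; reflexivity.
apply: (@definable_ext (fun E => forall i, (i < m)%N -> forall j : 'I_m, j = i :> nat -> G2 j E)).
  by move=> E; split=> [H i|H i _ j _]; [exact: H (ltn_ord i) i erefl | exact: H].
apply: definable_forall_lt => i lti.
apply: (@definable_ext (G2 (Ordinal lti))).
  move=> E; split=> [H j ji|]; last by apply.
  by rewrite (_ : j = Ordinal lti) //; exact: val_inj.
by apply: (definable_VR (dh _)); apply: renaming_scons; eexists => *; reflexivity.
Qed.

Hypothesis nq : forall u v w : int, u != 0 -> u%:~R * (a * a) + v%:~R * a + w%:~R != 0 :> R.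

(** [f] takes the value [z] at [y] exactly if some coded relation contains [(y, z)] and each of its
    pairs is justified by the base case or by another of its pairs. Here [x + x = x] stands for
    [x = 0]. *)
Lemma Graph_prim n (g : n.-tuple nat -> nat) (h : n.+2.-tuple nat -> nat) (f : n.+1.-tuple nat -> nat) :
  definable (Graph g) -> definable (Graph h) ->
  (forall v : n.-tuple nat, f [tuple of 0%N :: v] = g v) ->
  (forall y (v : n.-tuple nat),
     f [tuple of y.+1 :: v] = h [tuple of y :: f [tuple of y :: v] :: v]) ->
  definable (Graph f).
Proof.
move=> dg dh f0 fS.
apply: (@definable_ext (fun e => (forall i, (i < n)%N -> isnat (e (2 + i)%N)) /\
  exists del d L S, Rel a del d L S (e 1%N) (e 0%N) /\ forall x u, Rel a del d L S x u ->
   (x + x = x /\ Graph g (scons u (fun i => e i.+2))) \/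
   exists x' u' o, [/\ One o, x = x' + o, Rel a del d L S x' u' &
     Graph h (scons u (scons x' (scons u' (fun i => e i.+2))))])).
  move=> e; split.
  - move=> [/nat_tuple[v vE] [del [d [L [S [Hyz H]]]]]].
    have {}vE : isv (fun i => e i.+2) v by move=> i; exact: vE.
    have [/isnatP[y Ey] /isnatP[z Ez] _] := Hyz.
    (* The parameters are arbitrary reals, so the coded relation may be anything; justification of
       its pairs alone forces them onto the graph. *)
    have main k u : Rel a del d L S k%:R u -> u = (f [tuple of k :: v])%:R.
      elim: k u => [|k IH] u /H[[xx HG]|[x' [u' [o [/OneP-> E0 HR HG]]]]].
      + by have /= -> := (@Graph_eq _ g (scons u _) v vE).1 HG; rewrite f0.
      + have [/isnatP[m Em] _ _] := HR; move: E0; rewrite Em => /eqP.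
        by rewrite natr1 eqr_nat.
      + by move/eqP: xx; rewrite -subr_eq0 addrK pnatr_eq0.
      + have Ex : x' = k%:R by apply: (addIr 1); rewrite -E0 natr1.
        rewrite Ex in HR HG; have Eu := IH _ HR.
        have hv : isv (scons k%:R (scons u' (fun i => e i.+2))) [tuple of k :: f [tuple of k :: v] :: v].
          by apply/isv_cons; split=> //; apply/isv_cons; split.
        by have /= -> := (@Graph_eq _ h (scons u _) _ hv).1 HG; rewrite fS.
    exists [tuple of y :: v]; first by apply/isv_cons; split.
    by apply: main; rewrite -Ey.
  - move=> [w Hw Ez]; have [y [v [Ew Ey vE]]] := isv_cons_inv Hw; rewrite {}Ew {w Hw} in Ez.
    split; first by apply/nat_tuple; exists v => i; exact: vE.
    pose l := [seq (k, f [tuple of k :: v]) | k <- iota 0 y.+1].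
    have [del [d [L [S lP]]]] := finite_relation_coded nq l.
    exists del, d, L, S; split.
      apply/lP; exists (y, f [tuple of y :: v]); last by [].
      by apply/mapP; exists y; rewrite // mem_iota add0n ltnSn.
    move=> x u /lP[p /mapP[k]]; rewrite mem_iota add0n => /= ltk -> /= [-> ->].
    case: k ltk => [|k] ltk; [left | right].
      by rewrite addr0; split=> //; exists v => //; rewrite /= f0.
    exists k%:R, (f [tuple of k :: v])%:R, 1; split.
    + exact/OneP.
    + by rewrite natr1.
    + apply/lP; exists (k, f [tuple of k :: v]); last by [].
      by apply/mapP; exists k; rewrite // mem_iota add0n (ltnW ltk).
    + exists [tuple of k :: f [tuple of k :: v] :: v]; last by rewrite /= fS.
      by apply/isv_cons; split=> //; apply/isv_cons; split.
apply: definable_and; first exact: definable_nats.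
have dRel i1 i2 i3 i4 i5 i6 : definable (fun e => Rel a (e i1) (e i2) (e i3) (e i4) (e i5) (e i6)).
  have := @definable_VR _ (fun e i => nth (e 0%N) [:: e i1; e i2; e i3; e i4; e i5; e i6] i) definable_Rel; apply.
  by exists (fun i => nth 0%N [:: i1; i2; i3; i4; i5; i6] i) => e; do 7![case=> //].
do 4!apply: definable_ex; apply: definable_and; first exact: dRel.
do 2!apply: definable_all; apply: definable_imp; first exact: dRel.
apply: definable_or.
  by apply: definable_and; [dp_tac | apply: (definable_VR dg); dp_tac].
do 3!apply: definable_ex; apply: definable_and4.
- exact: definable_One.
- by dp_tac.
- exact: dRel.
- by apply: (definable_VR dh); dp_tac.
Qed.

Lemma Graph_min n (g : n.+1.-tuple nat -> nat) (f : n.-tuple nat -> nat) :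
  definable (Graph g) ->
  (forall v : n.-tuple nat, g [tuple of f v :: v] = 0%N) ->
  (forall (v : n.-tuple nat) y, (y < f v)%N -> g [tuple of y :: v] <> 0%N) ->
  definable (Graph f).
Proof.
move=> dg f1 f2.
apply: (@definable_ext (fun e => (forall i, (i < n)%N -> isnat (e (1 + i)%N)) /\ [/\ isnat (e 0%N),
  exists2 z, z + z = z & Graph g (scons z e) &
  forall y, isnat y -> y < e 0%N -> exists2 z, ~ (z + z = z) & Graph g (scons z (scons y (rtail e)))])).
  move=> e; split.
  - move=> [/nat_tuple[v vE] [/isnatP[y Ey] [z Ez Gz] H]].
    have {}vE : isv (rtail e) v by move=> i; exact: vE.
    exists v => //; rewrite Ey; congr (_%:R).
    have gy : g [tuple of y :: v] = 0%N.
      move: Gz => /(Graph_eq [tuple of y :: v]) /= E; apply/eqP.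
      rewrite -(eqr_nat R) -E; last by apply/isv_cons.
      by move/eqP: Ez; rewrite -subr_eq0 addrK.
    case: (ltngtP y (f v)) => // lt; first by case: (f2 v y).
    have [||z' nz] := H (f v)%:R; first by apply/isnatP; exists (f v).
      by rewrite Ey ltr_nat.
    move/(Graph_eq [tuple of f v :: v]) => /= E; case: nz.
    by rewrite E ?f1 ?addr0 //; apply/isv_cons.
  - move=> [v vE E0]; split; first by apply/nat_tuple; exists v => i; exact: vE.
    split; first by apply/isnatP; exists (f v).
      exists 0; first by rewrite addr0.
      by exists [tuple of f v :: v]; [apply/isv_cons | rewrite f1].
    move=> _ /isnatP[y ->]; rewrite E0 ltr_nat => lt.
    exists (g [tuple of y :: v])%:R.
      by move/eqP; rewrite -subr_eq0 addrK pnatr_eq0 => /eqP; exact: f2.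
    by exists [tuple of y :: v] => //; apply/isv_cons.
apply: definable_and; first exact: definable_nats.
apply: definable_and3; first exact: definable_isnat.
  by apply: definable_ex2; [dp_tac | apply: (definable_VR dg); dp_tac].
apply: definable_all; apply: definable_imp; first exact: definable_isnat.
apply: definable_imp; first by dp_tac.
by apply: definable_ex2; [dp_tac | apply: (definable_VR dg); dp_tac].
Qed.

Lemma recursive_definable n (f : n.-tuple nat -> nat) : recursive f -> definable (Graph f).
Proof.
elim=> {n f}.
- move=> n; apply: (@definable_ext (fun e => (forall i, (i < n)%N -> isnat (e (1 + i)%N)) /\ e 0%N + e 0%N = e 0%N)).
    move=> e; split=> [[/nat_tuple[v vE] E]|[v vE E]].
      by exists v => //; apply: (addrI (e 0%N)); rewrite addr0.
    by split; [apply/nat_tuple; exists v | rewrite E addr0].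
  by apply: definable_and; [exact: definable_nats | dp_tac].
- apply: (@definable_ext (fun e => isnat (e 1%N) /\ exists2 o, One o & e 0%N = e 1%N + o)).
    move=> e; split=> [[/isnatP[m Em] [o /OneP-> E]]|[v vE E]].
      exists [tuple m]; first by move=> i; rewrite ord1.
      by rewrite E Em natr1.
    have := vE ord0; rewrite /rtail /= => E1.
    split; first by apply/isnatP; exists (tnth v ord0).
    by exists 1; [exact/OneP | rewrite E E1 natr1].
  apply: definable_and; first exact: definable_isnat.
  by apply: definable_ex2; [exact: definable_One | dp_tac].
- move=> n i; apply: (@definable_ext (fun e => (forall j, (j < n)%N -> isnat (e (1 + j)%N)) /\ e 0%N = e i.+1)).
    move=> e; split=> [[/nat_tuple[v vE] E]|[v vE E]].
      by exists v => //; rewrite E -(vE i).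
    by split; [apply/nat_tuple; exists v | rewrite E -(vE i)].
  by apply: definable_and; [exact: definable_nats | dp_tac].
- by move=> m n g h _ dg _ dh; exact: Graph_comp.
- by move=> n g h f _ dg _ dh f0 fS; exact: Graph_prim dg dh f0 fS.
- by move=> n g f _ dg f1 f2; exact: Graph_min dg f1 f2.
Qed.

End Definable.

(** * Undecidability *)

Section Undecidability.
Variables (R : realType) (a : R).
Hypothesis nq : forall u v w : int, u != 0 -> u%:~R * (a * a) + v%:~R * a + w%:~R != 0 :> R.

(** All variables are renamed to [k]. The formula may still mention others, but its truth does not
    depend on them, so binding them existentially changes nothing. *)
Lemma definable_closed P k : definable a P -> exists p, {subset free_vars p <= [:: k]} /\
  forall e, @sat (S_ a) e p <-> P (fun=> e k).
Proof.
move=> [_ /(_ (fun=> k)) [p pE]].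
have free_ex xs : free_vars (foldr FEx p xs) = [seq y <- free_vars p | y \notin xs].
  elim: xs => [|x xs IH] /=; first by rewrite filter_predT.
  by rewrite IH -filter_predI; apply: eq_filter => y; rewrite /= inE negb_or.
have sat_ex xs : k \notin xs -> forall e, @sat (S_ a) e (foldr FEx p xs) <-> P (fun=> e k).
  elim: xs => [|x xs IH] /=; first by move=> _ e; exact: pE.
  rewrite inE negb_or => /andP[kx /IH H] e.
  have upd_k c : update e x c k = e k by rewrite /update (negbTE kx).
  split=> [[c /H]|Pe]; first by rewrite upd_k.
  by exists (e 0%N); apply/H; rewrite upd_k.
pose xs := [seq x <- free_vars p | x != k].
exists (foldr FEx p xs); split; last by apply: sat_ex; rewrite mem_filter eqxx.
move=> y; rewrite free_ex mem_filter inE => /andP[ny yp].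
by apply: contraNT ny => yk; rewrite mem_filter yk.
Qed.

Lemma eval_numeral n e : @eval (S_ a) e (numeral n) = e 1%N *+ n.+1.
Proof. by elim: n => //= n ->; rewrite -mulrSr. Qed.

Lemma sat_diag one phi (Q : R -> Prop) e :
  (forall e, @sat (S_ a) e one <-> e 1%N = 1) ->
  (forall e, @sat (S_ a) e phi <-> Q (e 0%N)) ->
  @sat (S_ a) e (diag one phi) <-> Q (formula_code phi)%:R.
Proof.
move=> oneP phiP; split=> [[c [/oneP]]|Qn].
  rewrite {1}/update /= => c1 [d []].
  rewrite eval_numeral /update /= c1 mulrSr => /addIr -> /phiP.
  by [].
exists 1; split; first exact/oneP.
exists (formula_code phi)%:R; split; last exact/phiP.
by rewrite /= eval_numeral /update /= mulrSr.
Qed.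

(** For a suitable [phi], [diag one phi] is true exactly if the supposed decision function takes the
    value 0 at the code of [diag one phi] itself. *)
Lemma theory_undecidable : ~ decidable_theory (theory (S_ a)).
Proof.
move=> [f [rf f1 f0]].
have [one [fv1 oneE]] := @definable_closed _ 1%N (definable_One a 0).
have {}oneE e : @sat (S_ a) e one <-> e 1%N = 1 by rewrite oneE OneP.
(* [T n] is the verdict on the diagonal sentence built from the formula with code [n]; [phi] will
   define [T n = 0]. *)
pose o := formula_code one; pose T n := f [tuple diag_code o n].
have rT : recursive (fun v : 1.-tuple nat => T (thead v)).
  apply: recursive_Rec; apply: (Rec_comp1 (f := fun n => f [tuple n])); last first.
    by rewrite /diag_code; rec_solve; apply: Rec_numeral; rec_solve.
  exists 1%N, f; split=> // e; congr f.
  by apply: eq_from_tnth => i; rewrite ord1 tnth_mktuple.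
pose Q (e : nat -> R) := exists2 z, z + z = z & Graph (fun v : 1.-tuple nat => T (thead v)) (scons z e).
have dQ : definable a Q.
  have dT := recursive_definable nq rT.
  apply: definable_ex2; first by apply: definable_eq; [apply: definable_term_add|]; exact: definable_term_var.
  apply: (definable_VR dT); apply: renaming_scons; last by eexists => ? ?; reflexivity.
  by eexists => ?; reflexivity.
have QE n : Q (fun=> n%:R) <-> T n = 0%N.
  have hn : isv (rtail (scons 0 (fun=> n%:R : R))) [tuple n] by move=> i; rewrite ord1.
  split=> [[z zz [v vE zE]]|Tn]; last first.
    exists 0; first by rewrite addr0.
    by exists [tuple n]; rewrite //= Tn.
  rewrite (isv_inj vE hn) /= in zE; apply/eqP; rewrite -(eqr_nat R) -zE.
  by apply/eqP; apply: (addrI z); rewrite addr0.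
have [phi [fv0 phiE]] := definable_closed 0 dQ.
pose n := formula_code phi.
have chiE e : @sat (S_ a) e (diag one phi) <-> T n = 0%N.
  rewrite (sat_diag (Q := fun x => Q (fun=> x)) e oneE) //; exact: QE.
have codeE : diag_code o n = formula_code (diag one phi) by rewrite diag_codeE.
case: (pselect (exists2 p, theory (S_ a) p & formula_code p = diag_code o n)) => [In|Out].
  have [p [_ hp]] := In; rewrite codeE => /formula_code_inj pE.
  have : T n = 1%N by exact: f1.
  by rewrite pE in hp; have /chiE -> := hp (fun=> 0).
have Tn : T n = 0%N := f0 _ Out.
have th : theory (S_ a) (diag one phi) by split=> [|e]; [exact: sentence_diag | apply/chiE].
exact: Out (ex_intro2 _ _ _ th (esym codeE)).
Qed.

End Undecidability.

Theorem theoremA (R : realType) (a : R) :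
  decidable_theory (theory (S_ a)) <-> quadratic a.
Proof.
split; last exact: quadratic_decidable.
move=> dec; apply: contrapT => nquad; apply: (@theory_undecidable R a) dec.
move=> u v w u0; apply/eqP => E; apply: nquad.
exists u%:~R, v%:~R, w%:~R; rewrite intr_eq0 !ratr_int expr2; split=> //.
Qed.
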